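(* For all $d\ge1$, let $(u_d(k))_{k\ge1}$ be an independent family of uniformly distributed random vectors on the unit sphere of $\mathbb{C}^d$. Then for all $\lambda\ge0$, the spectral distribution of the $d\times d$ Hermitian random matrix $$\sum_{k=1}^{d'}u_d(k)u_d(k)^*$$ converges in probability to the Marchenko–Pastur distribution with index $\lambda$ when $d,d'$ tend to infinity and the ratio $d'/d$ tends to $\lambda$.
   Context: The spectral distribution of a Hermitian matrix is the uniform distribution on its spectrum (with multiplicity). The Marchenko–Pastur distribution with index $\lambda$ is the image under the Bercovici–Pata bijection of the classical Poisson distribution with parameter $\lambda$, i.e. the free Poisson law of rate $\lambda$ and jump size $1$: the probability measure on $\mathbb{R}$ all of whose free cumulants equal $\lambda$ (for $\lambda=0$ it is $\delta_0$). A family $(\rho_{d,d'})$ of random probability measures converges in probability to a deterministic $\rho$ if for every $\varepsilon>0$, $\mathrm{P}(\mathrm{dist}(\rho_{d,d'},\rho)>\varepsilon)\to0$, where $\mathrm{dist}$ is a metric for weak convergence, e.g. $\mathrm{dist}(\rho,\rho')=\sup_{\Im z\ge1}\big|\int\frac{d\rho(u)}{u-z}-\int\frac{d\rho'(u)}{u-z}\big|$. *)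

(* Defs.v *)
From HB Require Import structures.
From mathcomp Require Import all_boot all_order all_algebra.
From mathcomp Require Import all_classical all_reals all_analysis.
From mathcomp Require Import complex.

Set Implicit Arguments.
Unset Strict Implicit.
Unset Printing Implicit Defensive.

Import Order.TTheory GRing.Theory Num.Theory.
Import numFieldNormedType.Exports.

Local Open Scope classical_set_scope.
Local Open Scope ring_scope.
Local Open Scope sesquilinear_scope.
Local Open Scope complex_scope.

(* C^d with its Borel sigma-algebra. The exponent ^o gives access to the
   topology that every numFieldType carries. *)
Definition Cvec (R : realType) (d : nat) :=
  g_sigma_algebraType (@open 'cV[(R[i])^o]_d).

Definition unit_Csphere (R : realType) (d : nat) : set (Cvec R d) :=
  [set x : 'cV[R[i]]_d | \sum_i `|x i 0| ^+ 2 = 1].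

(* The unitary group acts transitively on the unit sphere, which therefore
   carries exactly one unitarily invariant Borel probability measure: the
   uniform distribution (normalized surface measure). *)
Definition uniform_on_Csphere (R : realType) (d : nat)
    (mu : probability (Cvec R d) R) : Prop :=
  mu (@unit_Csphere R d) = 1%E /\
  forall U : 'M[R[i]]_d, U \is unitarymx ->
    forall A : set (Cvec R d), measurable A ->
      mu [set x : 'cV[R[i]]_d | A (U *m x)] = mu A.

Definition mutually_independent (R : realType) (d d' : measure_display)
    (T : measurableType d) (T' : measurableType d') (P : probability T R)
    (X : nat -> {mfun T >-> T'}) : Prop :=
  forall (s : seq nat) (A : nat -> set T'), uniq s ->
    (forall k, k \in s -> measurable (A k)) ->
    P (\bigcap_(k in [set` s]) X k @^-1` A k) =
    (\prod_(k <- s) P (X k @^-1` A k))%E.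

Section SpectralDistribution.
Variables (R : realType) (d : nat).

(* For a normal matrix M (in particular a Hermitian one), [spectral_diag M]
   lists the eigenvalues of M with multiplicity; they are real when M is
   Hermitian. *)
Definition eigenvalues (M : 'M[R[i]]_d) : seq R :=
  [seq complex.Re (spectral_diag M 0 i) | i : 'I_d].

Definition spectral_distribution (M : 'M[R[i]]_d) : {measure set R -> \bar R} :=
  mscale (d%:R^-1)%:nng (msum (fun k => \d_(nth 0 (eigenvalues M) k)) d).

End SpectralDistribution.

Definition noncrossing (n : nat) (pi : {set {set 'I_n}}) : bool :=
  [forall B in pi, forall C in pi, (B != C) ==>
    ~~ [exists i in B, exists j in C, exists k in B, exists l in C,
          [&& (i < j)%N, (j < k)%N & (k < l)%N]]].

(* The moment-cumulant formula determines the free cumulants kappa n, n >= 1,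
   of mu from its moments; kappa 0 plays no role. *)
Definition has_free_cumulants (R : realType) (mu : probability R R)
    (kappa : nat -> R) : Prop :=
  forall n : nat,
    mu.-integrable setT (fun x : R => (x ^+ n)%:E) /\
    \int[mu]_x (x ^+ n) =
    \sum_(pi : {set {set 'I_n}} | finset.partition pi [set: 'I_n]%SET && noncrossing pi)
      \prod_(B in pi) kappa #|B|.

(* The law is determined by this property: the moments it prescribes grow at
   most geometrically. *)
Definition is_marchenko_pastur (R : realType) (lambda : R)
    (mu : probability R R) : Prop :=
  has_free_cumulants mu (fun=> lambda).

Section StieltjesDistance.
Variable R : realType.

Definition stieltjes (mu : {measure set R -> \bar R}) (z : R[i]) : R[i] :=
  (\int[mu]_x complex.Re ((x%:C - z)^-1)) +i* (\int[mu]_x complex.Im ((x%:C - z)^-1)).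

Definition dist (mu nu : {measure set R -> \bar R}) : \bar R :=
  ereal_sup [set (Normc.normc (stieltjes mu z - stieltjes nu z))%:E |
    z in [set z : R[i] | 1 <= complex.Im z]].

End StieltjesDistance.

Definition sum_rank_one (R : realType) (d m : nat) (x : nat -> 'cV[R[i]]_d) :
    'M[R[i]]_d :=
  \sum_(k < m) x k *m (x k)^t*.

(* Main.v *)
Require Import Defs.
From HB Require Import structures.
From mathcomp Require Import all_boot all_order all_algebra.

(* Let s(z) = tr((A - z)^-1) / d be the Stieltjes transform of the spectral
   distribution of A = \sum_(k < N) x_k x_k^*, and c = N / d. Writing A_k for A
   without its k-th summand and H_k = (A_k - z)^-1, the Sherman-Morrison formula
   turns the trace of (A - z) (A - z)^-1 = 1 into
     1 + z s = d^-1 \sum_k q_k / (1 + q_k),   q_k = x_k^* H_k x_k.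
   Since x_k is independent of H_k and uniform on the sphere, q_k has variance
   O(1/d) around tr H_k / d, which is within O(1/d) of s. Hence s satisfies
   1 + z s = c s / (1 + s) up to an error that tends to 0 in probability. This
   equation is stable: among solutions in the upper half plane, s is close to the
   solution m of z m^2 + (z + 1 - lambda) m + 1 = 0.
   The Stieltjes transform m of the Marchenko-Pastur distribution solves that
   equation: removing the block of the first point gives a quadratic recursion for
   the weighted number of noncrossing partitions, that is for the moments, and the
   expansion of 1 / (x - z) about a point far below the real axis converges for all
   Im z >= 1 and turns the recursion into the equation.
   Pointwise convergence suffices because s and m are Lipschitz on Im z >= 1 and
   s - m = O(1/|z|), so that dist is controlled by a finite net of points z. *)

Set Implicit Arguments.
Unset Strict Implicit.
Unset Printing Implicit Defensive.

Import Order.TTheory GRing.Theory Num.Theory.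

(** The Gram matrices are positive semidefinite, so not only [s] and [q_k] but also [z s] and
    [z q_k] have nonnegative imaginary part; with [1 <= Im z] this bounds [1 / (1 + s)] and
    [1 / (1 + q_k)] by [|z|] and makes every denominator harmless. The limit law is given through
    its free cumulants alone: neither a density nor a bounded support is at hand, only moments of at
    most geometric growth. An expansion of its resolvent at infinity would reach only large [|z|]
    and leave an analytic continuation to be done. Recentring the expansion at a point below the
    real axis avoids this, since the moments about that point obey a recursion of the same kind. For
    the variance of [q_k] an upper bound on the fourth moments of the sphere is enough, and
    permutations together with one reflection provide it. Independence is assumed for finite
    families of events; it has to be extended to the sigma-algebra generated by all vectors but one
    before Tonelli's theorem applies. *)

Section PartitionElements.
Variable T : finType.
Implicit Types (P : {set {set T}}) (D B C : {set T}).

Lemma partition_elemP P D :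
  reflect [/\ forall x, x \in D -> exists2 B, B \in P & x \in B,
              forall B, B \in P -> B \subset D,
              forall B C x, B \in P -> C \in P -> x \in B -> x \in C -> B = C
            & set0 \notin P]
          (partition P D).
Proof.
apply: (iffP and3P) => [[/eqP cP tP nP]|[cP sP tP nP]]; split => //.
- by move=> x; rewrite -cP => /bigcupP[B BP xB]; exists B.
- by move=> B BP; rewrite -cP; apply: (bigcup_sup B).
- move=> B C x BP CP xB xC.
  by rewrite -(def_pblock tP BP xB) (def_pblock tP CP xC).
- rewrite eqEsubset; apply/andP; split; first by apply/bigcupsP => B /sP.
  by apply/subsetP => x /cP[B BP xB]; apply/bigcupP; exists B.
- apply/trivIsetP => B C BP CP neBC; rewrite -setI_eq0; apply/set0Pn => -[x].
  by rewrite inE => /andP[xB xC]; move/eqP: neBC; apply; exact: tP xB xC.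
Qed.

End PartitionElements.

(** * Noncrossing partitions and the recursion for their weighted number *)

Lemma noncrossingP n (pi : {set {set 'I_n}}) :
  reflect (forall B C i j k l, B \in pi -> C \in pi ->
             i \in B -> j \in C -> k \in B -> l \in C ->
             (i < j)%N -> (j < k)%N -> (k < l)%N -> B = C)
          (noncrossing pi).
Proof.
apply: (iffP forall_inP) => [H B C i j k l BP CP iB jC kB lC ij jk kl|H B BP].
  have /forall_inP/(_ _ CP)/implyP neBC := H _ BP.
  apply/eqP; case: eqP => // /eqP /neBC /existsP[]; exists i; rewrite iB /=.
  apply/existsP; exists j; rewrite jC /=; apply/existsP; exists k.
  by rewrite kB /=; apply/existsP; exists l; rewrite lC ij jk kl.
apply/forall_inP => C CP; apply/implyP => neBC; apply/negP.
case/exists_inP => i iB /exists_inP[j jC] /exists_inP[k kB] /exists_inP[l lC].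
by case/and3P => ij jk kl; move/eqP: neBC; apply; exact: (H _ _ i j k l).
Qed.

Section NoncrossingWeights.
Variable R : comNzRingType.
Variable lam : R.
Local Open Scope ring_scope.

Definition nc_partition n (A : {set 'I_n}) (pi : {set {set 'I_n}}) :=
  partition pi A && noncrossing pi.

(** All free cumulants of the law equal [lam], so the product over the blocks in the moment-cumulant
    formula is [lam ^+ #|pi|]. A subset [A] is allowed because the recursion cuts ['I_n] into
    intervals. *)
Definition nc_weight n (A : {set 'I_n}) : R :=
  \sum_(pi | nc_partition A pi) lam ^+ #|pi|.

Lemma imset_blocksK n m (f : 'I_n -> 'I_m) : injective f ->
  cancel (fun pi : {set {set 'I_n}} => [set f @: (B : {set _}) | B in pi])
         (fun pi => [set f @^-1: (B : {set _}) | B in pi]).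
Proof.
move=> finj pi; rewrite -imset_comp -[RHS]imset_id; apply: eq_imset => B /=.
by apply/setP => x; rewrite inE mem_imset.
Qed.

Lemma nc_partition_imset n m (f : 'I_n -> 'I_m) (A : {set 'I_n}) (pi : {set {set 'I_n}}) :
  {mono f : i j / (i < j)%N} -> injective f ->
  nc_partition (f @: A) [set f @: (B : {set _}) | B in pi] =
  nc_partition A pi.
Proof.
move=> fm finj.
have finj' : injective (fun B : {set 'I_n} => f @: B) by exact: imset_inj.
rewrite /nc_partition; congr andb.
  apply/partition_elemP/partition_elemP => -[cP sP tP nP]; split.
  - move=> x xA; have [|_ /imsetP[B BP ->]] := cP (f x); first by rewrite mem_imset.
    by rewrite mem_imset // => xB; exists B.
  - move=> B BP; have := sP (f @: B); rewrite mem_imset // => /(_ BP) /subsetP s.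
    by apply/subsetP => x xB; have := s (f x); rewrite !mem_imset // => /(_ xB).
  - move=> B C x BP CP xB xC; apply: (finj').
    by apply: (tP _ _ (f x)); rewrite ?(mem_imset _ _ finj') ?mem_imset.
  - by apply: contra nP => nP; apply/imsetP; exists set0 => //; rewrite imset0.
  - move=> _ /imsetP[x xA ->]; have [B BP xB] := cP x xA.
    by exists (f @: B); rewrite ?mem_imset.
  - by move=> _ /imsetP[B BP ->]; apply: imsetS; exact: sP.
  - move=> _ _ x /imsetP[B BP ->] /imsetP[C CP ->] /imsetP[y yB ->].
    by rewrite mem_imset // => yC; rewrite (tP B C y).
  - apply: contra nP => /imsetP[B BP /esym/eqP].
    by rewrite imset_eq0 => /eqP <-.
apply/noncrossingP/noncrossingP => [H B C i j k l BP CP iB jC kB lC ij jk kl|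
                                    H _ _ i j k l /imsetP[B BP ->] /imsetP[C CP ->]].
  apply: (finj'); apply: (H _ _ (f i) (f j) (f k) (f l)); rewrite ?(mem_imset _ _ finj') ?mem_imset //;
    by rewrite fm.
move=> /imsetP[i' iB ->] /imsetP[j' jC ->] /imsetP[k' kB ->] /imsetP[l' lC ->].
by rewrite !fm => *; rewrite (H B C i' j' k' l').
Qed.

Lemma nc_weight_imset n m (f : 'I_n -> 'I_m) (A : {set 'I_n}) :
  {mono f : i j / (i < j)%N} -> injective f ->
  nc_weight (f @: A) = nc_weight A.
Proof.
move=> fm finj; rewrite /nc_weight.
pose h (pi : {set {set 'I_n}}) := [set f @: (B : {set _}) | B in pi].
pose h' (pi : {set {set 'I_m}}) := [set f @^-1: (B : {set _}) | B in pi].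
rewrite (reindex_onto h h') => [|pi]; last first.
  case/andP => /partition_elemP[cP sP tP nP] _; rewrite /h /h' -imset_comp.
  rewrite -[RHS]imset_id; apply: eq_in_imset => B BP /=.
  apply/setP => x; apply/imsetP/idP => [[y]|xB]; first by rewrite inE => yB ->.
  have /subsetP /(_ _ xB) /imsetP[y yA exy] := sP _ BP.
  by exists y => //; rewrite inE -exy.
apply: eq_big => [pi|pi _]; last first.
  by rewrite card_imset //; exact: imset_inj.
by rewrite /h nc_partition_imset // /h' imset_blocksK // eqxx andbT.
Qed.

Lemma enum_val_mono n (A : {set 'I_n}) :
  {mono (@enum_val _ (mem A)) : i j / (i < j)%N}.
Proof.
have sA : sorted ltn (map val (enum A)).
  rewrite -[enum A]/(filter _ _); rewrite -enumT.
  apply: (subseq_sorted ltn_trans (s2 := map val (enum 'I_n))).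
    by apply: map_subseq; exact: filter_subseq.
  by rewrite val_enum_ord; exact: iota_ltn_sorted.
have lt (i j : 'I_#|A|) : (i < j)%N -> (@enum_val _ (mem A) i < @enum_val _ (mem A) j)%N.
  move=> ij; have x0 : 'I_n by exact: (enum_val i).
  rewrite !(enum_val_nth x0).
  have ltsz (k : 'I_#|A|) : (k < size (enum A))%N by rewrite -cardE.
  rewrite -!(nth_map x0 0%N (fun y : 'I_n => nat_of_ord y)) ?ltsz //.
  by apply: (sorted_ltn_nth ltn_trans) => //; rewrite inE size_map.
move=> i j; apply/idP/idP => [|/lt //].
case: (ltngtP i j) => // [/lt h1 h2|/val_inj ->]; last by rewrite ltnn.
by have := ltn_trans h1 h2; rewrite ltnn.
Qed.

(** Being noncrossing depends only on the relative order of the points, so the increasing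
    enumeration of [A] transports its partitions to those of an initial segment. *)
Lemma nc_weight_card n (A : {set 'I_n}) : nc_weight A = nc_weight [set: 'I_#|A|].
Proof.
rewrite -(@nc_weight_imset _ _ (@enum_val _ (mem A))); last 2 first.
- exact: enum_val_mono.
- exact: enum_val_inj.
congr nc_weight; apply/setP => x; apply/idP/imsetP => [xA|[i _ ->]].
  by exists (enum_rank_in xA x); rewrite // enum_rankK_in.
exact: (enum_valP i).
Qed.

Lemma nc_weight_set0 n : nc_weight (set0 : {set 'I_n}) = 1.
Proof.
rewrite /nc_weight (big_pred1 set0) ?cards0 ?expr0 // => pi.
rewrite /nc_partition partition_set0 /=; case: eqP => //= ->.
by apply/noncrossingP => B C i j k l; rewrite inE.
Qed.

Section Split.
Variable n : nat.
Implicit Types (pi : {set {set 'I_n.+1}}) (B C : {set 'I_n.+1}).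

Let full : {set 'I_n.+1} := [set: 'I_n.+1].
Let tail : {set 'I_n.+1} := [set i | i != ord0].

(** A crossing takes two points from each of its blocks, so the block [{0}] can be added or removed
    freely. *)
Lemma nc_partition_singleton :
  \sum_(pi | nc_partition full pi && ([set ord0] \in pi)) lam ^+ #|pi| =
  lam * nc_weight tail.
Proof.
rewrite /nc_weight big_distrr /=.
rewrite (reindex_onto (fun pi => [set ord0] |: pi) (fun pi => pi :\ [set ord0])) /=;
  last by move=> pi /andP[_ /setD1K].
have n0 pi : nc_partition tail pi -> [set ord0] \notin pi.
  case/andP => /partition_elemP[_ sP _ _] _; apply/negP => /sP /subsetP /(_ ord0).
  by rewrite !inE eqxx => /(_ isT).
apply: eq_big => [pi|pi /andP[_ /eqP H]]; last first.
  by rewrite -exprS (cardsD1 [set ord0]) H setU11 add1n.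
rewrite setU11 andbT; apply/andP/idP => [[/andP[pP ncP] /eqP e]|ncpi]; last first.
  have ns := n0 _ ncpi; rewrite setU1K // eqxx; split => //.
  case/andP: ncpi => /partition_elemP[cP sP tP nP] /noncrossingP ncP.
  apply/andP; split; last first.
    apply/noncrossingP => B C i j k l.
    case/setU1P => [->|BP]; case/setU1P => [->|CP] //; rewrite ?inE.
    - by move=> /eqP -> _ /eqP ->; move=> _ h1 h2; have := ltn_trans h1 h2; rewrite ltnn.
    - by move=> _ /eqP -> _ /eqP ->; move=> _ h1 h2; have := ltn_trans h1 h2; rewrite ltnn.
    - exact: ncP.
  have tl B x : B \in pi -> x \in B -> x != ord0.
    by move=> /sP /subsetP s /s; rewrite inE.
  apply/partition_elemP; split.
  - move=> x _; have [->|x0] := eqVneq x ord0.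
      by exists [set ord0]; rewrite ?inE ?eqxx.
    by have [|B BP xB] := cP x; rewrite ?inE //; exists B; rewrite // inE BP orbT.
  - by move=> B _; apply: subsetT.
  - move=> B C x; case/setU1P => [->|BP]; case/setU1P => [->|CP] //.
    + by rewrite inE => /eqP -> /(tl _ _ CP); rewrite eqxx.
    + by move=> xB; rewrite inE => /eqP x0; have := tl _ _ BP xB; rewrite x0 eqxx.
    + exact: tP.
  - rewrite in_setU1 negb_or nP andbT; apply/eqP => /esym /setP /(_ ord0).
    by rewrite !inE eqxx.
have inpi B : B \in pi -> B \in [set ord0] |: pi by rewrite inE => ->; rewrite orbT.
have ns : [set ord0] \notin pi by rewrite -e setD11.
move/partition_elemP: pP => [cP sP tP nP]; move/noncrossingP: ncP => ncP.
apply/andP; split; last first.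
  by apply/noncrossingP => B C i j k l /inpi BP /inpi CP; apply: ncP.
apply/partition_elemP; split.
- move=> x; rewrite inE => x0; have [|B] := cP x; first by rewrite inE.
  by rewrite inE => /orP[/set1P ->|]; [rewrite inE (negPf x0)|exists B].
- move=> B BP; apply/subsetP => x xB; rewrite inE; apply/eqP => x0.
  move: ns; rewrite (tP [set ord0] B ord0) ?BP ?inE ?eqxx //.
    by rewrite BP orbT.
  by rewrite -x0.
- by move=> B C x /inpi BP /inpi CP; apply: tP.
- by apply: contra nP => /inpi.
Qed.

Variable j : 'I_n.+1.
Hypothesis j_gt0 : (0 < j)%N.

Let A1 : {set 'I_n.+1} := [set i : 'I_n.+1 | (0 < i < j)%N].
Let A2 : {set 'I_n.+1} := [set i : 'I_n.+1 | (j <= i)%N].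

(* Expresses that [j] is the second smallest element of the block of [0]; cutting
   that block before [j] leaves noncrossing partitions of [{1, .., j - 1}] and of
   [{j, .., n}], and every such pair arises once. *)
Definition second_of_first pi :=
  [exists B in pi, [&& ord0 \in B, j \in B & [disjoint B & A1]]].

Lemma second_of_firstP pi :
  reflect (exists2 B, B \in pi & [/\ ord0 \in B, j \in B &
             forall i : 'I_n.+1, i \in B -> i != ord0 -> (j <= i)%N])
          (second_of_first pi).
Proof.
apply: (iffP exists_inP) => -[B BP].
  case/and3P => B0 Bj /pred0P dis; exists B => //; split => // i iB i0.
  have := dis i; rewrite /= iB inE lt0n -val_eqE /= in i0 *.
  by rewrite i0 /= ltnNge => /negbFE.
case=> B0 Bj H; exists B => //; rewrite B0 Bj /=; apply/pred0P => i /=.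
apply/negP => /andP[iB]; rewrite inE => /andP[i0].
by rewrite ltnNge H // -val_eqE /= -lt0n.
Qed.

(** [pi ::&: A] keeps the blocks contained in [A]. Once [0] is cut off, its block is recognised as
    the one that contains [j]; this tells [glue] where [0] has to be put back. *)
Let glue (p : {set {set 'I_n.+1}} * {set {set 'I_n.+1}}) :=
  (ord0 |: pblock p.2 j) |: (p.1 :|: (p.2 :\ pblock p.2 j)).
Let cut pi :=
  (pi ::&: A1, (pblock pi ord0 :\ ord0) |: (pi ::&: A2)).

Let A1A2 x : x \in A1 -> x \in A2 -> False.
Proof. by rewrite !inE => /andP[_]; rewrite ltnNge => /negbTE ->. Qed.

Let ord0A2 : ord0 \notin A2.
Proof. by rewrite inE -ltnNge. Qed.

Lemma cut_glue_facts pi : nc_partition full pi && second_of_first pi ->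
  [/\ nc_partition A1 (cut pi).1, nc_partition A2 (cut pi).2 & glue (cut pi) = pi].
Proof.
case/andP => /andP[pP /noncrossingP ncP] /second_of_firstP[B BP [B0 Bj HB]].
have /and3P[_ triv _] := pP.
move/partition_elemP: pP => [cP sP tP nP].
have eB : pblock pi ord0 = B by exact: def_pblock.
(* A block with points [x < j < y] would cross [B], which contains [0] and [j]. *)
have sub12 C : C \in pi -> C != B -> (C \subset A1) || (C \subset A2).
  move=> CP neCB.
  have C0 x : x \in C -> (0 < x)%N.
    move=> xC; rewrite lt0n; apply/negP => /eqP x0.
    have ex : x = ord0 by exact: val_inj.
    by move/eqP: neCB; apply; apply: (tP _ _ x); rewrite // ex.
  apply/orP; have [|/subsetPn[y yC yA1]] := boolP (C \subset A1); [by left|right].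
  move: yA1; rewrite inE C0 //= -leqNgt leq_eqVlt => /orP[/eqP/val_inj ejy|jy].
    by move/eqP: neCB; case; apply: (tP _ _ y); rewrite // -ejy.
  apply/subsetP => x xC; rewrite inE leqNgt; apply/negP => xj.
  move/eqP: neCB; apply; apply/esym; apply: (ncP B C ord0 x j y) => //.
  exact: C0.
have BA2 : B :\ ord0 \subset A2.
  by apply/subsetP => x; rewrite !inE => /andP[x0 xB]; exact: HB.
have Bj' : j \in B :\ ord0 by rewrite !inE Bj andbT -val_eqE /= -lt0n.
have BnA2 : ~~ (B \subset A2) by apply/subsetPn; exists ord0.
have p1P : nc_partition A1 (cut pi).1.
  apply/andP; split; last first.
    apply/noncrossingP => C C' i k l m; rewrite !inE => /andP[CP _] /andP[CP' _].
    exact: ncP.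
  apply/partition_elemP; split.
  - move=> x xA1; have [|C CP xC] := cP x; first by rewrite inE.
    exists C => //; rewrite inE CP /=.
    have neCB : C != B.
      apply: contraTneq xA1 => eCB; rewrite inE; apply/negP => /andP[x0].
      by rewrite ltnNge HB -?eCB // -val_eqE /= -lt0n.
    case/orP: (sub12 _ CP neCB) => // /subsetP /(_ _ xC) xA2.
    by case: (A1A2 xA1 xA2).
  - by move=> C; rewrite inE => /andP[].
  - by move=> C C' x; rewrite !inE => /andP[CP _] /andP[CP' _]; apply: tP.
  - by rewrite inE negb_and nP.
(* Distinct blocks of the second component lie in distinct blocks of [pi], so disjointness and the
   absence of crossings are inherited from [pi]. *)
have parent C : C \in (cut pi).2 ->
    exists C', [/\ C' \in pi, C \subset C' & forall C2, C2 \in (cut pi).2 -> C2 \subset C' -> C = C2].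
  have aux C2 : C2 \in pi -> C2 \subset A2 -> C2 \subset B -> False.
    move=> C2P s2 s; have [e|[x xC2]] := set_0Vmem C2.
      by move: nP; rewrite -e C2P.
    move: BnA2; rewrite -(tP _ _ x C2P BP) ?s2 //.
    exact: (subsetP s).
  rewrite /cut /= eB; case/setU1P => [->|].
    exists B; split => //; first exact: subsetDl.
    by move=> C2; case/setU1P => [->|] //; rewrite !inE => /andP[C2P s2] /(aux _ C2P s2).
  rewrite inE => /andP[CP sC]; exists C; split => //.
  move=> C2 /setU1P[->|]; rewrite ?inE.
    move=> s; case: (aux _ CP sC); rewrite -(tP _ _ j BP CP) //.
    exact: (subsetP s).
  move=> /andP[C2P sC2] s; have [e|[x xC2]] := set_0Vmem C2.
    by move: nP; rewrite -e C2P.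
  by apply: (tP _ _ x) => //; exact: (subsetP s).
have p2P : nc_partition A2 (cut pi).2.
  apply/andP; split; last first.
    apply/noncrossingP => C1 C2 i k l m CP1 CP2.
    have [D1 [D1P s1 u1]] := parent _ CP1; have [D2 [D2P s2 u2]] := parent _ CP2.
    move=> /(subsetP s1) iD /(subsetP s2) kD /(subsetP s1) lD /(subsetP s2) mD ik kl lm.
    by apply: u1 => //; rewrite (ncP D1 D2 i k l m).
  apply/partition_elemP; rewrite /cut /= eB; split.
  - move=> x xA2; have [|C CP xC] := cP x; first by rewrite inE.
    have [eCB|neCB] := eqVneq C B.
      exists (B :\ ord0); first exact: setU11.
      by rewrite -eCB !inE xC andbT; apply: contraNneq ord0A2 => <-.
    exists C => //; rewrite !inE CP /=; apply/orP; right.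
    case/orP: (sub12 _ CP neCB) => // /subsetP /(_ _ xC) xA1.
    by case: (A1A2 xA1 xA2).
  - by move=> C /setU1P[->|] //; rewrite inE => /andP[].
  - move=> C1 C2 x; rewrite -eB => CP1 CP2.
    have [D1 [D1P s1 u1]] := parent _ CP1; have [D2 [D2P s2 u2]] := parent _ CP2.
    move=> /(subsetP s1) xD1 /(subsetP s2) xD2.
    by apply: u1 => //; rewrite (tP D1 D2 x).
  - rewrite in_setU1 negb_or [_ \in (_ ::&: _)]inE negb_and nP /= andbT.
    by apply/eqP => /setP /(_ j); rewrite Bj' inE.
split => //.
have eB' : pblock (cut pi).2 j = B :\ ord0.
  case/andP: p2P => /and3P[_ triv2 _] _; apply: def_pblock => //.
  by rewrite /= eB setU11.
rewrite /glue eB' setD1K // /cut /= eB.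
apply/setP => C; rewrite !inE; apply/idP/idP.
  by move=> /or3P[/eqP -> // | /andP[] // | /andP[nC /orP[/eqP e|/andP[]//]]]; rewrite e eqxx in nC.
move=> CP; have [//|neCB] := eqVneq C B; rewrite CP /=.
case/orP: (sub12 _ CP neCB) => -> //; rewrite orbT andbT.
apply/orP; right; apply: contra_neq neCB => e.
by apply: (tP _ _ j) => //; rewrite e.
Qed.

(** A crossing that starts in the enlarged block remains one when its first point is replaced by
    [j], the least point of [A2], and then contradicts the hypothesis on [p.2]. Blocks of [p.1] lie
    between [0] and [j], where the enlarged block has no point, so they cross neither it nor any
    block of [p.2]. *)
Lemma glue_cut_facts p : nc_partition A1 p.1 -> nc_partition A2 p.2 ->
  [/\ nc_partition full (glue p), second_of_first (glue p), cut (glue p) = p &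
      #|glue p| = (#|p.1| + #|p.2|)%N].
Proof.
case: p => p1 p2 /= /andP[/partition_elemP[c1 s1 t1 n1] /noncrossingP nc1].
move=> /andP[pP2 /noncrossingP nc2].
have /and3P[/eqP cov2 triv2 _] := pP2.
move/partition_elemP: pP2 => [c2 s2 t2 n2].
have jA2 : j \in A2 by rewrite inE.
rewrite /glue /=; set B := pblock p2 j.
have BP : B \in p2 by rewrite pblock_mem // cov2.
have Bj : j \in B by rewrite mem_pblock cov2.
have m1 C x : C \in p1 -> x \in C -> (0 < x < j)%N.
  by move=> /s1 /subsetP s /s; rewrite inE.
have m2 C x : C \in p2 -> x \in C -> (j <= x)%N.
  by move=> /s2 /subsetP s /s; rewrite inE.
have B0 : ord0 \notin B by apply/negP => /(m2 _ _ BP); rewrite leqNgt j_gt0.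
set pi := _ |: _.
have piP C : C \in pi -> [\/ C = ord0 |: B, C \in p1 | C \in p2 /\ C <> B].
  case/setU1P => [|/setUP[|]]; first by constructor 1.
    by constructor 2.
  by rewrite !inE => /andP[/eqP neC CP2]; constructor 3.
have ncpi : nc_partition full pi.
  apply/andP; split.
    apply/partition_elemP; split.
    - move=> x _; have [->|x0] := eqVneq x ord0.
        by exists (ord0 |: B); rewrite ?setU11.
      case: (ltnP x j) => xj.
        have [|C CP xC] := c1 x; first by rewrite inE xj lt0n andbT.
        by exists C; rewrite // !inE CP orbT.
      have [|C CP xC] := c2 x; first by rewrite inE.
      have [eCB|neCB] := eqVneq C B.
        by exists (ord0 |: B); rewrite ?setU11 // !inE -eCB xC orbT.
      by exists C; rewrite // !inE CP neCB !orbT.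
    - by move=> C _; exact: subsetT.
    - have H C x : [\/ C = ord0 |: B, C \in p1 | C \in p2 /\ C <> B] -> x \in C ->
         [/\ (x < j)%N -> x != ord0 -> C \in p1,
             (j <= x)%N -> (C \in p2 /\ C <> B) \/ C = ord0 |: B & x = ord0 -> C = ord0 |: B].
        case=> [->|CP|[CP neC]] xC.
        + split => //; last by right.
          case/setU1P: xC => [->|/(m2 _ _ BP)]; first by rewrite eqxx.
          by rewrite leqNgt => /negbTE ->.
        + have /andP[x0 xj] := m1 _ _ CP xC; split => //.
            by rewrite leqNgt xj.
          by move=> ex; rewrite ex in x0.
        + have jx := m2 _ _ CP xC; split => //.
            by rewrite ltnNge jx.
            by left.
          by move=> ex; move: jx; rewrite ex leqNgt j_gt0.
      move=> C1 C2 x /piP /H h1 /piP /H h2 xC1 xC2.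
      have [a1 b1 z1] := h1 _ xC1; have [a2 b2 z2] := h2 _ xC2.
      have [x0|x0] := eqVneq x ord0; first by rewrite z1 // z2.
      case: (ltnP x j) => xj; first by apply: (t1 _ _ x); [exact: a1|exact: a2|..].
      have xB C : C = ord0 |: B -> x \in C -> x \in B.
        by move=> -> /setU1P[e|//]; rewrite e eqxx in x0.
      case: (b1 xj) => [[C1P ne1]|e1]; case: (b2 xj) => [[C2P ne2]|e2].
      + exact: (t2 _ _ x).
      + by case: ne1; apply: (t2 _ _ x) => //; exact: xB e2 _.
      + by case: ne2; apply: (t2 _ _ x) => //; exact: xB e1 _.
      + by rewrite e1 e2.
    - rewrite in_setU1 in_setU in_setD1 !negb_or (negPf n1) (negPf n2) /= andbF andbT.
      by apply/eqP => /esym /setP /(_ ord0); rewrite !inE eqxx.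
  apply/noncrossingP => C1 C2 i k l m /piP P1 /piP P2 i1 k2 l1 m2' ik kl lm.
  have pos (x : 'I_n.+1) (y : 'I_n.+1) : (x < y)%N -> y != ord0.
    by move=> xy; rewrite -val_eqE /= -lt0n (leq_ltn_trans _ xy).
  have k0 := pos _ _ ik; have l0 := pos _ _ kl; have m0 := pos _ _ lm.
  have inB x : x != ord0 -> x \in ord0 |: B -> x \in B.
    by move=> x0 /setU1P[e|//]; rewrite e eqxx in x0.
  have jlt (x : 'I_n.+1) C : x \in C -> C \in p2 -> C <> B -> (j <= x)%N -> (j < x)%N.
    move=> xC CP neC; rewrite leq_eqVlt => /orP[/eqP/val_inj e|//].
    by case: neC; apply: (t2 _ _ j); rewrite // e.
  case: P1 => [e1|P1|[P1 ne1]]; case: P2 => [e2|P2|[P2 ne2]].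
  - by rewrite e1 e2.
  - have lB : l \in B by apply: inB; rewrite // -e1.
    have /andP[_ mj] := m1 _ _ P2 m2'; have := m2 _ _ BP lB.
    by rewrite leqNgt (ltn_trans lm mj).
  - have lB : l \in B by apply: inB; rewrite // -e1.
    case: (ne2); apply/esym; apply: (nc2 B C2 j k l m) => //.
    by apply: (jlt _ _ k2) => //; exact: (m2 _ _ P2 k2).
  - have kB : k \in B by apply: inB; rewrite // -e2.
    have /andP[_ lj] := m1 _ _ P1 l1; have := m2 _ _ BP kB.
    by rewrite leqNgt (ltn_trans kl lj).
  - exact: (nc1 _ _ i k l m).
  - have /andP[_ lj] := m1 _ _ P1 l1; have := m2 _ _ P2 k2.
    by rewrite leqNgt (ltn_trans kl lj).
  - have kB : k \in B by apply: inB; rewrite // -e2.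
    have mB : m \in B by apply: inB; rewrite // -e2.
    by case: ne1; apply: (nc2 C1 B i k l m).
  - have /andP[_ mj] := m1 _ _ P2 m2'; have := m2 _ _ P1 l1.
    by rewrite leqNgt (ltn_trans lm mj).
  - exact: (nc2 _ _ i k l m).
have sof : second_of_first pi.
  apply/second_of_firstP; exists (ord0 |: B); first exact: setU11.
  split; [exact: setU11|by rewrite !inE Bj orbT|].
  by move=> i /setU1P[->|/(m2 _ _ BP)//]; rewrite eqxx.
have nB1 : B \notin p1.
  by apply/negP => /m1 /(_ Bj); rewrite ltnn andbF.
have nB0 C : C \in p1 \/ C \in p2 -> C <> ord0 |: B.
  move=> CP e; have : ord0 \in C by rewrite e setU11.
  by case: CP => [/m1 h /h|/m2 h /h] //; rewrite leqNgt j_gt0.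
split => //.
- rewrite /cut; have -> : pblock pi ord0 = ord0 |: B.
    case/andP: ncpi => /and3P[_ tpi _] _; apply: def_pblock => //; exact: setU11.
  rewrite setU1K //; congr pair; apply/setP => C; rewrite !inE.
    apply/andP/idP => [[/or3P[/eqP e sC|//|/andP[neC C2] sC]]|C1].
    + have /subsetP /(_ ord0) := sC; rewrite e setU11 => /(_ isT).
      by rewrite inE.
    + have [e|[x xC]] := set_0Vmem C; first by move: n2; rewrite -e C2.
      have /andP[_] : (0 < x < j)%N by have /subsetP /(_ x xC) := sC; rewrite inE.
      by rewrite ltnNge (m2 _ _ C2 xC).
    + by rewrite C1 orbT; split => //; exact: s1.
  apply/idP/idP => [/orP[/eqP -> //|/andP[/or3P[/eqP e|C1|/andP[]//] sC]]|C2].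
  + have /subsetP /(_ ord0) := sC; rewrite e setU11 => /(_ isT).
    by rewrite (negPf ord0A2).
  + have [e|[x xC]] := set_0Vmem C; first by move: n1; rewrite -e C1.
    have := m1 _ _ C1 xC; have : x \in A2 by apply: (subsetP sC).
    by rewrite inE leqNgt => /negPf ->; rewrite andbF.
  + by rewrite C2; have [//|_] := eqVneq C B; rewrite (s2 _ C2) !orbT.
- rewrite /pi cardsU1 (_ : _ \notin _); last first.
    rewrite !inE !negb_or; apply/andP; split.
      by apply/negP => C1; have := nB0 _ (or_introl C1); apply.
    by apply/negP => /andP[_ C2]; have := nB0 _ (or_intror C2); apply.
  rewrite cardsU (_ : p1 :&: _ = set0) ?cards0 ?subn0.
    by rewrite [in RHS](cardsD1 B p2) BP addnCA.
  apply/setP => C; rewrite !inE; apply/negP => /and3P[C1 _ C2].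
  have [e|[x xC]] := set_0Vmem C; first by move: n1; rewrite -e C1.
  by have /andP[_] := m1 _ _ C1 xC; rewrite ltnNge (m2 _ _ C2 xC).
Qed.

Lemma nc_partition_second_of_first :
  \sum_(pi | nc_partition full pi && second_of_first pi) lam ^+ #|pi| =
  nc_weight A1 * nc_weight A2.
Proof.
rewrite /nc_weight big_distrl /=; under [RHS]eq_bigr do rewrite big_distrr /=.
rewrite pair_big /= (reindex_onto glue cut) /=; last first.
  by move=> pi /cut_glue_facts[].
apply: eq_big => [p|p /andP[/cut_glue_facts[h1 h2 _] /eqP e]]; last first.
  by rewrite e in h1 h2; have [_ _ _ ->] := glue_cut_facts h1 h2; rewrite exprD.
apply/idP/idP => [/andP[/cut_glue_facts[h1 h2 _] /eqP e]|/andP[h1 h2]].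
  by rewrite e in h1 h2; rewrite h1.
by have [-> -> -> _] := glue_cut_facts h1 h2; rewrite eqxx.
Qed.

End Split.

Definition nc_moment n : R := nc_weight [set: 'I_n].

Lemma nc_moment0 : nc_moment 0 = 1.
Proof.
rewrite /nc_moment (_ : [set: 'I_0] = set0) ?nc_weight_set0 //.
by apply/setP => -[].
Qed.

Lemma card_ord_interval m a b : (b <= m)%N ->
  #|[set i : 'I_m | (a <= i < b)%N]| = (b - a)%N.
Proof.
move=> bm; rewrite cardsE -sum1_card.
rewrite (eq_bigl (fun i : 'I_m => (a <= i) && (i < b))%N) //.
rewrite -(big_mkord (fun i => (a <= i) && (i < b))%N (fun=> 1%N)).
rewrite (eq_bigl (fun i => xpredT i && (i < b) && (a <= i))%N); last first.
  by move=> i; rewrite andbC.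
by rewrite -big_nat_widenl // -(big_nat_widen _ _ _ xpredT) // sum_nat_const_nat muln1.
Qed.

(** Partitions are sorted by the block of [0]. A singleton contributes a factor [lam] and leaves [n]
    points. Otherwise let [j + 1] be its second smallest element, whence [lift ord0 j]: there are
    [j] points before it and [n - j] from it on. Cutting there creates no new block, so the
    quadratic term carries no factor [lam]. *)
Lemma nc_momentS n :
  nc_moment n.+1 = lam * nc_moment n + \sum_(j < n) nc_moment j * nc_moment (n - j).
Proof.
rewrite [LHS]/nc_moment [LHS]/nc_weight.
rewrite (bigID (fun pi : {set {set 'I_n.+1}} => [set ord0] \in pi)) /=.
rewrite nc_partition_singleton nc_weight_card; congr (lam * _ + _).
  by rewrite cardsE cardC1 card_ord.
have uniqJ (pi : {set {set 'I_n.+1}}) (j j' : 'I_n) :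
    nc_partition [set: 'I_n.+1] pi ->
    second_of_first (lift ord0 j) pi -> second_of_first (lift ord0 j') pi -> j = j'.
  move=> /andP[/partition_elemP[_ _ tP _] _].
  move=> /(second_of_firstP (lift ord0 j))[B BP [B0 Bj HB]].
  move=> /(second_of_firstP (lift ord0 j'))[C CP [C0 Cj HC]].
  have eBC : B = C by exact: (tP _ _ ord0).
  apply/val_inj/eqP; rewrite eqn_leq.
  rewrite -[X in X && _](leq_add2l 1) -[X in _ && X](leq_add2l 1).
  by rewrite (HB (lift ord0 j')) ?(HC (lift ord0 j)) ?eBC // -eBC.
have -> : \sum_(j < n) nc_moment j * nc_moment (n - j) =
    \sum_(j < n) \sum_(pi : {set {set 'I_n.+1}} |
       nc_partition [set: 'I_n.+1] pi && second_of_first (lift ord0 j) pi) lam ^+ #|pi|.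
  apply: eq_bigr => j _; rewrite (nc_partition_second_of_first (j := lift ord0 j) isT).
  rewrite !(@nc_weight_card n.+1) card_ord_interval; last exact: (ltnW (ltn_ord (lift ord0 j))).
  rewrite (_ : [set i : 'I_n.+1 | (lift ord0 j <= i)%N] =
               [set i : 'I_n.+1 | (lift ord0 j <= i < n.+1)%N]); last first.
    by apply/setP => i; rewrite !inE ltn_ord andbT.
  by rewrite card_ord_interval // subn1 subSS.
(* After the exchange, each partition without the block [{0}] is counted once, because exactly one
   [j] gives the second smallest element of the block of [0]. *)
rewrite (exchange_big_dep (fun pi => nc_partition [set: 'I_n.+1] pi
                                     && ([set ord0] \notin pi))) /=; last first.
  move=> j pi _ /andP[ncpi]; rewrite ncpi /=.
  move=> /(second_of_firstP (lift ord0 j))[B BP [B0 Bj HB]].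
  apply/negP => s0; case/andP: ncpi => /partition_elemP[_ _ tP _] _.
  move: Bj; rewrite -(tP [set ord0] B ord0) ?inE ?eqxx //.
apply: eq_bigr => pi /andP[ncpi nsing]; rewrite ncpi /=.
have [j sj] : exists j : 'I_n, second_of_first (lift ord0 j) pi.
  have /andP[/partition_elemP[cP sP tP nP] _] := ncpi.
  have [|B BP B0] := cP ord0; first by rewrite inE.
  have [i iB i0] : exists2 i, i \in B & i != ord0.
    have [e|[i]] := set_0Vmem (B :\ ord0); last by rewrite !inE => /andP[]; exists i.
    by move: nsing; rewrite -(setD1K B0) e setU0 in BP; rewrite BP.
  pose P k := (k \in B) && (k != ord0).
  have Pi : P i by rewrite /P iB.
  case: (arg_minnP (P := P) (fun k => val k) Pi) => k /andP[kB k0] kmin.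
  case: (unliftP ord0 k) => [j ek|ek]; last by rewrite ek eqxx in k0.
  exists j; apply/(second_of_firstP (lift ord0 j)); exists B => //; split => //.
    by rewrite -ek.
  by move=> m mB m0; rewrite -ek; apply: kmin; rewrite /P mB.
rewrite (big_pred1 j) // => j'; apply/idP/eqP => [sj'|-> //].
exact: uniqJ sj' sj.
Qed.

End NoncrossingWeights.

From mathcomp Require Import fingroup perm.
From mathcomp Require Import all_classical all_reals all_analysis.
From mathcomp Require Import measurable_realfun complex.
From mathcomp Require Import ring lra.

Import numFieldNormedType.Exports.

Local Open Scope classical_set_scope.
Local Open Scope ring_scope.
Local Open Scope sesquilinear_scope.
Local Open Scope complex_scope.

Local Notation nc := Normc.normc.
Local Notation Re := complex.Re.
Local Notation Im := complex.Im.

(** * The real-valued modulus and bounds for [1 / (x - z)] *)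

Section ComplexModulus.
Variable R : realType.
Implicit Types (x y : R[i]) (r : R).

(** The norm of [R[i]] takes its values in [R[i]]; [nc] is its real-valued counterpart, in which all
    estimates are carried out. *)
Lemma normr_nc x : `|x| = (nc x)%:C.
Proof. by rewrite normc_def; case: x. Qed.

Lemma nc_ge0 x : 0 <= nc x.
Proof. by rewrite -ler0c -normr_nc. Qed.

Lemma nc_sqr x : nc x ^+ 2 = Re x ^+ 2 + Im x ^+ 2.
Proof. by case: x => a b /=; rewrite sqr_sqrtr // addr_ge0 ?sqr_ge0. Qed.

Lemma Re_add x y : Re (x + y) = Re x + Re y. Proof. by case: x; case: y. Qed.
Lemma Im_add x y : Im (x + y) = Im x + Im y. Proof. by case: x; case: y. Qed.
Lemma Re_opp x : Re (- x) = - Re x. Proof. by case: x. Qed.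
Lemma Im_opp x : Im (- x) = - Im x. Proof. by case: x. Qed.
Lemma Re_mul x y : Re (x * y) = Re x * Re y - Im x * Im y.
Proof. by case: x => a b; case: y. Qed.
Lemma Im_mul x y : Im (x * y) = Re x * Im y + Im x * Re y.
Proof. by case: x => a b; case: y. Qed.
Lemma Re_inv x : Re x^-1 = Re x / nc x ^+ 2.
Proof. by rewrite nc_sqr; case: x. Qed.
Lemma Im_inv x : Im x^-1 = - Im x / nc x ^+ 2.
Proof. by rewrite nc_sqr; case: x => a b /=; rewrite mulNr. Qed.
Lemma Re_sum (I : Type) (s : seq I) (P : pred I) (F : I -> R[i]) :
  Re (\sum_(i <- s | P i) F i) = \sum_(i <- s | P i) Re (F i).
Proof. by apply: (big_morph (@complex.Re R) Re_add). Qed.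
Lemma Im_sum (I : Type) (s : seq I) (P : pred I) (F : I -> R[i]) :
  Im (\sum_(i <- s | P i) F i) = \sum_(i <- s | P i) Im (F i).
Proof. by apply: (big_morph (@complex.Im R) Im_add). Qed.

Lemma complex_eq x y : Re x = Re y -> Im x = Im y -> x = y.
Proof. by case: x; case: y => a b c d /= -> ->. Qed.

Lemma ncD x y : nc (x + y) <= nc x + nc y. Proof. exact: le_normcD. Qed.
Lemma ncN x : nc (- x) = nc x. Proof. exact: normcN. Qed.
Lemma ncBC x y : nc (x - y) = nc (y - x). Proof. by rewrite -ncN opprB. Qed.
Lemma ncM x y : nc (x * y) = nc x * nc y. Proof. exact: Normc.normcM. Qed.
Lemma ncV x : nc x^-1 = (nc x)^-1. Proof. exact: Normc.normcV. Qed.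
Lemma nc1 : nc (1 : R[i]) = 1. Proof. exact: Normc.normc1. Qed.
Lemma nc0 : nc (0 : R[i]) = 0. Proof. exact: Normc.normc0. Qed.
Lemma ncX x n : nc (x ^+ n) = nc x ^+ n.
Proof. by elim: n => [|n IH]; rewrite ?expr0 ?nc1 // !exprS ncM IH. Qed.
Lemma nc_eq0 x : (nc x == 0) = (x == 0).
Proof. by apply/eqP/eqP => [/Normc.eq0_normc|->]; rewrite ?nc0. Qed.
Lemma nc_gt0 x : (0 < nc x) = (x != 0).
Proof. by rewrite lt_def nc_ge0 andbT nc_eq0. Qed.
Lemma nc_conj x : nc x^*%C = nc x.
Proof. by case: x => a b /=; rewrite sqrrN. Qed.
Lemma nc_real r : nc r%:C = `|r|.
Proof. by rewrite /= expr0n addr0 sqrtr_sqr. Qed.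

Lemma nc_sum (I : Type) (s : seq I) (P : pred I) (F : I -> R[i]) :
  nc (\sum_(i <- s | P i) F i) <= \sum_(i <- s | P i) nc (F i).
Proof.
apply: (big_ind2 (fun x r => nc x <= r)) => //; first by rewrite nc0.
by move=> x1 r1 x2 r2 h1 h2; apply: (le_trans (ncD _ _)); exact: lerD.
Qed.

Lemma ler_ReIm_nc x : `|Re x| <= nc x /\ `|Im x| <= nc x.
Proof.
by split; rewrite -(@ler_pXn2r _ 2) ?nnegrE ?nc_ge0 // nc_sqr real_normK ?num_real //;
  rewrite ?lerDl ?lerDr sqr_ge0.
Qed.

Lemma ler_Re_nc x : `|Re x| <= nc x. Proof. by have [] := ler_ReIm_nc x. Qed.
Lemma ler_Im_nc x : `|Im x| <= nc x. Proof. by have [] := ler_ReIm_nc x. Qed.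

Lemma nc_le_ReIm x : nc x <= `|Re x| + `|Im x|.
Proof.
rewrite -(@ler_pXn2r _ 2) ?nnegrE ?nc_ge0 ?addr_ge0 // nc_sqr sqrrD.
rewrite !real_normK ?num_real // -addrA lerD2l lerDr.
by rewrite mulrn_wge0 // mulr_ge0.
Qed.

Lemma nc_le_ReIm_eps x r : `|Re x| <= r -> `|Im x| <= r -> nc x <= 2 * r.
Proof.
by move=> h1 h2; apply: (le_trans (nc_le_ReIm x)); rewrite mulr_natl mulr2n lerD.
Qed.

(* Away from the real axis, [1 / (x - z)] never divides by zero. *)
Lemma real_sub_neq0 r x : Im x != 0 -> r%:C - x != 0.
Proof.
apply: contra_neq => /(congr1 (@complex.Im R)).
by rewrite Im_add Im_opp /= sub0r => /eqP; rewrite oppr_eq0 => /eqP.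
Qed.

Lemma nc_resolvent_le r x : 0 < Im x -> nc (r%:C - x)^-1 <= (Im x)^-1.
Proof.
move=> x0; rewrite ncV lef_pV2 ?posrE //; last first.
  by rewrite nc_gt0 real_sub_neq0 // gt_eqF.
apply: le_trans (ler_Im_nc _); rewrite Im_add Im_opp /= sub0r normrN.
exact: ler_norm.
Qed.

Lemma nc_resolvent_lip r x y : 1 <= Im x -> 1 <= Im y ->
  nc ((r%:C - x)^-1 - (r%:C - y)^-1) <= nc (x - y).
Proof.
move=> x1 y1; have [x0 y0] : 0 < Im x /\ 0 < Im y by split; exact: lt_le_trans ltr01 _.
have -> : (r%:C - x)^-1 - (r%:C - y)^-1 = (x - y) * ((r%:C - x)^-1 * (r%:C - y)^-1).
  by field; rewrite !real_sub_neq0 // gt_eqF.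
rewrite ncM ler_piMr ?nc_ge0 // ncM mulr_ile1 ?nc_ge0 //.
  by rewrite (le_trans (nc_resolvent_le _ x0)) // invf_le1.
by rewrite (le_trans (nc_resolvent_le _ y0)) // invf_le1.
Qed.

Lemma Im_resolvent r x : Im (r%:C - x)^-1 = Im x / nc (r%:C - x) ^+ 2.
Proof. by rewrite Im_inv Im_add Im_opp /= sub0r opprK. Qed.

Lemma Im_resolvent_gt0 r x : 0 < Im x -> 0 < Im (r%:C - x)^-1.
Proof.
by move=> x0; rewrite Im_resolvent divr_gt0 // exprn_gt0 // nc_gt0 real_sub_neq0 // gt_eqF.
Qed.

End ComplexModulus.

(** * Measurability and integration of complex-valued functions *)

Section ComplexIntegral.
Context {R : realType} {disp : measure_display} {T : measurableType disp}.
Implicit Types (f g : T -> R[i]) (h : T -> R).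

Definition cmeasurable f :=
  measurable_fun setT (fun x => Re (f x)) /\ measurable_fun setT (fun x => Im (f x)).

Lemma cmeasurable_cst c : cmeasurable (fun=> c).
Proof. by split; exact: measurable_cst. Qed.

Lemma cmeasurableD f g : cmeasurable f -> cmeasurable g ->
  cmeasurable (fun x => f x + g x).
Proof.
move=> [f1 f2] [g1 g2]; split.
  by under eq_fun do rewrite Re_add; exact: measurable_funD.
by under eq_fun do rewrite Im_add; exact: measurable_funD.
Qed.

Lemma cmeasurableN f : cmeasurable f -> cmeasurable (fun x => - f x).
Proof.
move=> [f1 f2]; split.
  by under eq_fun do rewrite Re_opp; exact: measurableT_comp.
by under eq_fun do rewrite Im_opp; exact: measurableT_comp.
Qed.

Lemma cmeasurableM f g : cmeasurable f -> cmeasurable g ->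
  cmeasurable (fun x => f x * g x).
Proof.
move=> [f1 f2] [g1 g2]; split.
  by under eq_fun do rewrite Re_mul; apply: measurable_funB; exact: measurable_funM.
by under eq_fun do rewrite Im_mul; apply: measurable_funD; exact: measurable_funM.
Qed.

Lemma cmeasurable_conj f : cmeasurable f -> cmeasurable (fun x => (f x)^*%C).
Proof.
move=> [f1 f2]; split.
  by rewrite (_ : (fun x => _) = (fun x => Re (f x))) //; apply/funext => x; case: (f x).
rewrite (_ : (fun x => _) = (fun x => - Im (f x))); first exact: measurableT_comp.
by apply/funext => x; case: (f x).
Qed.

Lemma measurable_inv : measurable_fun setT (fun r : R => r^-1).
Proof.
rewrite -(setUv [set (0 : R)]); apply/measurable_funU => //.
  exact: measurableC.
split; first exact: measurable_fun_set1.
apply: open_continuous_measurable_fun.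
  by apply: closed_openC; exact: closed_eq.
by move=> x; rewrite inE /= => /eqP x0; exact: inv_continuous.
Qed.

Lemma measurable_nc f : cmeasurable f -> measurable_fun setT (fun x => nc (f x)).
Proof.
move=> [f1 f2].
rewrite (_ : (fun x => _) = (fun x => Num.sqrt (Re (f x) ^+ 2 + Im (f x) ^+ 2))).
  apply: measurableT_comp; first by apply: continuous_measurable_fun; exact: sqrt_continuous.
  by apply: measurable_funD; exact: measurable_funX.
by apply/funext => x; case: (f x).
Qed.

Lemma cmeasurableV f : cmeasurable f -> cmeasurable (fun x => (f x)^-1).
Proof.
move=> mf; have mn : measurable_fun setT (fun x => (nc (f x) ^+ 2)^-1).
  apply: (measurableT_comp measurable_inv).
  by apply: measurable_funX; exact: measurable_nc.
case: (mf) => f1 f2; split.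
  by under eq_fun do rewrite Re_inv; exact: measurable_funM.
under eq_fun do rewrite Im_inv; apply: measurable_funM => //.
exact: measurableT_comp.
Qed.

Lemma cmeasurable_sum (I : Type) (s : seq I) (P : pred I) (F : I -> T -> R[i]) :
  (forall i, cmeasurable (F i)) -> cmeasurable (fun x => \sum_(i <- s | P i) F i x).
Proof.
move=> mF; elim: s => [|i s IH].
  by under eq_fun do rewrite big_nil; exact: cmeasurable_cst.
under eq_fun do rewrite big_cons; case: (P i) => //; exact: cmeasurableD.
Qed.

Lemma cmeasurable_prod (I : Type) (s : seq I) (P : pred I) (F : I -> T -> R[i]) :
  (forall i, cmeasurable (F i)) -> cmeasurable (fun x => \prod_(i <- s | P i) F i x).
Proof.
move=> mF; elim: s => [|i s IH].
  by under eq_fun do rewrite big_nil; exact: cmeasurable_cst.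
under eq_fun do rewrite big_cons; case: (P i) => //; exact: cmeasurableM.
Qed.

Variable mu : {measure set T -> \bar R}.

Definition cint f : R[i] := (\int[mu]_x Re (f x)) +i* (\int[mu]_x Im (f x)).

Definition cintegrable f :=
  mu.-integrable setT (fun x => (Re (f x))%:E) /\
  mu.-integrable setT (fun x => (Im (f x))%:E).

Lemma cintegrableD f g : cintegrable f -> cintegrable g ->
  cintegrable (fun x => f x + g x).
Proof.
move=> [f1 f2] [g1 g2]; split.
  by under eq_fun do rewrite Re_add EFinD; exact: integrableD.
by under eq_fun do rewrite Im_add EFinD; exact: integrableD.
Qed.

Lemma cintegrableM c f : cintegrable f -> cintegrable (fun x => c * f x).
Proof.
move=> [f1 f2]; split.
  under eq_fun do rewrite Re_mul EFinB !EFinM.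
  by apply: integrableB => //; exact: integrableZl.
under eq_fun do rewrite Im_mul EFinD !EFinM.
by apply: integrableD => //; exact: integrableZl.
Qed.

Lemma cintD f g : cintegrable f -> cintegrable g ->
  cint (fun x => f x + g x) = cint f + cint g.
Proof.
move=> [f1 f2] [g1 g2]; apply: complex_eq; rewrite ?Re_add ?Im_add /=.
  by under eq_Rintegral do rewrite Re_add; rewrite RintegralD.
by under eq_Rintegral do rewrite Im_add; rewrite RintegralD.
Qed.

Let integrable_scale k h : mu.-integrable setT (EFin \o h) ->
  mu.-integrable setT (EFin \o (fun x => k * h x)).
Proof. by move=> ih; exact: (integrableZl measurableT k ih). Qed.

Lemma cintM c f : cintegrable f -> cint (fun x => c * f x) = c * cint f.
Proof.
move=> [f1 f2]; apply: complex_eq; rewrite ?Re_mul ?Im_mul /=.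
  under eq_Rintegral do rewrite Re_mul.
  by rewrite RintegralB // ?RintegralZl //; exact: integrable_scale.
under eq_Rintegral do rewrite Im_mul.
by rewrite RintegralD // ?RintegralZl //; exact: integrable_scale.
Qed.

Lemma cintegrable0 : cintegrable (fun=> 0).
Proof. by split; exact: integrable0. Qed.

Lemma cintegrable_sum (I : Type) (s : seq I) (F : I -> T -> R[i]) :
  (forall i, cintegrable (F i)) -> cintegrable (fun x => \sum_(i <- s) F i x).
Proof.
move=> iF; elim: s => [|i s IH].
  by under eq_fun do rewrite big_nil; exact: cintegrable0.
by under eq_fun do rewrite big_cons; exact: cintegrableD.
Qed.

Lemma cint_sum (I : Type) (s : seq I) (F : I -> T -> R[i]) :
  (forall i, cintegrable (F i)) ->
  cint (fun x => \sum_(i <- s) F i x) = \sum_(i <- s) cint (F i).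
Proof.
move=> iF; elim: s => [|i s IH].
  rewrite big_nil; under [in LHS]eq_fun do rewrite big_nil.
  by apply: complex_eq; rewrite /= Rintegral_cst // mul0r.
rewrite big_cons -IH -cintD //; last exact: cintegrable_sum.
by congr cint; apply/funext => x; rewrite big_cons.
Qed.

Lemma cintegrable_dom f h : cmeasurable f -> mu.-integrable setT (EFin \o h) ->
  (forall x, nc (f x) <= h x) -> cintegrable f.
Proof.
move=> [f1 f2] ih fh; split; apply: (le_integrable _ _ _ ih) => //;
  try exact/measurable_EFinP.
  move=> x _ /=; rewrite lee_fin (le_trans (ler_Re_nc _)) //.
  by rewrite (le_trans (fh x)) // ler_norm.
move=> x _ /=; rewrite lee_fin (le_trans (ler_Im_nc _)) //.
by rewrite (le_trans (fh x)) // ler_norm.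
Qed.

(** Real and imaginary parts are bounded separately, which costs the factor [2]. It reappears in the
    bound [2] for the Stieltjes transform of the limit law, and the stability estimate is adapted to
    it. *)
Lemma nc_cint_le f h : cmeasurable f -> mu.-integrable setT (EFin \o h) ->
  (forall x, nc (f x) <= h x) -> nc (cint f) <= 2 * \int[mu]_x h x.
Proof.
move=> mf ih fh; have [f1 f2] := cintegrable_dom mf ih fh.
have bd (g : T -> R) : mu.-integrable setT (EFin \o g) -> (forall x, `|g x| <= h x) ->
    `|\int[mu]_x g x| <= \int[mu]_x h x.
  move=> ig gh; apply: (le_trans (le_normr_Rintegral _ _)) => //.
  apply: le_Rintegral => //.
  rewrite (_ : EFin \o _ = abse \o (EFin \o g)); first exact: integrable_abse.
  by apply/funext.
apply: nc_le_ReIm_eps => /=; apply: bd => // x; apply: le_trans (fh x).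
  exact: ler_Re_nc.
exact: ler_Im_nc.
Qed.

End ComplexIntegral.

Lemma cmeasurable_real (R : realType) : cmeasurable (fun x : R => x%:C).
Proof. by split; [exact: measurable_id|exact: measurable_cst]. Qed.

Lemma cmeasurable_resolvent (R : realType) (z : R[i]) :
  cmeasurable (fun x : R => (x%:C - z)^-1).
Proof.
apply: cmeasurableV; apply: cmeasurableD; last exact: cmeasurable_cst.
exact: cmeasurable_real.
Qed.

(** * Growth of the moments *)

Lemma nc_moment_ge0 (R : numDomainType) (lam : R) n : 0 <= lam -> 0 <= nc_moment lam n.
Proof. by move=> l0; rewrite sumr_ge0 // => pi _; rewrite exprn_ge0. Qed.

Lemma sum_triangle (V : nmodType) (F : nat -> nat -> V) n :
  \sum_(i < n) \sum_(j < i.+1) F j (i - j)%N = \sum_(j < n) \sum_(l < n - j) F j l.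
Proof.
elim: n => [|n IH]; first by rewrite !big_ord0.
rewrite big_ord_recr /= IH [RHS]big_ord_recr /= subSnn big_ord1.
rewrite big_ord_recr /= subnn addrA; congr (_ + _).
rewrite -big_split /=; apply: eq_bigr => j _.
by rewrite subSn ?(ltnW (ltn_ord j)) // big_ord_recr.
Qed.

(* With [M] the generating function of the moments, [M = 1 + lam t M + t M (M - 1)];
   for small [t] its partial sums therefore never exceed [2]. *)
Lemma nc_moment_bound (R : realFieldType) (lam : R) n : 0 <= lam ->
  nc_moment lam n <= 2 * (2 * lam + 4) ^+ n.
Proof.
move=> l0; set t := (2 * lam + 4)^-1; have C0 : 0 < 2 * lam + 4 by lra.
have t0 : 0 < t by rewrite invr_gt0.
pose a k := nc_moment lam k * t ^+ k.
have a0 k : 0 <= a k by rewrite mulr_ge0 ?nc_moment_ge0 // exprn_ge0 // ltW.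
have aS k : a k.+1 <= lam * t * a k + t * \sum_(j < k.+1) a j * a (k - j)%N.
  rewrite /a nc_momentS exprS mulrDl lerD //.
    by rewrite le_eqVlt; apply/orP; left; apply/eqP; ring.
  rewrite mulrCA; apply: ler_wpM2l; first exact: ltW.
  rewrite big_ord_recr /= mulr_suml -[leLHS]addr0; apply: lerD.
    rewrite le_eqVlt; apply/orP; left; apply/eqP/eq_bigr => j _.
    by rewrite mulrACA -exprD subnKC // ltnW.
  by rewrite mulr_ge0 // a0.
pose S k := \sum_(i < k.+1) a i.
have S2 : forall k, S k <= 2.
  elim=> [|k IH]; first by rewrite /S big_ord1 /a nc_moment0 expr0; lra.
  have S0 : 0 <= S k by rewrite sumr_ge0.
  have dbl : \sum_(i < k.+1) \sum_(j < i.+1) a j * a (i - j)%N <= S k * S k.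
    rewrite (sum_triangle (fun j l => a j * a l)) mulr_suml; apply: ler_sum => j _.
    rewrite -mulr_sumr /S; apply: ler_wpM2l => //.
    rewrite (big_ord_widen k.+1 a (leq_subr _ _)) [leRHS](bigID (fun i : 'I__ => i < k.+1 - j)%N) /=.
    by rewrite lerDl sumr_ge0.
  have : S k.+1 <= 1 + lam * t * S k + t * (S k * S k).
    rewrite /S big_ord_recl {1}/a nc_moment0 expr0 mulr1 -addrA lerD2l -/(S k).
    apply: (@le_trans _ _ (lam * t * S k +
      t * (\sum_(i < k.+1) \sum_(j < i.+1) a j * a (i - j)%N))).
      rewrite /S !mulr_sumr -big_split /=; apply: ler_sum => i _.
      exact: aS.
    by rewrite lerD2l ler_pM2l.
  move=> h; apply: (le_trans h).
  (* With [S k <= 2] the right-hand side is at most [1 + (2 lam + 4) t], and [t] is chosen to make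
     this equal to [2]. *)
  have tE : t * (2 * lam + 4) = 1 by rewrite mulVf // gt_eqF.
  have h1 : lam * t * S k <= lam * t * 2 by rewrite ler_wpM2l // mulr_ge0 // ltW.
  have h2 : t * (S k * S k) <= t * 4.
    by rewrite ler_pM2l // (_ : 4 = 2 * 2); [rewrite ler_pM | ring].
  by lra.
have : a n <= 2.
  by apply: le_trans (S2 n); rewrite /S big_ord_recr /= lerDr sumr_ge0.
by rewrite /a /t exprVn ler_pdivrMr // exprn_gt0.
Qed.

(** * The moment functional on polynomials and moments about a shifted centre *)

Section MomentFunctional.
Variables (F : comNzRingType) (c : nat -> F).
Implicit Types p q : {poly F}.

(** For the moments of the limit law this is integration of polynomials; defining it from the
    sequence [c] keeps the change of centre purely algebraic. *)
Definition moment_fun p := \sum_(i < size p) p`_i * c i.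

Lemma moment_fun_widen p n : (size p <= n)%N -> moment_fun p = \sum_(i < n) p`_i * c i.
Proof.
move=> pn; rewrite /moment_fun (big_ord_widen n (fun i => p`_i * c i) pn).
rewrite big_mkcond; apply: eq_bigr => i _; case: ltnP => // ?.
by rewrite nth_default // mul0r.
Qed.

Lemma moment_fun_linear : scalar moment_fun.
Proof.
move=> a p q; pose n := maxn (size (a *: p + q)) (maxn (size p) (size q)).
rewrite !(@moment_fun_widen _ n) ?leq_max ?leqnn ?orbT //.
rewrite mulr_sumr -big_split /=; apply: eq_bigr => i _.
by rewrite coefD coefZ mulrDl mulrA.
Qed.

HB.instance Definition _ :=
  GRing.isLinear.Build F {poly F} F *%R moment_fun moment_fun_linear.

Lemma moment_funXn n : moment_fun 'X^n = c n.
Proof.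
rewrite (@moment_fun_widen _ n.+1) ?size_polyXn // big_ord_recr /= coefXn eqxx mul1r.
by rewrite big1 ?add0r // => i _; rewrite coefXn ltn_eqF ?mul0r.
Qed.

(* [poly_diffq p] is [(p(x) - p(y)) / (x - y)] with the moment functional applied in [y]. *)
Definition poly_diffq p :=
  \poly_(j < size p) moment_fun (drop_poly j.+1 p).

Lemma coef_poly_diffq p j : (poly_diffq p)`_j = moment_fun (drop_poly j.+1 p).
Proof.
rewrite coef_poly; case: ltnP => // pj.
by rewrite drop_poly_eq0 ?linear0 // ltnW.
Qed.

Lemma poly_diffq_linear : linear poly_diffq.
Proof.
move=> a p q; apply/polyP => j.
rewrite coefD coefZ !coef_poly_diffq -linearP /=; congr moment_fun.
by apply/polyP => i; rewrite !(coef_drop_poly, coefD, coefZ).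
Qed.

HB.instance Definition _ :=
  GRing.isLinear.Build F {poly F} {poly F} *:%R poly_diffq poly_diffq_linear.

Lemma poly_diffqXM p : poly_diffq ('X * p) = 'X * poly_diffq p + (moment_fun p)%:P.
Proof.
apply/polyP => j; rewrite coefD coefXM coefC !coef_poly_diffq.
have -> : drop_poly j.+1 ('X * p) = drop_poly j p.
  by apply/polyP => i; rewrite !coef_drop_poly coefXM addnS.
case: j => [|j] /=; last by rewrite addr0.
by rewrite add0r; congr moment_fun; apply/polyP => i; rewrite coef_drop_poly addn0.
Qed.

Lemma poly_diffqXsubM a p :
  poly_diffq (('X - a%:P) * p) = ('X - a%:P) * poly_diffq p + (moment_fun p)%:P.
Proof.
by rewrite !mulrBl linearB /= poly_diffqXM !mul_polyC linearZ /= addrAC.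
Qed.

(** The factorisation of [(u^n - v^n) / (u - v)] with [u = x - a] and [v = y - a]. For [n = 0] the
    sum is empty, so the truncated [n.-1] does no harm. *)
Lemma poly_diffq_exp a n :
  poly_diffq (('X - a%:P) ^+ n) =
  \sum_(k < n) moment_fun (('X - a%:P) ^+ k) *: ('X - a%:P) ^+ (n.-1 - k).
Proof.
elim: n => [|n IH].
  rewrite expr0 big_ord0; apply/polyP => j; rewrite coef_poly_diffq coef0.
  by rewrite drop_poly_eq0 ?linear0 // size_poly1.
rewrite exprS poly_diffqXsubM IH big_ord_recr /= subnn expr0 alg_polyC; congr (_ + _).
rewrite mulr_sumr; apply: eq_bigr => k _; rewrite -scalerAr -exprS; congr (_ *: _ ^+ _).
by case: n k {IH} => [[]//|n] k /=; rewrite subSn // -ltnS.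
Qed.

Variable lam : F.
Hypothesis c0 : c 0%N = 1.
Hypothesis cS : forall n, c n.+1 = lam * c n + \sum_(j < n) c j * c (n - j)%N.

(** At [p = 'X^n] this is the recursion [cS], the extra [c n] being the last term of the
    convolution. In this form both sides are linear in [p] and no centre is singled out, so powers
    of ['X - a%:P] may be inserted. *)
Lemma moment_fun_schwinger_dyson p :
  moment_fun ('X * p) + (1 - lam) * moment_fun p = moment_fun (poly_diffq ('X * p)).
Proof.
rewrite -[p]coefK poly_def.
have -> : 'X * (\sum_(i < size p) p`_i *: 'X^i) = \sum_(i < size p) p`_i *: 'X^(i.+1).
  by rewrite mulr_sumr; apply: eq_bigr => i _; rewrite -scalerAr -exprS.
rewrite !linear_sum mulr_sumr -big_split /=.
apply: eq_bigr => i _; rewrite !linearZ /= mulrCA -mulrDr; congr (_ * _).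
rewrite !moment_funXn cS.
rewrite (_ : 'X^(i.+1) = ('X - 0%:P) ^+ i.+1); last by rewrite subr0.
rewrite poly_diffq_exp linear_sum /= big_ord_recr /= linearZ /= subnn expr0.
rewrite !subr0 moment_funXn.
have -> : moment_fun 1 = 1 by rewrite -(expr0 'X) moment_funXn.
rewrite mulr1 addrAC mulrBl mul1r addrCA subrr addr0 addrC; congr (_ + _).
by apply: eq_bigr => j _; rewrite linearZ /= !moment_funXn.
Qed.

(** The previous identity at [('X - a%:P) ^+ n]; writing the outer factor ['X] as
    [('X - a%:P) + a%:P] produces the two convolutions. *)
Lemma shifted_moment_rec a n (e := fun k => moment_fun (('X - a%:P) ^+ k)) :
  e n.+1 + (a + 1 - lam) * e n =
  \sum_(k < n.+1) e k * e (n - k)%N + a * \sum_(k < n) e k * e (n.-1 - k)%N.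
Proof.
have := moment_fun_schwinger_dyson (('X - a%:P) ^+ n).
have -> : 'X * ('X - a%:P) ^+ n = ('X - a%:P) ^+ n.+1 + a *: ('X - a%:P) ^+ n.
  by rewrite exprS -mul_polyC -mulrDl subrK.
rewrite !linearD !linearZ /= -/(e n.+1) -/(e n) !poly_diffq_exp !linear_sum /=.
move=> E; rewrite -addrA mulrDl addrA E; congr (_ + _ * _); apply: eq_bigr => k _;
  by rewrite linearZ.
Qed.

End MomentFunctional.

(** * Complex limits and truncated power series *)

Section ComplexLimits.
Variable R : realType.

Definition ccvg (u : nat -> R[i]) (l : R[i]) :=
  nc (u n - l) @[n --> \oo] --> (0 : R).

Lemma ccvgP (u : nat -> R[i]) (l : R[i]) :
  ccvg u l <-> (u n : (R[i])^o) @[n --> \oo] --> (l : (R[i])^o).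
Proof.
split=> /cvgrPdist_lt ul; apply/cvgrPdist_lt => e.
  rewrite ltcE => /andP[/= /eqP ie e0].
  have := ul _ e0; apply: filterS => n /=.
  rewrite sub0r normrN ger0_norm ?nc_ge0 // => un.
  by rewrite normr_nc ltcE /= ie eqxx /= ncBC.
move=> e0; have e0' : 0 < e%:C :> R[i] by rewrite ltcR.
have := ul _ e0'; apply: filterS => n /=.
by rewrite normr_nc ltcR sub0r normrN ger0_norm ?nc_ge0 // ncBC.
Qed.

Lemma ccvgD u v k l : ccvg u k -> ccvg v l -> ccvg (fun n => u n + v n) (k + l).
Proof.
move=> /ccvgP uk /ccvgP vl; apply/ccvgP.
exact: (@cvgD (R[i]) (R[i])^o _ _ _ _ _ _ _ uk vl).
Qed.

Lemma ccvgM u v k l : ccvg u k -> ccvg v l -> ccvg (fun n => u n * v n) (k * l).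
Proof. by move=> /ccvgP uk /ccvgP vl; apply/ccvgP; exact: (@cvgM (R[i]) _ _ _ _ _ _ _ uk vl). Qed.

Lemma ccvg_cst k : ccvg (fun=> k) k.
Proof. by apply/ccvgP; exact: cvg_cst. Qed.

Lemma ccvgS u l : ccvg u l -> ccvg (fun n => u n.+1) l.
Proof. by rewrite /ccvg -cvg_shiftS. Qed.

Lemma ccvg_ext u v l : (forall n, u n = v n) -> ccvg u l -> ccvg v l.
Proof. by move=> /funext ->. Qed.

Lemma ccvg_unique u k l : ccvg u k -> ccvg u l -> k = l.
Proof.
move=> /ccvgP uk /ccvgP ul.
exact: (@cvg_unique _ (@norm_hausdorff (R[i]) (R[i])^o) _ _ _ _ uk ul).
Qed.

Lemma cvg0_le (u v : nat -> R) : (forall n, 0 <= u n <= v n) ->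
  v n @[n --> \oo] --> (0 : R) -> u n @[n --> \oo] --> (0 : R).
Proof.
move=> uv; apply: squeeze_cvgr (cvg_cst (0 : R)).
by apply: nearW => n; exact: uv.
Qed.

Lemma geometric_sum_le (p : R) n : 0 <= p -> p < 1 -> \sum_(i < n) p ^+ i <= (1 - p)^-1.
Proof.
move=> p0 p1; rewrite -[leRHS]mul1r ler_pdivlMr ?subr_gt0 //.
by rewrite mulrC -opprB mulNr -subrX1 opprB gerBl exprn_ge0.
Qed.

(* The pairs missing from the truncated product satisfy [j + l >= N]; writing
   [q = p^2], their total weight is at most [p^N] times a convergent double series. *)
Lemma cauchy_product_bound (b : nat -> R[i]) (K p : R) N :
  0 <= p -> p < 1 -> (forall n, nc (b n) <= K * (p ^+ 2) ^+ n) ->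
  nc (\sum_(i < N) \sum_(j < i.+1) b j * b (i - j)%N - (\sum_(j < N) b j) ^+ 2)
    <= (K / (1 - p)) ^+ 2 * p ^+ N.
Proof.
move=> p0 p1 bK.
rewrite (sum_triangle (fun j l => b j * b l)) ncBC expr2 mulr_suml -sumrB.
have K0 : 0 <= K by have := bK 0%N; rewrite expr0 mulr1; apply: le_trans; exact: nc_ge0.
apply: (@le_trans _ _ (\sum_(j < N) \sum_(l < N) K ^+ 2 * p ^+ N * (p ^+ j * p ^+ l))).
  apply: (le_trans (nc_sum _ _ _)); apply: ler_sum => j _.
  rewrite mulr_sumr (big_ord_widen N (fun l => b j * b l) (leq_subr _ _)).
  rewrite (bigID (fun l : 'I_N => l < N - j)%N) /= addrAC subrr add0r.
  apply: (le_trans (nc_sum _ _ _)); rewrite big_mkcond; apply: ler_sum => l _.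
  case: ifP => [|_]; last by rewrite !mulr_ge0 ?exprn_ge0.
  rewrite -leqNgt leq_subLR => jl; rewrite ncM.
  apply: (@le_trans _ _ (K * (p ^+ 2) ^+ j * (K * (p ^+ 2) ^+ l))).
    by rewrite ler_pM ?nc_ge0.
  have -> : K * p ^+ 2 ^+ j * (K * p ^+ 2 ^+ l) = K ^+ 2 * (p ^+ (j + l) * (p ^+ j * p ^+ l)).
    by rewrite -!exprM !mul2n -!addnn !exprD; ring.
  rewrite -mulrA ler_wpM2l ?exprn_ge0 // ler_wpM2r ?mulr_ge0 ?exprn_ge0 //.
  by rewrite ler_wiXn2l // ltW.
under eq_bigr do rewrite -mulr_sumr -mulr_sumr.
rewrite -mulr_sumr -mulr_suml.
have -> : (K / (1 - p)) ^+ 2 * p ^+ N = K ^+ 2 * p ^+ N * ((1 - p)^-1 * (1 - p)^-1) by ring.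
apply: ler_wpM2l; first by rewrite mulr_ge0 ?exprn_ge0.
by rewrite ler_pM ?geometric_sum_le // sumr_ge0 // => i _; rewrite exprn_ge0.
Qed.

End ComplexLimits.

(** The recursion times [t ^+ n.+2], summed over [n <= N]. Being exact for partial sums, it
    separates the algebra from the convergence, which concerns only [S] and [Q]. *)
Lemma truncated_series_rec (F : comNzRingType) (e : nat -> F) (t a k : F)
    (b := fun n => e n * t ^+ n) (S := fun N => \sum_(n < N) b n)
    (Q := fun N => \sum_(i < N) \sum_(j < i.+1) b j * b (i - j)%N) N :
  e 0%N = 1 ->
  (forall n, e n.+1 + k * e n =
     \sum_(j < n.+1) e j * e (n - j)%N + a * \sum_(j < n) e j * e (n.-1 - j)%N) ->
  t * (S N.+2 - 1) + k * t ^+ 2 * S N.+1 = t ^+ 2 * Q N.+1 + a * t * (t ^+ 2 * Q N).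
Proof.
move=> e0 erec.
have b0 : b 0%N = 1 by rewrite /b e0 expr0 mulr1.
have SS m : S m.+1 = S m + b m by rewrite /S big_ord_recr.
pose f m := \sum_(j < m.+1) e j * e (m - j)%N.
have QS m : Q m.+1 = Q m + t ^+ m * f m.
  rewrite /Q big_ord_recr; congr (_ + _); rewrite /f mulr_sumr; apply: eq_bigr => j _.
  by rewrite /b mulrACA -exprD subnKC -1?ltnS // mulrC.
have S0 : S 0%N = 0 by rewrite /S big_ord0.
have Q0 : Q 0%N = 0 by rewrite /Q big_ord0.
elim: N => [|N IH].
  have f0 : f 0%N = 1 by rewrite /f big_ord1 e0 mulr1.
  have := erec 0%N; rewrite -/(f 0%N) big_ord0 f0 e0 => /(canRL (addrK _)) e1.
  by rewrite !SS !QS S0 Q0 b0 f0 /b e1; ring.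
transitivity (t * (S N.+2 - 1) + k * t ^+ 2 * S N.+1 + (t * b N.+2 + k * t ^+ 2 * b N.+1)).
  by rewrite (SS N.+2) (SS N.+1); ring.
have -> : t * b N.+2 + k * t ^+ 2 * b N.+1 = t ^+ N.+3 * (f N.+1 + a * f N).
  by rewrite /f -(erec N.+1) /b !exprS; ring.
by rewrite IH (QS N.+1) (QS N) !exprS; ring.
Qed.

(** * The quadratic equation for the Stieltjes transform of the limit law *)

Section MarchenkoPastur.
Variables (R : realType) (lam : R) (MP : probability R R).
Hypotheses (lam_ge0 : 0 <= lam) (MP_law : is_marchenko_pastur lam MP).

Let mm n : R := nc_moment lam n.
Let c n : R[i] := (mm n)%:C.

Lemma mp_moment n : MP.-integrable setT (fun x : R => (x ^+ n)%:E) /\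
  \int[MP]_x (x ^+ n) = mm n.
Proof.
have [h1 h2] := MP_law n; split => //; rewrite h2 /mm /nc_moment /nc_weight.
by apply: eq_bigr => pi _; rewrite prodr_const.
Qed.

Let c0 : c 0%N = 1. Proof. by rewrite /c /mm nc_moment0. Qed.

Let cS n : c n.+1 = lam%:C * c n + \sum_(j < n) c j * c (n - j)%N.
Proof.
rewrite /c /mm nc_momentS rmorphD rmorphM; congr (_ + _); rewrite rmorph_sum /=.
by apply: eq_bigr => j _; rewrite rmorphM.
Qed.

Lemma mp_cint_poly (p : {poly R[i]}) :
  cintegrable MP (fun x => p.[x%:C]) /\ cint MP (fun x => p.[x%:C]) = moment_fun c p.
Proof.
have i1 i : cintegrable MP (fun x : R => x%:C ^+ i).
  split; under eq_fun do rewrite -rmorphXn /=; first exact: (mp_moment i).1.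
  exact: integrable0.
have -> : (fun x : R => p.[x%:C]) = (fun x => \sum_(i < size p) p`_i * x%:C ^+ i).
  by apply/funext => x; rewrite horner_coef.
split; first by apply: cintegrable_sum => i; exact: cintegrableM.
rewrite cint_sum; last by move=> i; exact: cintegrableM.
apply: eq_bigr => i _; rewrite cintM //; congr (_ * _).
apply: complex_eq => /=; under eq_Rintegral do rewrite -rmorphXn /=.
  exact: (mp_moment i).2.
by rewrite Rintegral_cst // mul0r.
Qed.

(* The choice [L = C ^ 2] gives [|z - a| >= 1 + L > s] when [1 <= Im z], so that the
   resolvent expansion about [a] converges at [z]. *)
Let C : R := 2 * lam + 4.
Let L : R := C ^+ 2.
Let a : R[i] := 0 -i* L.
Let s : R := Num.sqrt (C ^+ 2 + L ^+ 2).
Let C_gt0 : 0 < C. Proof. by rewrite /C; move: lam_ge0; lra. Qed.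
Let s_gt0 : 0 < s.
Proof. by rewrite sqrtr_gt0 ltr_wpDr ?sqr_ge0 // exprn_gt0. Qed.
Let s_sqr : s ^+ 2 = C ^+ 2 + L ^+ 2.
Proof. by rewrite sqr_sqrtr // addr_ge0 ?sqr_ge0. Qed.

Let g (x : R) : R := x ^+ 2 + L ^+ 2.

Let nc_sub_a (x : R) : nc (x%:C - a) ^+ 2 = g x.
Proof. by rewrite nc_sqr /= subr0 sub0r opprK. Qed.

(** [g x] is [|x - a|^2]. In the binomial expansion each even moment is at most [2 C^(2 k)], and the
    sum closes up to [2 (C^2 + L^2)^n]; this is the origin of [s]. *)
Let mp_gX n : MP.-integrable setT (fun x => (g x ^+ n)%:E) /\
  \int[MP]_x (g x ^+ n) <= 2 * (s ^+ 2) ^+ n.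
Proof.
pose p : {poly R[i]} := ('X^2 + ((L ^+ 2)%:C)%:P) ^+ n.
have gp x : p.[x%:C] = (g x ^+ n)%:C.
  by rewrite /p horner_exp hornerD hornerC hornerXn /g !(rmorphXn, rmorphD).
have gR x : g x ^+ n = Re p.[x%:C] by rewrite gp.
have [[h _] /(congr1 (@complex.Re R)) /= e] := mp_cint_poly p.
split; first by under eq_fun do rewrite gR.
under eq_Rintegral do rewrite gR.
rewrite e /p exprDn [moment_fun _ _]linear_sum Re_sum s_sqr exprDn mulr_sumr /=.
apply: ler_sum => i _.
have -> : 'X^2 ^+ (n - i) * ((L ^+ 2)%:C)%:P ^+ i *+ 'C(n, i) =
    ('C(n, i)%:R * (L ^+ 2) ^+ i)%:C *: 'X^(2 * (n - i)) :> {poly R[i]}.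
  rewrite -exprM -rmorphXn -rmorphXn /= mulrC mul_polyC -scaler_nat scalerA; congr (_ *: _).
  by rewrite rmorphM /= rmorph_nat.
rewrite linearZ /= moment_funXn -rmorphM /=.
have -> : 2 * ((C ^+ 2) ^+ (n - i) * (L ^+ 2) ^+ i *+ 'C(n, i)) =
    'C(n, i)%:R * (L ^+ 2) ^+ i * (2 * (C ^+ (2 * (n - i)))).
  by rewrite -mulr_natl exprM; ring.
apply: ler_wpM2l; first by apply: mulr_ge0; rewrite ?ler0n // exprn_ge0 // sqr_ge0.
exact: nc_moment_bound.
Qed.

(** An odd power of [|x - a|] is not a polynomial in [x]. The majorant [y^n <= s^n + y^(2 n) / s^n]
    uses even powers only and still has an integral of order [s^n]. *)
Let h n (x : R) : R := s ^+ n + (s ^+ n)^-1 * g x ^+ n.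

Let mp_h n : MP.-integrable setT (EFin \o h n) /\ \int[MP]_x h n x <= 3 * s ^+ n.
Proof.
have [i1 b1] := mp_gX n.
have i0 : MP.-integrable setT (EFin \o (fun=> s ^+ n)).
  by apply: finite_measure_integrable_cst.
have i2 : MP.-integrable setT (EFin \o (fun x => (s ^+ n)^-1 * g x ^+ n)).
  exact: (integrableZl measurableT _ i1).
split; first exact: (integrableD measurableT i0 i2).
rewrite RintegralD // Rintegral_cst // RintegralZl //.
have -> : fine (MP [set: R]) = 1 by rewrite probability_setT.
rewrite mulr1 (_ : 3 = 1 + 2) ?mulrDl ?mul1r ?lerD2l; last by ring.
rewrite ler_pdivrMl ?exprn_gt0 //.
by rewrite -mulr2n -mulr_natl mulrCA -expr2 -exprM mulnC exprM.
Qed.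

Let nc_sub_aX n x : nc (x%:C - a) ^+ n <= h n x.
Proof.
rewrite /h -nc_sub_a; set y := nc _; have y0 : 0 <= y by exact: nc_ge0.
have s0 := ltW s_gt0.
have [ys|sy] := leP y s.
  rewrite ler_wpDr ?lerXn2r ?nnegrE //.
  by rewrite mulr_ge0 ?invr_ge0 ?exprn_ge0 ?sqr_ge0.
rewrite ler_wpDl ?exprn_ge0 //.
rewrite ler_pdivlMl ?exprn_gt0 // -exprM mulnC exprM expr2.
by rewrite ler_wpM2r ?exprn_ge0 // lerXn2r ?nnegrE // ltW.
Qed.

Let e n : R[i] := moment_fun c (('X - a%:P) ^+ n).

Let cmeasurable_X f n : cmeasurable f -> cmeasurable (fun x : R => f x ^+ n : R[i]).
Proof.
move=> mf; elim: n => [|n IH].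
  by under eq_fun do rewrite expr0; exact: cmeasurable_cst.
by under eq_fun do rewrite exprS; exact: cmeasurableM.
Qed.

Let eE n : e n = cint MP (fun x : R => (x%:C - a) ^+ n).
Proof.
rewrite /e -(mp_cint_poly _).2; congr cint; apply/funext => x.
by rewrite horner_exp hornerXsubC.
Qed.

Let e_bound n : nc (e n) <= 6 * s ^+ n.
Proof.
have [ih bh] := mp_h n; rewrite eE (_ : 6 = 2 * 3); last by ring.
apply: le_trans (_ : 2 * \int[MP]_x h n x <= _); last by rewrite -mulrA ler_pM2l.
apply: nc_cint_le => //.
  apply: cmeasurable_X; apply: cmeasurableD; last exact: cmeasurable_cst.
  exact: cmeasurable_real.
by move=> x; rewrite ncX; exact: nc_sub_aX.
Qed.

Variable z : R[i].
Hypothesis Im_z : 1 <= Im z.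

Let z_gt0 : 0 < Im z. Proof. exact: lt_le_trans Im_z. Qed.
Let t : R[i] := (z - a)^-1.

Let za_neq0 : z - a != 0.
Proof.
apply/eqP => /(congr1 (@complex.Im R)); rewrite Im_add Im_opp /= opprK => /eqP.
by rewrite gt_eqF // ltr_wpDr // sqr_ge0.
Qed.

Let q : R := nc t * s.

Let q_ge0 : 0 <= q. Proof. by rewrite mulr_ge0 ?nc_ge0 // ltW. Qed.

Let q_lt1 : q < 1.
Proof.
rewrite /q /t ncV mulrC ltr_pdivrMr ?nc_gt0 // mul1r.
apply: lt_le_trans (ler_Im_nc _); apply: lt_le_trans (ler_norm _).
rewrite Im_add Im_opp /= opprK -(@ltr_pXn2r _ 2) ?nnegrE ?(ltW s_gt0) //; last first.
  by rewrite addr_ge0 ?sqr_ge0 // ltW.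
rewrite s_sqr -/L [ltRHS]sqrrD; have L0 : 0 < L by rewrite exprn_gt0.
have : L <= Im z * L by rewrite ler_peMl // ltW.
have : 0 < Im z ^+ 2 by rewrite exprn_gt0.
by move: L0; lra.
Qed.

Let S N : R[i] := \sum_(n < N) e n * t ^+ n.

(** The finite geometric sum has the exact remainder [(t (x - a))^N / (x - z)]. It need not be small
    for large [x], but the integral of [h N] is at most [3 s^N], which gives the rate
    [q = |t| s]. *)
Let mp_stieltjes_approx N : nc (- t * S N - stieltjes MP z) <= 6 / Im z * q ^+ N.
Proof.
have mr := cmeasurable_resolvent z.
have mX n : cmeasurable (fun x : R => (x%:C - a) ^+ n).
  apply: cmeasurable_X; apply: cmeasurableD; last exact: cmeasurable_cst.
  exact: cmeasurable_real.
have iX n : cintegrable MP (fun x : R => (x%:C - a) ^+ n).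
  apply: (cintegrable_dom (mX n) (mp_h n).1) => x.
  by rewrite ncX; exact: nc_sub_aX.
have ir : cintegrable MP (fun x : R => (x%:C - z)^-1).
  apply: (cintegrable_dom (h := fun=> (Im z)^-1) mr) => [|x].
    exact: finite_measure_integrable_cst.
  exact: nc_resolvent_le.
have -> : - t * S N - stieltjes MP z =
   -1 * cint MP (fun x : R => (x%:C - z)^-1 + \sum_(n < N) t ^+ n.+1 * (x%:C - a) ^+ n).
  rewrite cintD //; last by apply: cintegrable_sum => n; exact: cintegrableM.
  rewrite cint_sum; last by move=> n; exact: cintegrableM.
  rewrite mulN1r opprD addrC; congr (- _ + _).
  rewrite /S mulNr mulr_sumr; congr (- _); apply: eq_bigr => n _.
  by rewrite cintM // -eE exprS mulrCA mulrC.
rewrite ncM ncN nc1 mul1r.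
have [ih bh] := mp_h N.
apply: le_trans (_ : 2 * \int[MP]_x (nc t ^+ N / Im z * h N x) <= _); last first.
  rewrite RintegralZl // /q exprMn mulrA [2 * _]mulrC.
  have -> : 6 / Im z * (nc t ^+ N * s ^+ N) = nc t ^+ N / Im z * 2 * (3 * s ^+ N) by ring.
  rewrite ler_wpM2l // !mulr_ge0 ?exprn_ge0 ?nc_ge0 ?invr_ge0 //.
  exact: ltW.
apply: nc_cint_le.
- apply: cmeasurableD => //; apply: cmeasurable_sum => n.
  by apply: cmeasurableM => //; exact: cmeasurable_cst.
- exact: (integrableZl measurableT _ ih).
move=> x.
have xz : x%:C - z != 0 by rewrite real_sub_neq0 // gt_eqF.
have -> : (x%:C - z)^-1 + \sum_(n < N) t ^+ n.+1 * (x%:C - a) ^+ n =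
    (t * (x%:C - a)) ^+ N / (x%:C - z).
  have := subrX1 (t * (x%:C - a)) N.
  have -> : t * (x%:C - a) - 1 = t * (x%:C - z).
    by rewrite -[in X in _ - X](mulVf za_neq0) -/t -mulrBr; congr (_ * _); ring.
  have -> : \sum_(n < N) t ^+ n.+1 * (x%:C - a) ^+ n = t * \sum_(n < N) (t * (x%:C - a)) ^+ n.
    by rewrite mulr_sumr; apply: eq_bigr => n _; rewrite exprS exprMn mulrA.
  move=> /(canRL (subrK _)) ->; field.
  by rewrite xz.
rewrite ncM ncX ncM exprMn -mulrA -mulrA ler_wpM2l ?exprn_ge0 ?nc_ge0 //.
rewrite [leRHS]mulrC ler_pM ?exprn_ge0 ?nc_ge0 //.
exact: nc_resolvent_le.
Qed.

Lemma mp_stieltjes_eq (m := stieltjes MP z) :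
  z * m ^+ 2 + (z + 1 - lam%:C) * m + 1 = 0.
Proof.
pose p := Num.sqrt q.
have p0 : 0 <= p by exact: sqrtr_ge0.
have pp : p ^+ 2 = q by rewrite sqr_sqrtr.
have p1 : p < 1 by rewrite -(@ltr_pXn2r _ 2) ?nnegrE // pp expr1n.
pose b n := e n * t ^+ n.
have bK n : nc (b n) <= 6 * (p ^+ 2) ^+ n.
  rewrite pp /b ncM ncX /q exprMn [leRHS]mulrCA [leRHS]mulrC.
  by rewrite ler_wpM2r ?exprn_ge0 ?nc_ge0.
pose Q N := \sum_(i < N) \sum_(j < i.+1) b j * b (i - j)%N.
have geo (k : R) r : 0 <= r -> r < 1 -> k * r ^+ n @[n --> \oo] --> (0 : R).
  move=> r0 r1; rewrite -[X in _ --> X](mulr0 k); apply: cvgMr.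
  by apply: cvg_expr; rewrite ger0_norm.
have cT : ccvg (fun n => - t * S n) m.
  apply: cvg0_le (geo (6 / Im z) q q_ge0 q_lt1) => n.
  by rewrite nc_ge0 mp_stieltjes_approx.
(* As [t^2 S^2] is the square of [- t S], which tends to [m], only the error of the truncated Cauchy
   product has to vanish. *)
have cQ : ccvg (fun n => t ^+ 2 * Q n) (m * m).
  have d0 : ccvg (fun n => Q n - S n ^+ 2) 0.
    apply: cvg0_le (geo ((6 / (1 - p)) ^+ 2) p p0 p1) => n.
    by rewrite nc_ge0 subr0 cauchy_product_bound.
  have := ccvgD (ccvgM (ccvg_cst (t ^+ 2)) d0) (ccvgM cT cT).
  rewrite mulr0 add0r; apply: ccvg_ext => n.
  by move: (Q n) (S n) t => *; ring.
have srec k := shifted_moment_rec c0 cS a k; rewrite -/e in srec.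
have e0 : e 0%N = 1 by rewrite /e expr0 -(expr0 'X) moment_funXn c0.
have rec N := @truncated_series_rec _ e t a (a + 1 - lam%:C) N e0 srec.
have cL := ccvgD (ccvgD (ccvgS (ccvgS cT)) (ccvg_cst t))
  (ccvgM (ccvg_cst ((a + 1 - lam%:C) * t)) (ccvgS cT)).
have cR := ccvgD (ccvgS cQ) (ccvgM (ccvg_cst (a * t)) cQ).
have E := ccvg_unique (ccvg_ext _ cL) (ccvgM (ccvg_cst (- 1)) cR).
have {}E : m + t + (a + 1 - lam%:C) * t * m = - 1 * (m * m + a * t * (m * m)).
  apply: E => n /=; rewrite -/(Q n.+1) -/(Q n) -(rec n).
  by rewrite -/(S n.+1) -/(S n.+2); move: (S n.+1) (S n.+2) t a => *; ring.
have t0 : t != 0 by rewrite invr_eq0 za_neq0.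
(* Since [t (z - a) = 1], the centre [a] can be eliminated; what remains is [t] times the desired
   equation. *)
have za : a * t = z * t - 1.
  by rewrite -[1](mulfV za_neq0) -/t -mulrBl; congr (_ * _); ring.
apply: (mulfI t0); rewrite mulr0.
have -> : t * (z * m ^+ 2 + (z + 1 - lam%:C) * m + 1) =
  m + t + (z * t - 1 + (1 - lam%:C) * t) * m + (z * t) * (m * m).
  by move: (t) (z) (m) => *; ring.
have -> : m + t + (z * t - 1 + (1 - lam%:C) * t) * m = - 1 * (m * m + a * t * (m * m)).
  by rewrite -E -za; move: (t) (a) (m) => *; ring.
rewrite za.
by move: (t) (z) (m) => *; ring.
Qed.

End MarchenkoPastur.

(** * Stability of the self-consistent equation *)

Section Stability.
Variable R : realType.
Implicit Types (z s m e w : R[i]) (lam c : R).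

(** [|z| |1 + s| >= Im (z (1 + s)) >= Im z >= 1]. *)
Lemma nc_1D_gt0 z s : 1 <= Im z -> 0 <= Im (z * s) -> 1 + s != 0 /\ nc (1 + s)^-1 <= nc z.
Proof.
move=> z1 zs.
have h : 1 <= nc z * nc (1 + s).
  rewrite -ncM; apply: le_trans (ler_Im_nc _); apply: le_trans (ler_norm _).
  by rewrite mulrDr mulr1 Im_add; lra.
have s1 : 1 + s != 0.
  by apply/eqP => s0; move: h; rewrite s0 nc0 mulr0 ler10.
by split => //; rewrite ncV -[leLHS]mul1r ler_pdivrMr ?nc_gt0.
Qed.

(* Imaginary part of the equation [z w + 1 - e = lam w / (1 + w)] multiplied by [conj w]. *)
Lemma Im_self_consistent z w e lam : 1 + w != 0 ->
  e = 1 + z * w - lam%:C * w / (1 + w) ->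
  lam * (nc w / nc (1 + w)) ^+ 2 * Im w = Im w - Im z * nc w ^+ 2 + Im (e * w^*%C).
Proof.
move=> w1 ->.
have -> : (1 + z * w - lam%:C * w / (1 + w)) * w^*%C =
    w^*%C + (z - lam%:C / (1 + w)) * (w * w^*%C) by move: w^*%C => *; ring.
have -> : w * w^*%C = (nc w ^+ 2)%:C.
  rewrite nc_sqr; apply: complex_eq; rewrite ?Re_mul ?Im_mul; case: (w) => a b /=; ring.
rewrite Im_add Im_mul /= mulr0 add0r Im_add Im_opp Im_mul /= mul0r addr0 Im_inv Im_add /= add0r.
have -> : Im w^*%C = - Im w by case: (w).
by rewrite expr_div_n; ring.
Qed.

(** Subtracting the equations gives [(m - s) (1 - lam s m / ((1 + s) (1 + m))) = e m]. With
    [a = |s| / |1 + s|] and [b = |m| / |1 + m|], the imaginary part identity yields [lam a^2 <= 1],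
    thanks to [|e| <= |s|], and [lam b^2 <= 1 - |m|], as [m] is an exact solution. Hence
    [lam a b <= 1 - |m| / 2]: the second factor has modulus at least [|m| / 2], and [|m|]
    cancels. *)
Lemma self_consistent_stable z m lam s e :
  1 <= Im z -> 0 <= lam ->
  0 < Im m -> 1 + m != 0 -> 0 = 1 + z * m - lam%:C * m / (1 + m) -> nc m <= 2 ->
  0 < Im s -> 1 + s != 0 -> e = 1 + z * s - lam%:C * s / (1 + s) -> nc e <= nc s ->
  nc (s - m) <= 2 * nc e.
Proof.
move=> z1 l0 m0 m1 em nm s0 s1 es ne.
have ncm : 0 < nc m by apply: lt_le_trans m0 (le_trans (ler_norm _) (ler_Im_nc _)).
have ncs : 0 < nc s by apply: lt_le_trans s0 (le_trans (ler_norm _) (ler_Im_nc _)).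
set a := nc s / nc (1 + s); set b := nc m / nc (1 + m).
have ha : lam * a ^+ 2 <= 1.
  rewrite -(ler_pM2r s0) mul1r (Im_self_consistent s1 es).
  have : Im (e * s^*%C) <= nc s * nc s.
    apply: (le_trans (ler_norm _)); apply: (le_trans (ler_Im_nc _)).
    by rewrite ncM nc_conj ler_wpM2r // nc_ge0.
  have : nc s ^+ 2 <= Im z * nc s ^+ 2 by rewrite ler_peMl // sqr_ge0.
  by rewrite expr2; lra.
have hb : lam * b ^+ 2 <= 1 - nc m.
  rewrite -(ler_pM2r m0) (Im_self_consistent m1 em) mul0r /= addr0 mulrBl mul1r.
  rewrite lerD2l lerN2; apply: (@le_trans _ _ (nc m ^+ 2)).
    by rewrite expr2 ler_pM2l // (le_trans (ler_norm _)) // ler_Im_nc.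
  by rewrite ler_peMl // sqr_ge0.
have a0 : 0 <= a by rewrite divr_ge0 ?nc_ge0.
have b0 : 0 <= b by rewrite divr_ge0 ?nc_ge0.
have hab : lam * (a * b) <= 1 - nc m / 2.
  have ab0 : 0 <= lam * (a * b) by apply: mulr_ge0 => //; exact: mulr_ge0.
  rewrite -(@ler_pXn2r _ 2) ?nnegrE //; last by lra.
  have -> : (lam * (a * b)) ^+ 2 = (lam * a ^+ 2) * (lam * b ^+ 2) by ring.
  apply: (@le_trans _ _ (1 * (1 - nc m))).
    by apply: ler_pM => //; apply: mulr_ge0; rewrite // sqr_ge0.
  by have := sqr_ge0 (nc m / 2); rewrite [X in _ -> _ <= X]expr2; lra.
have key : (m - s) * (1 - lam%:C * (s / (1 + s) * (m / (1 + m)))) = e * m.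
  transitivity (e * m - (1 + z * m - lam%:C * m / (1 + m)) * s).
    by rewrite es; field; rewrite m1 s1.
  by rewrite -em mul0r subr0.
have /(congr1 (@nc R)) := key; rewrite !ncM => key'.
have hc : nc m / 2 <= nc (1 - lam%:C * (s / (1 + s) * (m / (1 + m)))).
  have := ncD (1 - lam%:C * (s / (1 + s) * (m / (1 + m)))) (lam%:C * (s / (1 + s) * (m / (1 + m)))).
  rewrite subrK nc1 => h.
  have h2 : nc (lam%:C * (s / (1 + s) * (m / (1 + m)))) = lam * (a * b).
    by rewrite ncM nc_real ger0_norm // !ncM !ncV.
  by move: h; rewrite h2; lra.
rewrite ncBC -(ler_pM2r (_ : 0 < nc m / 2)) ?divr_gt0 //.
have -> : 2 * nc e * (nc m / 2) = nc e * nc m by field.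
by rewrite -key' ler_wpM2l // nc_ge0.
Qed.

(** The condition [|e| <= |s|] of the previous lemma follows from the equation itself: if
    [|e| <= 1/2], then [1 <= |e| + |z| |s| (1 + lam)] forces [|s| >= s0]. Replacing [c] by [lam]
    changes the error by at most [delta |z|], whence the division by [1 + nc z]. *)
Lemma stieltjes_eq_stable z m lam (eps : R) :
  1 <= Im z -> 0 <= lam -> 0 < Im m -> nc m <= 2 ->
  z * m ^+ 2 + (z + 1 - lam%:C) * m + 1 = 0 -> 0 < eps ->
  exists2 delta : R, 0 < delta & forall s c,
    0 < Im s -> 0 <= Im (z * s) -> nc s <= 1 -> `|c - lam| <= delta ->
    nc (1 + z * s - c%:C * s / (1 + s)) <= delta -> nc (s - m) <= eps.
Proof.
move=> z1 l0 m0 nm qm eps0.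
have nz : 0 < nc z by apply: lt_le_trans (ler_Im_nc z); rewrite gtr0_norm; lra.
have m1 : 1 + m != 0.
  by apply/eqP => /(congr1 (@complex.Im R)); rewrite Im_add /= add0r => /eqP; rewrite gt_eqF.
have em : 0 = 1 + z * m - lam%:C * m / (1 + m).
  by apply: (mulIf m1); rewrite mul0r -qm; field.
pose s0 := (2 * nc z * (1 + lam))^-1.
have s00 : 0 < s0 by rewrite invr_gt0 !mulr_gt0 //; lra.
pose r := Num.min (2^-1) (Num.min s0 (eps / 2)).
have r0 : 0 < r by rewrite !lt_min s00 divr_gt0 // invr_gt0 ltr0n.
have [r1 [r2 r3]] : r <= 2^-1 /\ (r <= s0 /\ r <= eps / 2).
  by rewrite !ge_min !lexx !orbT.
exists (r / (1 + nc z)) => [|s c ims zs ns cl he]; first by rewrite divr_gt0 // addr_gt0.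
have [s1 s1V] := nc_1D_gt0 z1 zs.
set e := 1 + z * s - lam%:C * s / (1 + s).
have ne : nc e <= r.
  have -> : e = (1 + z * s - c%:C * s / (1 + s)) + (c - lam)%:C * (s / (1 + s)).
    by rewrite /e rmorphB /=; ring.
  apply: (le_trans (ncD _ _)); rewrite ncM nc_real ncM ncV in s1V *.
  rewrite -[leRHS](divfK (x := 1 + nc z)) ?gt_eqF ?addr_gt0 // [leRHS]mulrDr mulr1 lerD //.
  rewrite ler_pM ?mulr_ge0 ?invr_ge0 ?nc_ge0 //.
  by rewrite -[leRHS]mul1r ler_pM ?invr_ge0 ?nc_ge0.
have lbs : r <= nc s.
  apply: (le_trans r2); rewrite /s0 -[leLHS]mul1r ler_pdivrMr ?mulr_gt0 //; last by lra.
  have h1 : 1 <= nc e + (nc z * nc s + lam * (nc s * nc z)).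
    rewrite -{1}(@nc1 R) (_ : 1 = e + (- (z * s) + lam%:C * (s / (1 + s)))); last first.
      by rewrite /e; ring.
    apply: (le_trans (ncD _ _)); rewrite lerD2l; apply: (le_trans (ncD _ _)).
    rewrite ncN ncM lerD2l ncM nc_real ger0_norm // ler_wpM2l // ncM.
    by rewrite ler_wpM2l ?nc_ge0.
  by move: h1 ne r1; nra.
apply: le_trans (self_consistent_stable z1 l0 m0 m1 em nm ims s1 erefl _) _.
  exact: le_trans ne lbs.
by rewrite -/e; lra.
Qed.

End Stability.

(** * Resolvents of Gram matrices and rank-one updates *)

Section Resolvent.
Variable R : realType.
Variable d : nat.
Local Notation C := R[i].
Implicit Types (M A H : 'M[C]_d) (x : 'cV[C]_d) (z : C).

Definition quad A x : C := (x^t* *m A *m x) 0 0.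

Definition resolvent M z := invmx (M - z%:M).

(** The predicate makes the full matrix ([xpredT]) and the leave-one-out matrices ([predC1 k])
    instances of one construction. *)
Definition gram (N : nat) (p : pred nat) (x : nat -> 'cV[C]_d) : 'M[C]_d :=
  \sum_(k < N | p k) x k *m (x k)^t*.

Lemma adjmxM m n k (A : 'M[C]_(m, n)) (B : 'M[C]_(n, k)) : (A *m B)^t* = B^t* *m A^t*.
Proof. by rewrite trmx_mul map_mxM. Qed.

Lemma gram_hermitian N p (x : nat -> 'cV[C]_d) : (gram N p x)^t* = gram N p x.
Proof.
rewrite /gram linear_sum /= raddf_sum /=; apply: eq_bigr => k _.
by rewrite adjmxM trmxCK.
Qed.

Lemma mulJ_nc (a : C) : a^*%C * a = (nc a ^+ 2)%:C.
Proof.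
rewrite nc_sqr; apply: complex_eq; rewrite ?Re_mul ?Im_mul; case: a => a b /=; ring.
Qed.

Lemma mulmx_adj x : (x^t* *m x) 0 0 = (\sum_i nc (x i 0) ^+ 2)%:C.
Proof.
by rewrite mxE rmorph_sum /=; apply: eq_bigr => i _; rewrite !mxE -mulJ_nc.
Qed.

Definition spectral_decomposition M (P : 'M[C]_d) (l : 'I_d -> R) :=
  [/\ P \is unitarymx, M = P^t* *m diag_mx (\row_i (l i)%:C) *m P & forall i, 0 <= l i].

(** An eigenvalue is a diagonal entry of [P *m M *m P^t*], that is a sum of squares [|(P x_k)_i|^2],
    hence nonnegative. *)
Lemma gram_spectral N p (x : nat -> 'cV[C]_d) (M := gram N p x) :
  spectral_decomposition M (spectralmx M) (fun i => Re (spectral_diag M 0 i)).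
Proof.
have hM : M \is hermsymmx.
  by apply/is_hermitianmxP; rewrite expr0 scale1r; rewrite gram_hermitian.
have /orthomx_spectralP eM := hermitian_normalmx hM.
set P := spectralmx M in eM *; set D := spectral_diag M in eM *.
have uP : P \is unitarymx by exact: spectral_unitarymx.
rewrite invmx_unitary // in eM.
have rD i : (Re (D 0 i))%:C = D 0 i.
  by apply: RRe_real; have /mxOverP /(_ 0 i) := hermitian_spectral_diag_real hM.
have PP : P *m P^t* = 1%:M by apply/unitarymxP.
split => // [|i].
  rewrite {1}eM; congr (_ *m diag_mx _ *m _); apply/rowP => i.
  by rewrite mxE rD.
have dE : diag_mx D = P *m M *m P^t*.
  by rewrite eM !mulmxA PP mul1mx -mulmxA PP mulmx1.
have -> : D 0 i = diag_mx D i i by rewrite mxE eqxx mulr1n.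
rewrite dE /M /gram mulmx_sumr mulmx_suml summxE Re_sum sumr_ge0 // => k _.
have -> : P *m (x k *m (x k)^t*) *m P^t* = (P *m x k) *m (P *m x k)^t*.
  by rewrite adjmxM !mulmxA.
rewrite mxE big_ord1 !mxE mulrC [_ * _]mulJ_nc /=.
exact: sqr_ge0.
Qed.

Section OneDecomposition.
Variables (M P : 'M[C]_d) (l : 'I_d -> R) (z : C).
Hypotheses (dec : spectral_decomposition M P l) (Im_z : 0 < Im z).

Let PP : P *m P^t* = 1%:M. Proof. by case: dec => /unitarymxP. Qed.
Let PP' : P^t* *m P = 1%:M.
Proof. by case: dec => uP _ _; rewrite -invmx_unitary // mulVmx // unitarymx_unit. Qed.

Let r i : C := ((l i)%:C - z)^-1.
Let lz i : (l i)%:C - z != 0. Proof. by rewrite real_sub_neq0 // gt_eqF. Qed.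

Let resE_aux : (M - z%:M) *m (P^t* *m diag_mx (\row_i r i) *m P) = 1%:M.
Proof.
have -> : M - z%:M = P^t* *m diag_mx (\row_i ((l i)%:C - z)) *m P.
  have -> : \row_i ((l i)%:C - z) = \row_i (l i)%:C - const_mx z.
    by apply/rowP => i; rewrite !mxE.
  rewrite linearB /= mulmxBr mulmxBl diag_const_mx; case: dec => _ {1}-> _.
  by congr (_ - _); rewrite scalar_mxC -mulmxA PP' mulmx1.
rewrite !mulmxA -[X in X *m _ *m _]mulmxA PP mulmx1 -[X in X *m _]mulmxA mulmx_diag.
rewrite (_ : \row_i _ = const_mx 1) ?diag_const_mx ?mulmx1 //.
by apply/rowP => i; rewrite !mxE divff.
Qed.

Lemma resolvent_unit : M - z%:M \in unitmx.
Proof. by have [] := mulmx1_unit resE_aux. Qed.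

Lemma resolvent_spectral : resolvent M z = P^t* *m diag_mx (\row_i r i) *m P.
Proof.
by rewrite -[RHS](mulKmx resolvent_unit) resE_aux mulmx1.
Qed.

Lemma tr_resolvent : \tr (resolvent M z) = \sum_i r i.
Proof.
rewrite resolvent_spectral -mulmxA mxtrace_mulC -mulmxA PP mulmx1 mxtrace_diag.
by apply: eq_bigr => i _; rewrite mxE.
Qed.

Lemma quad_spectral x (D : 'rV[C]_d) :
  quad (P^t* *m diag_mx D *m P) x = \sum_i (nc ((P *m x) i 0) ^+ 2)%:C * D 0 i.
Proof.
rewrite /quad !mulmxA -adjmxM -[_ *m P *m x]mulmxA mxE.
move: (P *m x) => w; apply: eq_bigr => i _.
by rewrite mul_mx_diag !mxE -mulJ_nc mulrAC.
Qed.

Lemma quad_resolvent x :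
  quad (resolvent M z) x = \sum_i (nc ((P *m x) i 0) ^+ 2)%:C * r i.
Proof.
by rewrite resolvent_spectral quad_spectral; apply: eq_bigr => i _; rewrite mxE.
Qed.

Lemma quad_resolvent2 x :
  quad (resolvent M z *m resolvent M z) x = \sum_i (nc ((P *m x) i 0) ^+ 2)%:C * r i ^+ 2.
Proof.
rewrite resolvent_spectral !mulmxA -[X in X *m _ *m _]mulmxA PP mulmx1.
rewrite -[X in X *m _]mulmxA mulmx_diag quad_spectral.
by apply: eq_bigr => i _; rewrite !mxE.
Qed.

(** Positive semidefiniteness enters here: [z / (l - z) = l / (l - z) - 1] with [l >= 0]. *)
Lemma Im_z_resolvent_ge0 i : 0 <= Im (z * r i).
Proof.
have -> : z * r i = (l i)%:C * r i - 1 by rewrite /r; field; exact: lz.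
rewrite Im_add Im_opp Im_mul /= mul0r addr0 subr0 /r Im_resolvent.
by case: dec => _ _ l0; rewrite mulr_ge0 ?l0 // divr_ge0 ?sqr_ge0 // ltW.
Qed.

Lemma Im_quad_resolvent x : 0 <= Im (quad (resolvent M z) x) /\
  0 <= Im (z * quad (resolvent M z) x).
Proof.
rewrite quad_resolvent mulr_sumr !Im_sum; split; apply: sumr_ge0 => i _.
  rewrite Im_mul /= mul0r addr0 mulr_ge0 ?sqr_ge0 //.
  exact: ltW (Im_resolvent_gt0 (l i) Im_z).
rewrite mulrCA Im_mul /= mul0r addr0 mulr_ge0 ?sqr_ge0 //.
exact: Im_z_resolvent_ge0.
Qed.

(** The identity [|r|^2 = Im r / Im z] for [r = 1 / (l - z)], summed over the spectrum. *)
Lemma quad_resolvent2_le x :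
  nc (quad (resolvent M z *m resolvent M z) x) <= Im (quad (resolvent M z) x) / Im z.
Proof.
rewrite quad_resolvent2 quad_resolvent Im_sum mulr_suml.
apply: (le_trans (nc_sum _ _ _)); apply: ler_sum => i _.
rewrite ncM nc_real ger0_norm ?sqr_ge0 // Im_mul /= mul0r addr0 -mulrA.
apply: ler_wpM2l; first exact: sqr_ge0.
rewrite ncX /r ncV exprVn Im_resolvent mulrAC divff ?mul1r //.
by rewrite gt_eqF.
Qed.

End OneDecomposition.

Section RankOneUpdate.
Variables (N : nat) (x : nat -> 'cV[C]_d) (z : C).
Hypothesis Im_z : 1 <= Im z.

Let z_gt0 : 0 < Im z. Proof. exact: lt_le_trans Im_z. Qed.

Let M := gram N xpredT x.
Let G := resolvent M z.
Let Mk (k : nat) := gram N (predC1 k) x.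
Let Hk k := resolvent (Mk k) z.
Let q k := quad (Hk k) (x k).

Lemma gram_leave_one_out (k : 'I_N) : M = Mk k + x k *m (x k)^t*.
Proof. by rewrite /M /gram (bigD1 k) //= addrC. Qed.

Lemma one_add_quad_neq0 k : 1 + q k != 0 /\ nc (1 + q k)^-1 <= nc z.
Proof.
have [_ h] := Im_quad_resolvent (gram_spectral N (predC1 k) x) z_gt0 (x k).
exact: nc_1D_gt0 h.
Qed.

Let uG : M - z%:M \in unitmx.
Proof. exact: (resolvent_unit (gram_spectral N xpredT x) z_gt0). Qed.

Let uH k : Mk k - z%:M \in unitmx.
Proof. exact: (resolvent_unit (gram_spectral N (predC1 k) x) z_gt0). Qed.

(** The Sherman-Morrison formula applied to [x k]: it comes from
    [(M - z) H_k x_k = (1 + q_k) x_k]. *)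
Lemma resolvent_update_col (k : 'I_N) : G *m x k = (1 + q k)^-1 *: (Hk k *m x k).
Proof.
have e : (M - z%:M) *m (Hk k *m x k) = (1 + q k) *: x k.
  rewrite (gram_leave_one_out k) addrAC mulmxDl mulmxA mulmxV // mul1mx scalerDl scale1r.
  congr (_ + _); rewrite -mulmxA [X in _ *m X = _]mx11_scalar.
  by rewrite mul_mx_scalar /q /quad mulmxA.
have [q1 _] := one_add_quad_neq0 k.
by rewrite -[Hk k *m x k](mulKmx uG) e -scalemxAr scalerA mulVf // scale1r.
Qed.

Lemma quad_update (k : 'I_N) : quad G (x k) = q k / (1 + q k).
Proof.
rewrite /quad -mulmxA resolvent_update_col -scalemxAr mxE mulrC.
by rewrite /q /quad mulmxA.
Qed.

(** The difference of the traces is [x_k^* H_k^2 x_k / (1 + q_k)], and the numerator is at most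
    [Im q_k / Im z <= |1 + q_k|]. The bound therefore does not grow with [d] or [N]. *)
Lemma tr_resolvent_update (k : 'I_N) : nc (\tr (Hk k) - \tr G) <= 1.
Proof.
have e : Hk k - G = G *m (x k *m (x k)^t*) *m Hk k.
  have -> : x k *m (x k)^t* = (M - z%:M) - (Mk k - z%:M).
    by rewrite (gram_leave_one_out k); apply/matrixP => i j; rewrite !mxE; ring.
  by rewrite mulmxBr mulVmx // mulmxBl mul1mx -mulmxA mulmxV // mulmx1.
rewrite -linearB /= e mulmxA resolvent_update_col -!scalemxAl linearZ /=.
rewrite -!mulmxA mulmxA mxtrace_mulC -mulmxA mulmxA.
have -> : \tr ((x k)^t* *m Hk k *m (Hk k *m x k)) = quad (Hk k *m Hk k) (x k).
  by rewrite /mxtrace big_ord1 /quad !mulmxA.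
have [q1 _] := one_add_quad_neq0 k.
rewrite ncM ncV mulrC ler_pdivrMr ?nc_gt0 // mul1r.
have dk := gram_spectral N (predC1 (k : nat)) x.
apply: le_trans (quad_resolvent2_le dk z_gt0 (x k)) _.
have [h _] := Im_quad_resolvent dk z_gt0 (x k).
apply: (@le_trans _ _ (Im (q k))).
  by rewrite ler_pdivrMr // ler_peMr.
apply: le_trans (ler_Im_nc _); apply: le_trans (ler_norm _).
by rewrite Im_add /= add0r.
Qed.

Lemma tr_resolvent_identity : d%:R + z * \tr G = \sum_(k < N) q k / (1 + q k).
Proof.
under eq_bigr do rewrite -quad_update.
have -> : d%:R + z * \tr G = \tr (M *m G).
  rewrite -[M](subrK z%:M) mulmxDl mulmxV // linearD /= mxtrace1 mul_scalar_mx.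
  by rewrite linearZ.
rewrite {1}/M /gram mulmx_suml linear_sum /=; apply: eq_bigr => k _.
by rewrite -mulmxA mxtrace_mulC /mxtrace big_ord1 /quad.
Qed.

Let s := \tr G / d%:R.

Lemma resolvent_trace_facts : (0 < d)%N ->
  [/\ 0 < Im s, 0 <= Im (z * s) & nc s <= 1].
Proof.
move=> d0; have dk := gram_spectral N xpredT x.
have d0' : 0 < (d%:R : R) by rewrite ltr0n.
have dC : (d%:R : C) = (d%:R : R)%:C by rewrite rmorph_nat.
have sE : s = (d%:R^-1)%:C * \tr G by rewrite /s mulrC dC rmorphV ?unitfE ?gt_eqF.
rewrite sE (tr_resolvent dk z_gt0); split.
- rewrite Im_mul /= mul0r addr0 mulr_gt0 ?invr_gt0 // Im_sum.
  rewrite (bigD1 (Ordinal d0)) //= ltr_pwDl //; first exact: Im_resolvent_gt0.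
  by apply: sumr_ge0 => i _; exact: ltW (Im_resolvent_gt0 _ z_gt0).
- rewrite mulrCA Im_mul /= mul0r addr0 mulr_ge0 ?invr_ge0 ?(ltW d0') // mulr_sumr Im_sum.
  by apply: sumr_ge0 => i _; exact: (Im_z_resolvent_ge0 dk).
rewrite ncM nc_real ger0_norm ?invr_ge0 ?(ltW d0') // ler_pdivrMl // mulr1.
apply: (le_trans (nc_sum _ _ _)).
apply: (@le_trans _ _ (\sum_(i < d) 1)); last by rewrite sumr_const card_ord.
apply: ler_sum => i _; apply: le_trans (nc_resolvent_le _ z_gt0) _.
by rewrite invf_le1.
Qed.

(** The error is the average of [q_k / (1 + q_k) - s / (1 + s) = (q_k - s) / ((1 + q_k) (1 + s))].
    The denominators cost [|z|^2], and replacing [s] by [\tr (Hk k) / d%:R] costs [1 / d] in each of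
    the [N] terms. *)
Lemma self_consistency_error (c := N%:R / d%:R : R) : (0 < d)%N ->
  nc (1 + z * s - c%:C * s / (1 + s)) <=
  nc z ^+ 2 * (c / d%:R + d%:R^-1 * \sum_(k < N) nc (q k - \tr (Hk k) / d%:R)).
Proof.
move=> d0; have [s_gt0 zs_ge0 _] := resolvent_trace_facts d0.
have d0' : 0 < (d%:R : R) by rewrite ltr0n.
have dC : (d%:R : C) = (d%:R : R)%:C by rewrite rmorph_nat.
have dC0 : (d%:R : C) != 0 by rewrite pnatr_eq0 -lt0n.
have [s1 s1V] := nc_1D_gt0 Im_z zs_ge0.
have -> : 1 + z * s - c%:C * s / (1 + s) =
    (d%:R^-1)%:C * \sum_(k < N) (q k - s) * ((1 + q k)^-1 * (1 + s)^-1).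
  have -> : \sum_(k < N) (q k - s) * ((1 + q k)^-1 * (1 + s)^-1) =
      \sum_(k < N) (q k / (1 + q k) - s / (1 + s)).
    apply: eq_bigr => k _; have [q1 _] := one_add_quad_neq0 k.
    by field; rewrite q1 s1.
  have trE : \tr G = s * d%:R by rewrite /s divfK.
  have cC : c%:C = N%:R / d%:R :> C by rewrite /c rmorphM fmorphV /= -dC rmorph_nat.
  have dV : (d%:R^-1)%:C = d%:R^-1 :> C by rewrite fmorphV /= -dC.
  rewrite sumrB -tr_resolvent_identity sumr_const card_ord -[_ *+ N]mulr_natl trE cC dV.
  by field; rewrite dC0 s1.
rewrite ncM nc_real ger0_norm ?invr_ge0 ?(ltW d0') //.
have -> : nc z ^+ 2 * (c / d%:R + d%:R^-1 * \sum_(k < N) nc (q k - \tr (Hk k) / d%:R)) =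
    d%:R^-1 * \sum_(k < N) nc z ^+ 2 * (d%:R^-1 + nc (q k - \tr (Hk k) / d%:R)).
  rewrite -mulr_sumr big_split /= sumr_const card_ord /c -[X in _ = _ * (_ * (X + _))]mulr_natl.
  by ring.
rewrite ler_pM2l ?invr_gt0 //; apply: (le_trans (nc_sum _ _ _)); apply: ler_sum => k _.
have [_ q1] := one_add_quad_neq0 k.
rewrite !ncM mulrC expr2; apply: ler_pM; rewrite ?mulr_ge0 ?nc_ge0 //.
  by apply: ler_pM; rewrite ?nc_ge0.
have -> : q k - s = (\tr (Hk k) / d%:R - s) + (q k - \tr (Hk k) / d%:R) by ring.
apply: (le_trans (ncD _ _)); rewrite lerD2r /s -mulrBl ncM ncV dC nc_real ger0_norm ?(ltW d0') //.
by rewrite -[leRHS]mul1r ler_wpM2r ?invr_ge0 ?(ltW d0') // tr_resolvent_update.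
Qed.

End RankOneUpdate.

End Resolvent.

(** * Measurability of coordinates and of linear maps on the space of vectors *)

Section CvecMeasurability.
Variables (R : realType) (d : nat).

Lemma Re_continuous : continuous (fun a : (R[i])^o => (Re a : R)).
Proof.
move=> /= a A /= /(nbhs_ballP (Re a)) [e e0 eA].
apply/(@nbhs_ballP _ (R[i])^o); exists e%:C; first by rewrite /= ltcR.
move=> b; rewrite -ball_normE /= normr_nc ltcR => h; apply: eA.
rewrite -ball_normE /= -Re_opp -Re_add; exact: le_lt_trans (ler_Re_nc _) h.
Qed.

Lemma Im_continuous : continuous (fun a : (R[i])^o => (Im a : R)).
Proof.
move=> /= a A /= /(nbhs_ballP (Im a)) [e e0 eA].
apply/(@nbhs_ballP _ (R[i])^o); exists e%:C; first by rewrite /= ltcR.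
move=> b; rewrite -ball_normE /= normr_nc ltcR => h; apply: eA.
rewrite -ball_normE /= -Im_opp -Im_add; exact: le_lt_trans (ler_Im_nc _) h.
Qed.

Lemma continuous_Cvec_measurable (f : 'cV[(R[i])^o]_d -> R) :
  continuous f -> measurable_fun setT (f : Cvec R d -> R).
Proof.
move=> cf; apply: (measurability _ (RGenOpens.measurableE R)).
move=> _ [_ [a [b ->]] <-]; rewrite setTI.
apply: sub_sigma_algebra; move/continuousP : cf; apply; exact: interval_open.
Qed.

Lemma cmeasurable_coord i : cmeasurable (fun x : Cvec R d => (x : 'cV[R[i]]_d) i 0).
Proof.
split; apply: continuous_Cvec_measurable => x.
  exact: (continuous_comp (@coord_continuous (R[i] : numFieldType) d 1 i 0 x) (@Re_continuous _)).
exact: (continuous_comp (@coord_continuous (R[i] : numFieldType) d 1 i 0 x) (@Im_continuous _)).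
Qed.

Lemma measurable_mulmx (U : 'M[R[i]]_d) :
  measurable_fun setT (fun x : Cvec R d => (U *m (x : 'cV[R[i]]_d) : Cvec R d)).
Proof.
have mE : @measurable _ (Cvec R d) = <<s @open 'cV[(R[i])^o]_d >> by [].
apply: (measurability _ mE) => _ [A oA <-]; rewrite setTI.
apply: sub_sigma_algebra.
have : continuous (fun x : 'cV[(R[i])^o]_d => (U *m x : 'cV[(R[i])^o]_d)).
  move=> x A' [Q xQ QA].
  have cont i : continuous (fun y : 'cV[(R[i])^o]_d => (\sum_j U i j * y j 0 : (R[i])^o)).
    elim: (index_enum 'I_d) => [|j r IH] y0.
      under [X in continuous_at _ X]eq_fun do rewrite big_nil.
      exact: cst_continuous.
    under [X in continuous_at _ X]eq_fun do rewrite big_cons.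
    rewrite /continuous_at /=; apply: (@cvgD _ (R[i])^o _ _ (nbhs_filter y0)); last exact: IH.
    apply: (@cvgM (R[i] : numFieldType) _ _ (nbhs_filter y0) (fun=> U i j)
      (fun y : 'cV[(R[i])^o]_d => y j 0)); first exact: cvg_cst.
    exact: (@coord_continuous (R[i] : numFieldType) d 1 j 0 y0).
  have QU : \forall y \near x, forall i, Q i 0 ((U *m y) i 0).
    apply: (@filter_forall _ _ (fun i y => Q i 0 ((U *m y) i 0)) _ (nbhs_filter x)) => i.
    have := cont i x (Q i 0); rewrite /nbhs /= => H.
    have : nbhs (\sum_j U i j * x j 0 : (R[i])^o) (Q i 0) by have := xQ i 0; rewrite mxE.
    by move=> /H; apply: (@filterS _ _ (nbhs_filter x)) => y /=; rewrite mxE.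
  apply: (@filterS _ _ (nbhs_filter x) _ _ _ QU) => y h; apply: QA => i j; rewrite ord1; exact: h.
by move/continuousP; apply.
Qed.

End CvecMeasurability.

(** * Fourth moments of the uniform distribution and the variance of quadratic forms *)

Lemma reflection_sqr (F : comNzRingType) (d : nat) (i j : 'I_d) (s : F)
    (H := 1%:M + ((s - 1) *: delta_mx i i + (- s - 1) *: delta_mx j j
          + s *: delta_mx i j + s *: delta_mx j i) : 'M[F]_d) :
  i != j -> 2 * (s * s) = 1 -> H *m H = 1%:M.
Proof.
move=> neq_ij e; rewrite /H mulmxDl mul1mx mulmxDr mulmx1 -[RHS]addr0 -addrA.
congr (_ + _); rewrite !mulmxDl !mulmxDr -!scalemxAl -!scalemxAr !mul_delta_mx_cond.
rewrite !eqxx (negPf neq_ij) eq_sym (negPf neq_ij) /= !mulr1n !mulr0n.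
rewrite !scaler0 !addr0 !add0r !scalerA.
move: (delta_mx i i) (delta_mx j j) (delta_mx i j) (delta_mx j i) => p q u v.
transitivity ((2 * (s * s) - 1) *: (p + q)); last by rewrite e subrr scale0r.
by apply/matrixP => k l; rewrite !mxE; move: (p k l) (q k l) (u k l) (v k l) => *; ring.
Qed.

Section HalfTurn.
Variables (R : realType) (d : nat) (i j : 'I_d).
Hypothesis neq_ij : i != j.
Local Notation C := R[i].

Let s : C := ((Num.sqrt 2)^-1)%:C.
Let s_sqr : s * s = 2^-1.
Proof.
by rewrite /s -rmorphM /= -invfM -expr2 sqr_sqrtr // fmorphV /= rmorphD /= rmorph1.
Qed.

(* The reflection acting on the coordinates [i] and [j] by [(x_i + x_j, x_i - x_j) / sqrt 2]. *)
Definition half_turn : 'M[C]_d :=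
  1%:M + ((s - 1) *: delta_mx i i + (- s - 1) *: delta_mx j j
          + s *: delta_mx i j + s *: delta_mx j i).

Lemma half_turn_unitary : half_turn \is unitarymx.
Proof.
apply/unitarymxP.
have -> : half_turn^t* = half_turn.
  have conjs : (s^*)%R = s by rewrite /s; apply: complex_eq; rewrite /= ?oppr0.
  rewrite /half_turn !linearD !linearZ /= trmx1 !trmx_delta !map_mxD map_mx1 !map_mxZ.
  rewrite !map_delta_mx !rmorphB rmorphN rmorph1 /= conjs.
  rewrite conjC1.
  by rewrite [X in _ + X = _]addrAC.
by apply: reflection_sqr; rewrite // s_sqr mulfV // pnatr_eq0.
Qed.

Lemma delta_mulmx (a b k : 'I_d) (x : 'cV[C]_d) :
  (delta_mx a b *m x) k 0 = (k == a)%:R * x b 0.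
Proof.
rewrite mxE (bigD1 b) //= big1 ?addr0 => [|l lb]; first by rewrite mxE eqxx andbT.
by rewrite mxE (negPf lb) andbF mul0r.
Qed.

Lemma nc_half_turn (x : 'cV[C]_d) :
  nc ((half_turn *m x) i 0) ^+ 2 = nc (x i 0 + x j 0) ^+ 2 / 2 /\
  nc ((half_turn *m x) j 0) ^+ 2 = nc (x i 0 - x j 0) ^+ 2 / 2.
Proof.
have ns : nc s ^+ 2 = 2^-1.
  have n2 : nc (2 : C) = 2 by rewrite -(rmorph_nat (real_complex R)) nc_real ger0_norm.
  by rewrite expr2 -ncM s_sqr ncV n2.
have eji : (j == i) = false by rewrite eq_sym (negPf neq_ij).
have E k : (half_turn *m x) k 0 = x k 0 + ((s - 1) * ((k == i)%:R * x i 0) +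
    (- s - 1) * ((k == j)%:R * x j 0) + s * ((k == i)%:R * x j 0) + s * ((k == j)%:R * x i 0)).
  rewrite /half_turn mulmxDl mul1mx 3!mulmxDl -!scalemxAl mxE; congr (_ + _).
  move: (delta_mulmx i i k x) (delta_mulmx j j k x) (delta_mulmx i j k x) (delta_mulmx j i k x).
  move: (delta_mx i i *m x) (delta_mx j j *m x) (delta_mx i j *m x) (delta_mx j i *m x).
  by move=> A B X Y eA eB eX eY; rewrite !mxE eA eB eX eY.
have -> : (half_turn *m x) i 0 = s * (x i 0 + x j 0).
  by rewrite E eqxx (negPf neq_ij) /=; move: s (x i 0) (x j 0) => *; ring.
have -> : (half_turn *m x) j 0 = s * (x i 0 - x j 0).
  by rewrite E eqxx eji /=; move: s (x i 0) (x j 0) => *; ring.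
by rewrite !ncM !exprMn ns ![2^-1 * _]mulrC.
Qed.

End HalfTurn.

Section SphereMoments.
Variables (R : realType) (d : nat) (mu : probability (Cvec R d) R).
Hypothesis mu_unif : uniform_on_Csphere mu.
Hypothesis d_gt1 : (1 < d)%N.
Local Notation C := R[i].
Local Notation S := (@unit_Csphere R d).

Let w (i : 'I_d) (x : 'cV[C]_d) : R := nc (x i 0) ^+ 2.

Let w_ge0 i x : 0 <= w i x. Proof. exact: sqr_ge0. Qed.

Lemma sphere_sum (x : 'cV[C]_d) : S x <-> \sum_i w i x = 1.
Proof.
rewrite /unit_Csphere /=.
have -> : \sum_i `|x i 0| ^+ 2 = (\sum_i w i x)%:C.
  by rewrite rmorph_sum /=; apply: eq_bigr => i _; rewrite normr_nc rmorphXn.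
by split => [|->] //; move=> /(congr1 (@complex.Re R)).
Qed.

Lemma measurable_w i : measurable_fun setT (w i : Cvec R d -> R).
Proof. by apply: measurable_funX; apply: measurable_nc; exact: cmeasurable_coord. Qed.

Lemma measurable_sphere : measurable S.
Proof.
have mf : measurable_fun setT (fun x : Cvec R d => \sum_i w i (x : 'cV[C]_d)).
  by apply: measurable_sum => i; exact: measurable_w.
have -> : S = (fun x : Cvec R d => \sum_i w i (x : 'cV[C]_d)) @^-1` [set 1].
  by apply/seteqP; split => x /sphere_sum.
by rewrite -[X in measurable X]setTI; exact: mf.
Qed.

Lemma w_le1 i x : S x -> w i x <= 1.
Proof.
by move=> /sphere_sum <-; rewrite (bigD1 i) //= lerDl sumr_ge0.
Qed.

Lemma sphere_unitary U (x : 'cV[C]_d) : U \is unitarymx -> S (U *m x) <-> S x.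
Proof.
move=> uU; rewrite !sphere_sum.
have E (y : 'cV[C]_d) : (\sum_i w i y)%:C = (y^t* *m y) 0 0 by rewrite mulmx_adj.
have : (\sum_i w i (U *m x))%:C = (\sum_i w i x)%:C.
  rewrite !E adjmxM mulmxA -[_ *m U]mulmxA -[U^t*]invmx_unitary // mulVmx ?mulmx1 //.
  exact: unitarymx_unit.
by case=> ->.
Qed.

(** The integrands are polynomials, unbounded on the whole space; integrals are taken over the
    sphere, which has full measure and on which they are bounded. *)
Let integrable_S (f : Cvec R d -> R) K : measurable_fun setT f ->
  (forall x, S x -> `|f x| <= K) -> mu.-integrable S (EFin \o f).
Proof.
move=> mf fK; apply: measurable_bounded_integrable.
- exact: measurable_sphere.
- by rewrite (le_lt_trans (probability_le1 mu measurable_sphere)) // ltry.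
- exact: measurable_funTS.
exists K; split; first exact: num_real.
by move=> M KM x Sx; exact: le_trans (fK _ Sx) (ltW KM).
Qed.

Local Notation E f := (\int[mu]_(x in S) f x).

Lemma sphere_invariance U (f : Cvec R d -> R) K : U \is unitarymx ->
  measurable_fun setT f -> (forall x, S x -> `|f x| <= K) ->
  E (fun x => f (U *m (x : 'cV[C]_d))) = E f.
Proof.
move=> uU mf fK; rewrite /Rintegral; congr fine.
have mU := @measurable_mulmx R d U.
pose phi (x : Cvec R d) : Cvec R d := U *m (x : 'cV[C]_d).
have SU : phi @^-1` S = S by apply/seteqP; split => x /(sphere_unitary x uU).
have mfE : measurable_fun setT (EFin \o f) by exact/measurable_EFinP.
have mfU : measurable_fun setT (f \o phi) by exact: measurableT_comp.
have := @integral_pushforward _ _ _ _ R phi mU mu S (EFin \o f) mfE.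
rewrite SU => H.
rewrite -(H _ measurable_sphere); last first.
  apply: (@integrable_S _ K) => // x Sx; apply: fK.
  by move: Sx; rewrite -{1}SU.
apply: eq_measure_integral => A mA _; rewrite /pushforward.
by have [_ inv] := mu_unif; exact: (inv U uU A mA).
Qed.

Let m2 i j := E (fun x => w i x * w j x).

Let measurable_ww i j : measurable_fun setT (fun x : Cvec R d => w i x * w j x).
Proof. by apply: measurable_funM; exact: measurable_w. Qed.

Let ww_bound i j x : S x -> `|w i x * w j x| <= 1.
Proof.
move=> Sx; rewrite ger0_norm; last exact: mulr_ge0.
by apply: mulr_ile1 => //; exact: w_le1.
Qed.

Let w_perm (s : 'S_d) i (x : 'cV[C]_d) : w i (perm_mx s *m x) = w (s i) x.
Proof. by rewrite /w -row_permE mxE. Qed.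

Lemma perm_mx_unitary (s : 'S_d) : (perm_mx s : 'M[C]_d) \is unitarymx.
Proof.
by apply/unitarymxP; rewrite tr_perm_mx map_perm_mx -perm_mxM mulgV perm_mx1.
Qed.

Let m2_perm (s : 'S_d) i j : m2 (s i) (s j) = m2 i j.
Proof.
rewrite /m2 -(sphere_invariance (perm_mx_unitary s) (@measurable_ww i j) (@ww_bound i j)).
by apply: eq_Rintegral => x _; rewrite !w_perm.
Qed.

Let i0 : 'I_d := Ordinal (ltnW d_gt1).
Let i1 : 'I_d := Ordinal d_gt1.
Let neq01 : i0 != i1. Proof. by []. Qed.
Let a := m2 i0 i0.
Let b := m2 i0 i1.

Let m2_diag i : m2 i i = a.
Proof. by rewrite -(m2_perm (tperm i i0)) tpermL. Qed.

(** Permutations act doubly transitively on the coordinates: one transposition sends [i] to [i0], a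
    second one sends the image of [j] to [i1] and fixes [i0]. *)
Let m2_off i j : i != j -> m2 i j = b.
Proof.
move=> ij; rewrite -(m2_perm (tperm i i0)) tpermL.
set k := tperm i i0 j; have k0 : k != i0.
  by rewrite /k -{2}(tpermL i i0) (inj_eq perm_inj) eq_sym.
rewrite -(m2_perm (tperm k i1)) tpermL tpermD // eq_sym //.
Qed.

Let integrable_ww i j : mu.-integrable S (EFin \o (fun x => w i x * w j x)).
Proof. exact: integrable_S (@measurable_ww i j) (@ww_bound i j). Qed.

Let integrable_w i : mu.-integrable S (EFin \o (fun x => w i x)).
Proof.
apply: (@integrable_S _ 1) => [|x Sx]; first exact: measurable_w.
by rewrite ger0_norm ?w_le1.
Qed.

Let integrable_scale k (f : Cvec R d -> R) : mu.-integrable S (EFin \o f) ->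
  mu.-integrable S (EFin \o (fun x => k * f x)).
Proof. by move=> ih; exact: (integrableZl measurable_sphere k ih). Qed.

Let integrable_add (f g : Cvec R d -> R) : mu.-integrable S (EFin \o f) ->
  mu.-integrable S (EFin \o g) -> mu.-integrable S (EFin \o (fun x => f x + g x)).
Proof. by move=> fi gi; exact: (integrableD measurable_sphere fi gi). Qed.

Let integrable_lin (I : Type) (r : seq I) (k : I -> R) (f : I -> Cvec R d -> R) :
  (forall i, mu.-integrable S (EFin \o f i)) ->
  mu.-integrable S (EFin \o (fun x => \sum_(i <- r) k i * f i x)) /\
  E (fun x => \sum_(i <- r) k i * f i x) = \sum_(i <- r) k i * E (f i).
Proof.
move=> fi; elim: r => [|i r [IH1 IH2]].
  rewrite big_nil; under eq_Rintegral do rewrite big_nil.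
  split; last by rewrite Rintegral_cst ?mul0r //; exact: measurable_sphere.
  under [X in _.-integrable _ (EFin \o X)]eq_fun do rewrite big_nil.
  exact: integrable0.
rewrite big_cons -IH2 -RintegralZl //; last exact: measurable_sphere.
rewrite -RintegralD //; [|exact: measurable_sphere|exact: integrable_scale].
split; last by apply: eq_Rintegral => x _; rewrite big_cons.
under [X in _.-integrable _ (EFin \o X)]eq_fun do rewrite big_cons.
exact: (integrableD measurable_sphere (integrable_scale (k i) (fi i)) IH1).
Qed.

Let E1 : E (fun=> 1) = 1.
Proof.
have [mu1 _] := mu_unif; rewrite Rintegral_cst; last exact: measurable_sphere.
by rewrite mul1r [X in fine X]mu1.
Qed.

Let eq_on_sphere (f g : Cvec R d -> R) : (forall x, S x -> f x = g x) -> E f = E g.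
Proof. by move=> fg; apply: eq_Rintegral => x /[!inE]; exact: fg. Qed.

Let off_sum (h : 'I_d -> R) :
  \sum_i \sum_j h i * h j * m2 i j = (a - b) * \sum_i h i ^+ 2 + b * (\sum_i h i) ^+ 2.
Proof.
rewrite expr2 !mulr_suml mulr_sumr mulr_sumr -big_split /=; apply: eq_bigr => i _.
rewrite (bigD1 i) //= m2_diag (bigD1 i (F := fun j => h j)) //= mulrDr mulrDr.
under eq_bigr => j ji do rewrite m2_off 1?eq_sym // mulrC.
by rewrite -mulr_sumr -mulr_sumr; ring.
Qed.

(** Comes from integrating the square of [\sum_i w i x = 1]. *)
Let sum_ab : d%:R * a + d%:R * (d%:R - 1) * b = 1.
Proof.
rewrite -[RHS]E1; have -> : E (fun=> 1) = E (fun x => \sum_(p : 'I_d * 'I_d) 1 * (w p.1 x * w p.2 x)).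
  apply: eq_on_sphere => x /sphere_sum e.
  under eq_bigr do rewrite mul1r.
  by rewrite -(pair_bigA _ (fun i j => w i x * w j x)) /= -big_distrlr /= e mulr1.
rewrite (integrable_lin _ _ (fun p => integrable_ww p.1 p.2)).2.
rewrite -(pair_bigA _ (fun i j => 1 * m2 i j)) /=.
apply/esym; transitivity (\sum_(i < d) \sum_(j < d) 1 * 1 * m2 i j).
  by apply: eq_bigr => i _; apply: eq_bigr => j _; rewrite mulr1.
rewrite (off_sum (fun=> 1)) expr1n sumr_const card_ord -[1 *+ d]/(d%:R : R).
by ring.
Qed.

(** The reflection turns [|x_0|^4 + |x_1|^4] into [(|x_0 + x_1|^4 + |x_0 - x_1|^4) / 4], which by
    Cauchy-Schwarz is at most [(w_0^2 + w_1^2) / 2 + 3 w_0 w_1]. Integrating both sides gives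
    [2 a <= a + 3 b]. *)
Let half_turn_moment : a <= 3 * b.
Proof.
have uH := half_turn_unitary R neq01.
pose H := half_turn R i0 i1.
have HE k := sphere_invariance uH (@measurable_ww k k) (@ww_bound k k).
have mH k l : measurable_fun setT (fun x : Cvec R d => w k (H *m x) * w l (H *m x)).
  exact: (measurableT_comp (@measurable_ww k l) (measurable_mulmx H)).
have iH k : mu.-integrable S (EFin \o (fun x : Cvec R d => w k (H *m x) * w k (H *m x))).
  apply: (@integrable_S _ 1) => // x Sx; apply: ww_bound.
  by apply/(sphere_unitary _ uH).
have mS := measurable_sphere.
have i2 k l r := integrable_scale r (integrable_ww k l).
have : E (fun x => w i0 (H *m x) * w i0 (H *m x) + w i1 (H *m x) * w i1 (H *m x)) <=
   E (fun x => 2^-1 * (w i0 x * w i0 x) + (3 * (w i0 x * w i1 x) + 2^-1 * (w i1 x * w i1 x))).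
  apply: le_Rintegral => //.
  - exact: integrable_add.
  - by apply: integrable_add; [|apply: integrable_add]; exact: i2.
  move=> x _; rewrite /w; have [-> ->] := nc_half_turn neq01 x.
  rewrite !nc_sqr !Re_add !Im_add !Re_opp !Im_opp.
  move: (Re _) (Re _) (Im _) (Im _) => p q r s.
  by have := sqr_ge0 (p * s - q * r); nra.
rewrite !RintegralD //; try (by exact: i2); last by apply: integrable_add; exact: i2.
rewrite !RintegralZl // !HE -/(m2 _ _) -/(m2 _ _) -/(m2 _ _) !m2_diag -/b.
lra.
Qed.

Let off_le_diag : b <= a.
Proof.
have i2 k l r := integrable_scale r (integrable_ww k l).
have : 0 <= E (fun x => w i0 x * w i0 x + (- 2 * (w i0 x * w i1 x) + w i1 x * w i1 x)).
  by apply: Rintegral_ge0 => x _; have := sqr_ge0 (w i0 x - w i1 x); lra.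
have mS := measurable_sphere.
rewrite !RintegralD //; try (by exact: i2); last by apply: integrable_add => //; exact: i2.
by rewrite RintegralZl // -/(m2 _ _) -/(m2 _ _) -/(m2 _ _) !m2_diag -/b; lra.
Qed.

Let mean_w i : E (w i) = d%:R^-1.
Proof.
have d0 : (d%:R : R) != 0 by rewrite pnatr_eq0 -lt0n ltnW.
have w1 k x : S x -> `|w k x| <= 1 by move=> Sx; rewrite ger0_norm ?w_le1.
have eqE k : E (w k) = E (w i).
  rewrite -(sphere_invariance (perm_mx_unitary (tperm i k)) (@measurable_w i) (@w1 i)).
  by apply: eq_Rintegral => x _; rewrite w_perm tpermL.
apply: (mulIf d0); rewrite mulVf // -[RHS]E1.
have -> : E (fun=> 1) = E (fun x => \sum_k 1 * w k x).
  by apply: eq_on_sphere => x /sphere_sum e; under eq_bigr do rewrite mul1r.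
rewrite (integrable_lin _ _ integrable_w).2; under eq_bigr do rewrite mul1r eqE.
by rewrite sumr_const card_ord mulr_natr.
Qed.

(** With [H] the sum of the [h i], the variance is [(a - b) \sum_i h i ^+ 2 + (b - d^-2) H^2]. The
    term in [H^2] could be of order [1], but it is nonpositive: [d a + d (d - 1) b = 1] and [b <= a]
    give [b <= d^-2]. *)
Let real_variance (h : 'I_d -> R) :
  mu.-integrable S (EFin \o (fun x => (\sum_i h i * w i x - (\sum_i h i) / d%:R) ^+ 2)) /\
  E (fun x => (\sum_i h i * w i x - (\sum_i h i) / d%:R) ^+ 2) <= a * \sum_i h i ^+ 2.
Proof.
set H := \sum_i h i; have mS := measurable_sphere.
have d1 : (1 : R) <= d%:R by rewrite ler1n ltnW.
have d0 : (0 : R) < d%:R by lra.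
have [ii eE] := integrable_lin (index_enum ('I_d * 'I_d)%type) (fun p => h p.1 * h p.2)
   (fun p => integrable_ww p.1 p.2).
have [il lE] := integrable_lin (index_enum 'I_d) h integrable_w.
have ic : mu.-integrable S (EFin \o (fun=> (H / d%:R) ^+ 2)).
  by apply: (@integrable_S _ (`|(H / d%:R) ^+ 2|)).
have -> : (fun x => (\sum_i h i * w i x - H / d%:R) ^+ 2) =
   (fun x => \sum_(p : 'I_d * 'I_d) h p.1 * h p.2 * (w p.1 x * w p.2 x) +
     (- (2 * (H / d%:R)) * (\sum_i h i * w i x) + (H / d%:R) ^+ 2)).
  apply/funext => x.
  rewrite -(pair_bigA _ (fun i j => h i * h j * (w i x * w j x))) /=.
  have -> : \sum_i \sum_j h i * h j * (w i x * w j x) = (\sum_i h i * w i x) * (\sum_i h i * w i x).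
    rewrite big_distrlr /=; apply: eq_bigr => i _; apply: eq_bigr => j _; ring.
  by ring.
have i2 := integrable_add (integrable_scale (- (2 * (H / d%:R))) il) ic.
split; first exact: integrable_add.
rewrite RintegralD // eE RintegralD //; last exact: integrable_scale.
rewrite RintegralZl // lE.
under [X in _ * X]eq_bigr do rewrite mean_w.
rewrite -mulr_suml -/H.
have -> : E (fun=> (H / d%:R) ^+ 2) = (H / d%:R) ^+ 2.
  have [mu1 _] := mu_unif; rewrite Rintegral_cst; last exact: measurable_sphere.
  by rewrite [X in fine X]mu1 mulr1.
rewrite -(pair_bigA _ (fun i j => h i * h j * m2 i j)) /= off_sum -/H.
set Q := \sum_i h i ^+ 2.
have -> : (a - b) * Q + b * H ^+ 2 + (- (2 * (H / d%:R)) * (H / d%:R) + (H / d%:R) ^+ 2) =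
   (a - b) * Q + (b - (d%:R ^+ 2)^-1) * H ^+ 2 by rewrite -exprVn; ring.
have b0 : 0 <= b.
  by apply: Rintegral_ge0 => x _; exact: mulr_ge0.
have Q0 : 0 <= Q by rewrite sumr_ge0 // => i _; exact: sqr_ge0.
have bd : b <= (d%:R ^+ 2)^-1.
  rewrite -[leRHS]mul1r ler_pdivlMr ?exprn_gt0 // -[leRHS]sum_ab.
  by have := ler_wpM2l (ltW d0) off_le_diag; lra.
have : (b - (d%:R ^+ 2)^-1) * H ^+ 2 <= 0.
  by rewrite mulr_le0_ge0 ?sqr_ge0 // subr_le0.
by have : 0 <= b * Q by [exact: mulr_ge0]; lra.
Qed.

(** Invariance removes [P] and leaves [\sum_i g i |x_i|^2], whose real and imaginary parts fall
    under [real_variance]; together they give at most [a d]. Finally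
    [d (d - 1) a <= 3 d (d - 1) b <= 3]. *)
Lemma quad_variance (P : 'M[C]_d) (g : 'I_d -> C) : P \is unitarymx ->
  (forall i, nc (g i) <= 1) ->
  (\int[mu]_x (nc (quad (P^t* *m diag_mx (\row_i g i) *m P) (x : 'cV[C]_d)
      - (\sum_i g i) / d%:R) ^+ 2)%:E <= (3 / (d%:R - 1))%:E)%E.
Proof.
move=> uP g1; have mS := measurable_sphere.
have d1 : (1 : R) < d%:R by rewrite ltr1n.
have d0 : (0 : R) < d%:R by lra.
pose f (x : Cvec R d) : C := \sum_i (w i x)%:C * g i - (\sum_i g i) / d%:R.
pose fP (x : Cvec R d) : R := nc (f (P *m (x : 'cV[C]_d))) ^+ 2.
have cf : cmeasurable f.
  apply: cmeasurableD; last exact: cmeasurable_cst.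
  apply: cmeasurable_sum => i; apply: cmeasurableM; last exact: cmeasurable_cst.
  by split; [exact: measurable_w | exact: measurable_cst].
have mf : measurable_fun setT (fun x => nc (f x) ^+ 2).
  by apply: measurable_funX; exact: measurable_nc.
have mfP : measurable_fun setT fP by exact: (measurableT_comp mf (measurable_mulmx P)).
have -> : (\int[mu]_x (nc (quad (P^t* *m diag_mx (\row_i g i) *m P) (x : 'cV[C]_d)
      - (\sum_i g i) / d%:R) ^+ 2)%:E = \int[mu]_x (fP x)%:E)%E.
  apply: eq_integral => x _; congr ((nc (_ - _) ^+ 2)%:E).
  by rewrite quad_spectral //; apply: eq_bigr => i _; rewrite mxE.
have [mu1 inv] := mu_unif.
have muC : mu (~` S) = 0%E by rewrite probability_setC // mu1 subee.
rewrite (ge0_negligible_integral (measurableC mS) measurableT) //; last 2 first.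
- exact/measurable_EFinP.
- by move=> x _; rewrite lee_fin sqr_ge0.
rewrite setTD setCK.
have fE (x : Cvec R d) : nc (f x) ^+ 2 =
    (\sum_i Re (g i) * w i x - (\sum_i Re (g i)) / d%:R) ^+ 2 +
    (\sum_i Im (g i) * w i x - (\sum_i Im (g i)) / d%:R) ^+ 2.
  have dC : (d%:R : C)^-1 = (d%:R^-1 : R)%:C by rewrite fmorphV rmorph_nat.
  rewrite nc_sqr /f dC; congr (_ ^+ 2 + _ ^+ 2).
    rewrite Re_add Re_opp Re_mul /= mulr0 subr0 !Re_sum; congr (_ - _).
    by apply: eq_bigr => i _; rewrite Re_mul /= mul0r subr0 mulrC.
  rewrite Im_add Im_opp Im_mul /= mulr0 add0r !Im_sum; congr (_ - _).
  by apply: eq_bigr => i _; rewrite Im_mul /= mul0r addr0 mulrC.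
have [i1' v1] := real_variance (fun i => Re (g i)).
have [i2' v2] := real_variance (fun i => Im (g i)).
have f_bound x : S x -> `|nc (f x) ^+ 2| <= 2 ^+ 2.
  move=> Sx; rewrite ger0_norm ?sqr_ge0 // lerXn2r ?nnegrE ?nc_ge0 //.
  rewrite (_ : 2 = 1 + 1) //; apply: (le_trans (ncD _ _)); apply: lerD.
    apply: (le_trans (nc_sum _ _ _)); move/sphere_sum : Sx => <-; apply: ler_sum => i _.
    by rewrite ncM nc_real ger0_norm // -[leRHS]mulr1 ler_wpM2l.
  rewrite ncN ncM ncV -(rmorph_nat (real_complex R)) nc_real ger0_norm ?(ltW d0) //.
  rewrite ler_pdivrMr // mul1r; apply: (le_trans (nc_sum _ _ _)).
  by rewrite -[d in leRHS]card_ord -sumr_const; apply: ler_sum.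
have iP : mu.-integrable S (EFin \o fP).
  apply: (integrable_S mfP) => x Sx; apply: f_bound.
  exact/(sphere_unitary _ uP).
rewrite -[leLHS]fineK; last exact: (integrable_fin_num mS iP).
rewrite lee_fin -/(Rintegral mu S fP) /fP (sphere_invariance uP mf f_bound).
rewrite (eq_on_sphere (fun x _ => fE x)) RintegralD //.
apply: (le_trans (lerD v1 v2)); rewrite -mulrDr -big_split /=.
have a0 : 0 <= a by apply: Rintegral_ge0 => x _; exact: mulr_ge0.
apply: (@le_trans _ _ (a * d%:R)).
  apply: ler_wpM2l => //; rewrite -[d in leRHS]card_ord -sumr_const; apply: ler_sum => i _.
  by rewrite -nc_sqr expr_le1 ?nc_ge0.
rewrite ler_pdivlMr ?subr_gt0 //; have := half_turn_moment.
have h : 0 <= (d%:R : R) * a by rewrite mulr_ge0 // ltW.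
have k0 : 0 <= (d%:R : R) * (d%:R - 1) by rewrite mulr_ge0 ?subr_ge0 ?ltW.
move=> /(ler_wpM2l k0); have := sum_ab; lra.
Qed.

End SphereMoments.

(** * Measurability of matrix-valued functions and of resolvents *)

Section MatrixMeasurability.
Context {R : realType} {disp : measure_display} {T : measurableType disp}.
Local Notation C := R[i].

Definition mx_cmeasurable m n (A : T -> 'M[C]_(m, n)) :=
  forall i j, cmeasurable (fun w => A w i j).

Lemma cmeasurable_det n (A : T -> 'M[C]_n) : mx_cmeasurable A ->
  cmeasurable (fun w => \det (A w)).
Proof.
move=> mA; apply: cmeasurable_sum => s; apply: cmeasurableM; first exact: cmeasurable_cst.
by apply: cmeasurable_prod.
Qed.

Lemma mx_cmeasurableM m n p (A : T -> 'M[C]_(m, n)) (B : T -> 'M[C]_(n, p)) :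
  mx_cmeasurable A -> mx_cmeasurable B -> mx_cmeasurable (fun w => A w *m B w).
Proof.
move=> mA mB i j; under eq_fun do rewrite mxE.
by apply: cmeasurable_sum => k; exact: cmeasurableM.
Qed.

Lemma mx_cmeasurable_adj m n (A : T -> 'M[C]_(m, n)) :
  mx_cmeasurable A -> mx_cmeasurable (fun w => (A w)^t*).
Proof.
by move=> mA i j; under eq_fun do rewrite !mxE; exact: cmeasurable_conj.
Qed.

(** By Cramer's rule the entries of the inverse are polynomials in the entries of the matrix divided
    by the determinant. *)
Lemma mx_cmeasurable_inv n (A : T -> 'M[C]_n) : (forall w, A w \in unitmx) ->
  mx_cmeasurable A -> mx_cmeasurable (fun w => invmx (A w)).
Proof.
move=> uA mA i j; under eq_fun => w do rewrite /invmx uA !mxE.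
apply: cmeasurableM; first by apply: cmeasurableV; exact: cmeasurable_det.
apply: cmeasurableM; first exact: cmeasurable_cst.
apply: cmeasurable_det => i' j'; under eq_fun do rewrite !mxE; exact: mA.
Qed.

Lemma mx_cmeasurable_resolvent d N (p : pred nat) (x : nat -> T -> 'cV[C]_d) (z : C) : 0 < Im z ->
  (forall k, p k -> mx_cmeasurable (x k)) ->
  mx_cmeasurable (fun w => resolvent (gram N p (fun k => x k w)) z).
Proof.
move=> z0 mx; apply: mx_cmeasurable_inv => [w|i j].
  exact: (resolvent_unit (gram_spectral _ _ _) z0).
under eq_fun do rewrite mxE; apply: cmeasurableD; last exact: cmeasurable_cst.
under eq_fun do rewrite /gram summxE big_mkcond.
apply: cmeasurable_sum => k; case pk : (p k); last exact: cmeasurable_cst.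
by apply: mx_cmeasurableM; [|apply: mx_cmeasurable_adj]; exact: mx.
Qed.

Lemma cmeasurable_quad d (A : T -> 'M[C]_d) (x : T -> 'cV[C]_d) :
  mx_cmeasurable A -> mx_cmeasurable x -> cmeasurable (fun w => quad (A w) (x w)).
Proof.
move=> mA mx; apply: (mx_cmeasurableM _ mx).
by apply: mx_cmeasurableM => //; exact: mx_cmeasurable_adj.
Qed.

Lemma cmeasurable_tr d (A : T -> 'M[C]_d) : mx_cmeasurable A ->
  cmeasurable (fun w => \tr (A w)).
Proof. by move=> mA; apply: cmeasurable_sum. Qed.

End MatrixMeasurability.

Lemma mx_cmeasurable_comp {R : realType} d1 d2 (T1 : measurableType d1) (T2 : measurableType d2)
    m n (A : T2 -> 'M[R[i]]_(m, n)) (f : T1 -> T2) :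
  measurable_fun setT f -> mx_cmeasurable A -> mx_cmeasurable (fun w => A (f w)).
Proof.
move=> mf mA i j; have [h1 h2] := mA i j.
by split; [exact: (measurableT_comp h1 mf)|exact: (measurableT_comp h2 mf)].
Qed.

Lemma mx_cmeasurable_Cvec (R : realType) d :
  mx_cmeasurable (fun x : Cvec R d => (x : 'cV[R[i]]_d)).
Proof. by move=> i j; rewrite ord1; exact: cmeasurable_coord. Qed.

(** * Independence of one vector from all the others *)

Section LeaveOneOutIndependence.
Variables (R : realType) (disp disp' : measure_display).
Variables (T : measurableType disp) (V : measurableType disp') (P : probability T R).
Variable X : nat -> {mfun T >-> V}.
Hypothesis X_indep : mutually_independent P X.
Variable k : nat.

(** These are the events about which the independence hypothesis speaks; they are stable under
    intersection, as the uniqueness theorem for measures requires of a generating class. *)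
Definition other_cylinders : set (set T) :=
  [set B | exists s (A : nat -> set V), [/\ uniq s, k \notin s,
     forall j, j \in s -> measurable (A j) & B = \bigcap_(j in [set` s]) X j @^-1` A j]].

(* [T] with the coarser sigma-algebra generated by the variables other than [X k]. *)
Definition others := g_sigma_algebraType other_cylinders.

Lemma measurable_to_others : measurable_fun setT (idfun : T -> others).
Proof.
apply: (@measurability _ _ T others setT idfun other_cylinders erefl).
move=> _ [B [s [A [us ks mA ->]]] <-]; rewrite setTI.
apply: fin_bigcap_measurable => // j js.
by rewrite -[X in measurable X]setTI; exact: (measurable_funP (X j) measurableT _ (mA j js)).
Qed.

Lemma measurable_from_others j : j != k -> measurable_fun setT (X j : others -> V).
Proof.
move=> jk _ A mA; rewrite setTI; apply: sub_sigma_algebra.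
exists [:: j], (fun=> A); split => //; first by rewrite inE eq_sym.
apply/seteqP; split => [w h i|w /(_ j)]; first by rewrite /= inE => /eqP ->.
by apply; rewrite /= inE.
Qed.

Let others_fun : {mfun T >-> others} :=
  HB.pack (idfun : T -> others) (isMeasurableFun.Build _ _ _ _ _ measurable_to_others).

Definition others_law := distribution P others_fun.

Lemma other_cylinders_setI : setI_closed other_cylinders.
Proof.
move=> _ _ [s [A [us ks mA ->]]] [s' [A' [us' ks' mA' ->]]].
exists (undup (s ++ s')),
  (fun j => (if j \in s then A j else setT) `&` (if j \in s' then A' j else setT)).
split; first exact: undup_uniq.
- by rewrite mem_undup mem_cat negb_or ks.
- by move=> j _; apply: measurableI; case: ifP => //; [exact: mA|exact: mA'].
apply/seteqP; split => w.
  move=> [h h'] j /=; rewrite mem_undup mem_cat => _.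
  by split; case: ifP => // js; [exact: h|exact: h'].
move=> h; split => j /= js.
  by have [|+ _] := h j; rewrite /= ?mem_undup ?mem_cat ?js.
by have [|_ +] := h j; rewrite /= ?mem_undup ?mem_cat ?js ?orbT.
Qed.

(** For fixed [A], both sides are finite measures in [B], and they agree on the cylinders. *)
Lemma independent_of_others (A : set V) (B : set others) :
  measurable A -> measurable B ->
  P (X k @^-1` A `&` B) = (P (X k @^-1` A) * P B)%E.
Proof.
move=> mA mB; set XA := X k @^-1` A.
have mXA : measurable XA.
  by rewrite -[X in measurable X]setTI; exact: (measurable_funP (X k) measurableT _ mA).
have r0 : 0 <= fine (P XA) by rewrite fine_ge0.
have PXA : P XA = (fine (P XA))%:E by rewrite fineK // fin_num_measure.
pose m1 : {measure set others -> \bar R} :=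
  pushforward (mrestr P mXA) (idfun : T -> others).
pose m2 : {measure set others -> \bar R} := mscale (NngNum r0) others_law.
have m12 : forall C, other_cylinders C -> m1 measurable_to_others C = m2 C.
  move=> _ [s [A' [us ks mA' ->]]]; rewrite /m1 /m2 /= /pushforward /mrestr /mscale /=.
  rewrite [X in P (X `&` _)](_ : _ = \bigcap_(j in [set` s]) X j @^-1` A' j) //.
  have -> : \bigcap_(j in [set` s]) X j @^-1` A' j `&` XA =
     \bigcap_(j in [set` (k :: s)]) X j @^-1` (if j == k then A else A' j).
    apply/seteqP; split => w.
      move=> [h hA] j; rewrite /= inE => /orP[/eqP ->|js]; first by rewrite eqxx.
      by case: eqP => [->|_]; [exact: hA|exact: h].
    move=> h; split => [j js|].
      have := h j; rewrite /= inE js orbT => /(_ isT); case: eqP => // jk.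
      by move: ks; rewrite -jk js.
    by have := h k; rewrite /= inE !eqxx => /(_ isT).
  rewrite X_indep /= ?ks //; last first.
    by move=> j; rewrite inE => /orP[/eqP ->|js]; [rewrite eqxx|case: eqP => // _; exact: mA'].
  rewrite big_cons eqxx -/XA PXA; congr (_ * _)%E.
  rewrite /others_law /distribution /pushforward /=.
  transitivity (\prod_(j <- s) P (X j @^-1` A' j))%E; last by rewrite -X_indep.
  apply: eq_big_seq => j js; case: eqP => // jk.
  by move: ks; rewrite -jk js.
have finm : forall _ : nat, (m1 measurable_to_others setT < +oo)%E.
  move=> _; rewrite /m1 /= /pushforward /mrestr preimage_setT setTI.
  by rewrite (le_lt_trans (probability_le1 P mXA)) // ltry.
have cov : \bigcup_(_ in [set: nat]) [set: others] = setT by rewrite bigcup_const //; exists 0%N.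
have covG : forall _ : nat, other_cylinders setT.
  move=> _; exists [::], (fun=> setT); split => //.
  by apply/esym/seteqP; split => // w _ j.
have := @measure_unique _ R others other_cylinders (fun=> setT) erefl
  other_cylinders_setI covG cov (m1 measurable_to_others) m2 m12 finm B mB.
by rewrite /m1 /m2 /= /pushforward /mrestr /mscale /= preimage_id setIC -PXA.
Qed.

(** The joint law of [X k] and the identity map into [others] is a product measure, so Tonelli's
    theorem applies to every integrand that sees [w] only through the other variables. *)
Lemma integral_independent (f : V * others -> R) :
  measurable_fun setT f -> (forall v, 0 <= f v) ->
  (\int[P]_w (f (X k w, w))%:E =
   \int[others_law]_y \int[distribution P (X k)]_x (f (x, y))%:E)%E.
Proof.
move=> mf f0; have mfE : measurable_fun setT (EFin \o f) by exact/measurable_EFinP.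
pose phi (w : T) : V * others := (X k w, w).
have mphi : measurable_fun setT phi.
  by apply: measurable_fun_pair => //; exact: measurable_to_others.
have mu (A : set V) (B : set others) : measurable A -> measurable B ->
    pushforward P phi (A `*` B) = (distribution P (X k) A * others_law B)%E.
  by move=> mA mB; exact: independent_of_others.
have f0E v : (0 <= (EFin \o f) v)%E by rewrite lee_fin.
rewrite -(@fubini_tonelli2 _ _ _ _ R (distribution P (X k)) others_law (EFin \o f) mfE f0E).
transitivity (\int[pushforward P phi]_v (f v)%:E)%E.
  by rewrite (ge0_integral_pushforward mphi) // => v _; exact: f0E.
apply: eq_measure_integral => A mA _; apply/esym.
exact: (@product_measure_unique _ _ _ _ R (distribution P (X k)) others_law
  (pushforward P phi) mu A mA).
Qed.

End LeaveOneOutIndependence.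

(** [H] is measurable for the other vectors and can be frozen; the inner integral is then the
    variance of a fixed quadratic form, with coefficients [1 / (l_i - z)] of modulus at most [1]. *)
Lemma leave_one_out_variance (R : realType) (disp : measure_display)
    (T : measurableType disp) (P : probability T R) (d : nat)
    (u : nat -> {RV P >-> Cvec R d}) (N k : nat) (z : R[i])
    (H := fun w => resolvent (gram N (predC1 k) (fun j => u j w)) z) :
  mutually_independent P u -> uniform_on_Csphere (distribution P (u k)) ->
  (1 < d)%N -> 1 <= Im z ->
  (\int[P]_w (nc (quad (H w) (u k w) - \tr (H w) / d%:R) ^+ 2)%:E <= (3 / (d%:R - 1))%:E)%E.
Proof.
move=> u_indep u_unif d1 z1; have z0 : 0 < Im z by exact: lt_le_trans z1.
pose W := others u k.
have mH : mx_cmeasurable (H : W -> _).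
  apply: (@mx_cmeasurable_resolvent _ _ W d N (predC1 k) (fun j (w : W) => u j w) z z0) => j jk.
  exact: (@mx_cmeasurable_comp R _ _ W (Cvec R d) d 1 _ (u j)
    (measurable_from_others (X := u) jk) (@mx_cmeasurable_Cvec R d)).
pose f (v : Cvec R d * W) : R := nc (quad (H v.2) v.1 - \tr (H v.2) / d%:R) ^+ 2.
have mf : measurable_fun setT f.
  apply: measurable_funX; apply: measurable_nc; apply: cmeasurableD.
    apply: cmeasurable_quad.
      exact: (mx_cmeasurable_comp measurable_snd mH).
    exact: (mx_cmeasurable_comp measurable_fst (@mx_cmeasurable_Cvec R d)).
  apply: cmeasurableN; apply: cmeasurableM; last exact: cmeasurable_cst.
  apply: cmeasurable_tr; exact: (mx_cmeasurable_comp measurable_snd mH).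
have f0 v : 0 <= f v by exact: sqr_ge0.
rewrite (integral_independent u_indep mf f0).
have inner y : (\int[distribution P (u k)]_x (f (x, y))%:E <= (3 / (d%:R - 1))%:E)%E.
  have dec := gram_spectral N (predC1 k) (fun j => u j y).
  rewrite /f /= /H (tr_resolvent dec z0) (resolvent_spectral dec z0).
  apply: quad_variance => //; first by case: dec.
  move=> i; apply: (le_trans (nc_resolvent_le _ z0)).
  by rewrite invf_le1.
have c0 : 0 <= 3 / (d%:R - 1) :> R by rewrite divr_ge0 // subr_ge0 ler1n ltnW.
apply: (@le_trans _ _ (\int[@others_law _ _ _ _ _ P u k]_y (3 / (d%:R - 1))%:E)%E).
  apply: ge0_le_integral => //.
    by move=> y _; apply: integral_ge0 => x _; rewrite lee_fin.
  have mfE : measurable_fun setT (EFin \o f) by exact/measurable_EFinP.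
  exact: (@measurable_fun_fubini_tonelli_G _ _ _ _ R (distribution P (u k)) (EFin \o f) mfE f0).
have law1 : (@others_law _ _ _ _ _ P u k) setT = 1%E by exact: (@probability_setT _ _ _ P).
by rewrite integral_cst // [X in (_ * X)%E]law1 mule1.
Qed.

(** * Stieltjes transforms of spectral distributions *)

Section SpectralStieltjes.
Variables (R : realType) (d : nat) (M : 'M[R[i]]_d).
Local Notation C := R[i].

Let ev k := nth 0 (eigenvalues M) k.

Let integral_spectral_ge0 (h : R -> R) : measurable_fun setT h -> (forall x, 0 <= h x) ->
  (\int[spectral_distribution M]_x (h x)%:E = (d%:R^-1 * \sum_(k < d) h (ev k))%:E)%E.
Proof.
move=> mh h0; have mhE : measurable_fun setT (EFin \o h) by exact/measurable_EFinP.
rewrite ge0_integral_mscale //; last by move=> x _; rewrite lee_fin.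
rewrite ge0_integral_measure_sum //; last by move=> x _; rewrite lee_fin.
rewrite EFinM -sumEFin; congr (_ * _)%E; apply: eq_bigr => k _.
by rewrite integral_dirac // diracT mul1e.
Qed.

Let integrable_spectral (h : R -> R) : measurable_fun setT h -> (forall x, 0 <= h x) ->
  (spectral_distribution M).-integrable setT (EFin \o h).
Proof.
move=> mh h0; apply/integrableP; split; first exact/measurable_EFinP.
under eq_integral => x _ do rewrite /= ger0_norm //.
by rewrite integral_spectral_ge0 // ltry.
Qed.

(** Writing [g = (g + |g|) - |g|] reduces the claim to nonnegative integrands. *)
Lemma Rintegral_spectral (g : R -> R) : measurable_fun setT g ->
  \int[spectral_distribution M]_x g x = d%:R^-1 * \sum_(k < d) g (ev k).
Proof.
move=> mg; have mn : measurable_fun setT (fun x => `|g x|) by exact: measurableT_comp.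
have mp : measurable_fun setT (fun x => g x + `|g x|) by exact: measurable_funD.
have n0 x : 0 <= `|g x| by [].
have p0 x : 0 <= g x + `|g x| by have := ler_norm (- g x); rewrite normrN; lra.
rewrite (_ : Rintegral _ _ _ = \int[spectral_distribution M]_x ((g x + `|g x|) - `|g x|)).
  rewrite RintegralB //; [|exact: integrable_spectral|exact: integrable_spectral].
  rewrite /Rintegral !integral_spectral_ge0 //= -mulrBr -sumrB; congr (_ * _).
  by apply: eq_bigr => k _; rewrite addrK.
by apply: eq_Rintegral => x _; rewrite addrK.
Qed.

Lemma sum_eigenvalues (g : R -> C) :
  \sum_(k < d) g (ev k) = \sum_i g (Re (spectral_diag M 0 i)).
Proof.
have sz : size (eigenvalues M) = d by rewrite size_map size_enum_ord.
rewrite -(big_mkord xpredT (fun k => g (ev k))) -{1}sz -(big_nth 0 xpredT g).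
by rewrite big_map big_enum.
Qed.

Lemma stieltjes_spectral (z : C) : (0 < d)%N ->
  stieltjes (spectral_distribution M) z =
  (\sum_i ((Re (spectral_diag M 0 i))%:C - z)^-1) / d%:R.
Proof.
move=> d0; have [m1 m2] := cmeasurable_resolvent z.
rewrite -(sum_eigenvalues (fun x => (x%:C - z)^-1)).
have -> : (d%:R : C)^-1 = (d%:R^-1 : R)%:C by rewrite fmorphV rmorph_nat.
apply: complex_eq; rewrite ?Re_mul ?Im_mul /= !Rintegral_spectral // ?Re_sum ?Im_sum;
  by rewrite mulr0 ?subr0 ?add0r mulrC.
Qed.

End SpectralStieltjes.

Section SpectralStieltjesGram.
Variables (R : realType) (d N : nat) (x : nat -> 'cV[R[i]]_d).
Hypothesis d_gt0 : (0 < d)%N.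
Local Notation C := R[i].
Let M := sum_rank_one N x.
Let l i := Re (spectral_diag M 0 i).

Lemma stieltjes_gram (z : C) : 0 < Im z ->
  stieltjes (spectral_distribution M) z = \tr (resolvent (gram N xpredT x) z) / d%:R.
Proof.
move=> z0; rewrite stieltjes_spectral // (tr_resolvent (gram_spectral N xpredT x) z0).
by [].
Qed.

Let d0 : 0 < (d%:R : R). Proof. by rewrite ltr0n. Qed.
Let ncd : nc (d%:R : C)^-1 = d%:R^-1.
Proof. by rewrite ncV -(rmorph_nat (real_complex R)) nc_real ger0_norm ?ler0n. Qed.

Lemma stieltjes_spectral_lip (z z' : C) : 1 <= Im z -> 1 <= Im z' ->
  nc (stieltjes (spectral_distribution M) z - stieltjes (spectral_distribution M) z')
    <= nc (z - z').
Proof.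
move=> z1 z1'; have [z0 z0'] : 0 < Im z /\ 0 < Im z' by split; lra.
rewrite !stieltjes_spectral // -mulrBl -sumrB ncM ncd ler_pdivrMr //.
apply: (le_trans (nc_sum _ _ _)).
apply: (@le_trans _ _ (\sum_(i < d) nc (z - z'))); last first.
  by rewrite sumr_const card_ord mulr_natr.
by apply: ler_sum => i _; exact: nc_resolvent_lip.
Qed.

(** [1 + z / (l - z) = l / (l - z)] is at most [l] in modulus, and the eigenvalues add up to the
    trace, which is [N] for unit vectors. *)
Lemma stieltjes_spectral_tail (z : C) : 1 <= Im z ->
  (forall k, (k < N)%N -> @unit_Csphere R d (x k)) ->
  nc (1 + z * stieltjes (spectral_distribution M) z) <= N%:R / d%:R.
Proof.
move=> z1 xS; have z0 : 0 < Im z by lra.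
have dec := gram_spectral N xpredT x.
have dC0 : (d%:R : C) != 0 by rewrite pnatr_eq0 -lt0n.
rewrite stieltjes_spectral // -/(l _).
have -> : 1 + z * ((\sum_i ((l i)%:C - z)^-1) / d%:R) = (\sum_i (l i)%:C / ((l i)%:C - z)) / d%:R.
  apply: (mulIf dC0); rewrite mulrDl divfK // mulrA divfK // mul1r mulr_sumr.
  rewrite -[d in d%:R]card_ord -sumr_const -big_split /=; apply: eq_bigr => i _.
  by field; rewrite real_sub_neq0 // gt_eqF.
rewrite ncM ncd ler_pM2r ?invr_gt0 //; apply: (le_trans (nc_sum _ _ _)).
have l0 i : 0 <= l i by have [_ _ /(_ i)] := dec.
have trM : \sum_i l i = N%:R.
  have [uP eM _] := dec; apply: (@complexI R).
  transitivity (\tr (gram N xpredT x)).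
    rewrite {1}eM -mulmxA mxtrace_mulC -mulmxA (unitarymxP uP) mulmx1 mxtrace_diag rmorph_sum /=.
    by apply: eq_bigr => i _; rewrite mxE.
  rewrite /gram linear_sum /= rmorph_nat -[N in RHS]card_ord -sumr_const; apply: eq_bigr => k _.
  rewrite mxtrace_mulC /mxtrace big_ord1 mulmx_adj.
  by have /sphere_sum -> := xS k (ltn_ord k).
rewrite -trM; apply: ler_sum => i _; rewrite ncM nc_real ger0_norm //.
by rewrite ler_piMr // (le_trans (nc_resolvent_le _ z0)) // invf_le1.
Qed.

End SpectralStieltjesGram.

(** * Bounds for the Stieltjes transform of the limit law *)

Section MarchenkoPasturStieltjes.
Variables (R : realType) (lam : R) (MP : probability R R).
Hypotheses (lam_ge0 : 0 <= lam) (MP_law : is_marchenko_pastur lam MP).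
Local Notation C := R[i].

Let mm n : R := nc_moment lam n.

Let integrable_cst (k : R) : MP.-integrable setT (EFin \o (fun=> k)).
Proof. exact: finite_measure_integrable_cst. Qed.

Let int_cst (k : R) : \int[MP]_x (fun=> k) x = k.
Proof. by rewrite Rintegral_cst // [X in fine X]probability_setT mulr1. Qed.

Let cintegrable_resolvent z : 1 <= Im z -> cintegrable MP (fun x : R => (x%:C - z)^-1).
Proof.
move=> z1; apply: (cintegrable_dom (h := fun=> 1) (cmeasurable_resolvent z)) => // x.
have z0 : 0 < Im z by exact: lt_le_trans z1.
by rewrite (le_trans (nc_resolvent_le _ z0)) // invf_le1.
Qed.

Lemma mp_stieltjes_le z : 1 <= Im z -> nc (stieltjes MP z) <= 2.
Proof.
move=> z1; have z0 : 0 < Im z by exact: lt_le_trans z1.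
rewrite (_ : 2 = 2 * \int[MP]_x (fun=> 1) x); last by rewrite int_cst mulr1.
apply: (nc_cint_le (f := fun x : R => (x%:C - z)^-1) (h := fun=> 1)) => //.
  exact: cmeasurable_resolvent.
by move=> x; rewrite (le_trans (nc_resolvent_le _ z0)) // invf_le1.
Qed.

Lemma mp_stieltjes_lip z z' : 1 <= Im z -> 1 <= Im z' ->
  nc (stieltjes MP z - stieltjes MP z') <= 2 * nc (z - z').
Proof.
move=> z1 z1'.
have -> : stieltjes MP z - stieltjes MP z' =
    cint MP (fun x : R => (x%:C - z)^-1 + -1 * (x%:C - z')^-1).
  rewrite cintD ?cintM ?mulN1r //; try exact: cintegrable_resolvent.
  by apply: cintegrableM; exact: cintegrable_resolvent.
rewrite -(int_cst (nc (z - z'))); apply: (nc_cint_le (h := fun=> nc (z - z'))) => //.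
  apply: cmeasurableD; first exact: cmeasurable_resolvent.
  by apply: cmeasurableM; [exact: cmeasurable_cst|exact: cmeasurable_resolvent].
by move=> x; rewrite mulN1r; exact: nc_resolvent_lip.
Qed.

Let integrable_sqr : MP.-integrable setT (EFin \o (fun x : R => 1 + x ^+ 2)).
Proof. exact: (integrableD measurableT (integrable_cst 1) (mp_moment MP_law 2).1). Qed.

(** [1 + z / (x - z) = x / (x - z)] is at most [|x|] in modulus. The bound [|x| <= 1 + x^2] replaces
    the first absolute moment by the second moment, which the recursion prescribes. *)
Lemma mp_stieltjes_tail z : 1 <= Im z ->
  nc (1 + z * stieltjes MP z) <= 2 * (1 + mm 2).
Proof.
move=> z1; have z0 : 0 < Im z by exact: lt_le_trans z1.
have ir := cintegrable_resolvent z1.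
have i1 : cintegrable MP (fun=> 1) by split; exact: integrable_cst.
have -> : 1 + z * stieltjes MP z = cint MP (fun x : R => 1 + z * (x%:C - z)^-1).
  rewrite cintD ?cintM //; last exact: cintegrableM.
  by congr (_ + _); apply: complex_eq; rewrite /= int_cst.
have -> : 1 + mm 2 = \int[MP]_x (1 + x ^+ 2).
  by rewrite RintegralD // ?int_cst ?(mp_moment MP_law 2).2 //; exact: (mp_moment MP_law 2).1.
apply: (nc_cint_le (h := fun x : R => 1 + x ^+ 2)) => //.
  apply: cmeasurableD; first exact: cmeasurable_cst.
  by apply: cmeasurableM; [exact: cmeasurable_cst|exact: cmeasurable_resolvent].
move=> x; have -> : 1 + z * (x%:C - z)^-1 = x%:C * (x%:C - z)^-1.
  by field; rewrite real_sub_neq0 // gt_eqF.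
rewrite ncM nc_real; apply: (@le_trans _ _ `|x|).
  by rewrite ler_piMr // (le_trans (nc_resolvent_le _ z0)) // invf_le1.
rewrite -[x ^+ 2]real_normK ?num_real //.
by have := sqr_ge0 (`|x| - 2^-1); lra.
Qed.

(* Jensen's inequality for [1 / y], through the tangent bound [1 / y >= 2 t - t^2 y]
   at the mean [1 / t] of [y = |x - z|^2]. *)
Lemma mp_Im_stieltjes_gt0 z : 1 <= Im z -> 0 < Im (stieltjes MP z).
Proof.
move=> z1; have z0 : 0 < Im z by exact: lt_le_trans z1.
have [_ ir] := cintegrable_resolvent z1.
pose y (x : R) : R := x ^+ 2 + (- (2 * Re z) * x ^+ 1 + (Re z ^+ 2 + Im z ^+ 2)).
have yE x : nc (x%:C - z) ^+ 2 = y x.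
  by rewrite nc_sqr Re_add Re_opp Im_add Im_opp /= /y; ring.
have y0 x : 0 < y x by rewrite -yE exprn_gt0 // nc_gt0 real_sub_neq0 // gt_eqF.
have iy : MP.-integrable setT (EFin \o y).
  have i1 := integrableZl measurableT (- (2 * Re z)) (mp_moment MP_law 1).1.
  have := integrableD measurableT (mp_moment MP_law 2).1
    (integrableD measurableT i1 (integrable_cst (Re z ^+ 2 + Im z ^+ 2))).
  by [].
set Y := \int[MP]_x y x.
have Y0 : 0 < Y.
  apply: (@lt_le_trans _ _ (Im z ^+ 2)); first by rewrite exprn_gt0.
  rewrite -(int_cst (Im z ^+ 2)) /Y; apply: le_Rintegral => // x _.
  by have := sqr_ge0 (x - Re z); rewrite /y; lra.
have il : MP.-integrable setT (EFin \o (fun x => Im z * (2 * Y^-1) + - (Im z * Y^-1 ^+ 2) * y x)).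
  exact: (integrableD measurableT (integrable_cst _)
     (integrableZl measurableT (- (Im z * Y^-1 ^+ 2)) iy)).
apply: (@lt_le_trans _ _ (Im z / Y)); first by rewrite divr_gt0.
have -> : Im z / Y = \int[MP]_x (Im z * (2 * Y^-1) + - (Im z * Y^-1 ^+ 2) * y x).
  rewrite RintegralD //; last exact: (integrableZl measurableT _ iy).
  rewrite int_cst RintegralZl // -/Y; by field; rewrite gt_eqF.
apply: le_Rintegral => // x _; rewrite Im_resolvent yE.
have -> : Im z * (2 * Y^-1) + - (Im z * Y^-1 ^+ 2) * y x =
    Im z * (2 * Y^-1 - Y^-1 ^+ 2 * y x) by ring.
rewrite ler_pM2l // -[leRHS]mul1r ler_pdivlMr //.
by have := sqr_ge0 (1 - Y^-1 * y x); lra.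
Qed.

End MarchenkoPasturStieltjes.

(** The single random quantity on which closeness at a given [z] depends; the deviations are squared
    because variances are what can be bounded. *)
Definition loo_fluctuation (R : realType) (d N : nat) (z : R[i]) (x : nat -> 'cV[R[i]]_d) : R :=
  d%:R^-1 * \sum_(k < N) nc (quad (resolvent (gram N (predC1 (k : nat)) x) z) (x k)
                             - \tr (resolvent (gram N (predC1 (k : nat)) x) z) / d%:R) ^+ 2.

Lemma stieltjes_gram_close (R : realType) (lam : R) (MP : probability R R) (z : R[i]) (eps : R) :
  0 <= lam -> is_marchenko_pastur lam MP -> 1 <= Im z -> 0 < eps ->
  exists eta delta K : R, [/\ 0 < eta, 0 < delta &
    forall (d N : nat) (x : nat -> 'cV[R[i]]_d), (0 < d)%N -> K <= d%:R ->
      `|N%:R / d%:R - lam| <= delta -> loo_fluctuation N z x <= eta ->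
      nc (stieltjes (spectral_distribution (sum_rank_one N x)) z - stieltjes MP z) <= eps].
Proof.
move=> l0 law z1 eps0; have z0 : 0 < Im z by exact: lt_le_trans z1.
have [delta0 dl0 stab] := stieltjes_eq_stable z1 l0 (mp_Im_stieltjes_gt0 law z1)
  (mp_stieltjes_le MP z1) (mp_stieltjes_eq l0 law z1) eps0.
pose B := nc z ^+ 2; have B0 : 0 < B.
  by rewrite exprn_gt0 // nc_gt0; apply: contraTneq z0 => ->; rewrite ltxx.
have l1 : 0 < lam + 1 by rewrite ltr_wpDl.
(* With [B = |z|^2], the error splits into [B c / d], [B c tau] and [B eta / tau]; [K], [tau] and
   [eta] make each at most [delta0 / 4]. The [1] in [Num.min delta0 1] guarantees [c <= lam + 1]. *)
pose tau := delta0 / (4 * B * (lam + 1)).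
have tau0 : 0 < tau by rewrite divr_gt0 // mulr_gt0 // mulr_gt0.
pose eta := delta0 * tau / (4 * B).
have eta0 : 0 < eta by rewrite divr_gt0 // mulr_gt0.
exists eta, (Num.min delta0 1), (4 * B * (lam + 1) / delta0); split => //.
  by rewrite lt_min dl0 ltr01.
move=> d N x d0 Kd; rewrite le_min => /andP[cl cl1] Y_le.
have d0' : 0 < (d%:R : R) by rewrite ltr0n.
set c : R := N%:R / d%:R in cl cl1 *.
have c0 : 0 <= c by rewrite divr_ge0.
have cle : c <= lam + 1.
  by have := ler_norm (c - lam); lra.
rewrite stieltjes_gram //; have [h1 h2 h3] := resolvent_trace_facts N x z1 d0.
apply: (stab _ c) => //; apply: (le_trans (self_consistency_error N x z1 d0)).
rewrite -/B -/c.
pose F (k : 'I_N) : R := nc (quad (resolvent (gram N (predC1 (k : nat)) x) z) (x k)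
  - \tr (resolvent (gram N (predC1 (k : nat)) x) z) / d%:R).
rewrite -[X in d%:R^-1 * X]/(\sum_(k < N) F k).
(* [F <= tau + F^2 / tau] passes from first powers to squares. *)
have hn : d%:R^-1 * \sum_(k < N) F k <= c * tau + eta / tau.
  apply: (@le_trans _ _ (d%:R^-1 * \sum_(k < N) (tau + F k ^+ 2 / tau))).
    rewrite ler_pM2l ?invr_gt0 //; apply: ler_sum => k _.
    rewrite -(ler_pM2r tau0) mulrDl divfK ?gt_eqF //.
    by have := sqr_ge0 (tau - F k); have := sqr_ge0 (F k); nra.
  have e1 : d%:R^-1 * (tau *+ N) = c * tau.
    by rewrite -[_ *+ N]mulr_natl mulrCA (mulrA N%:R).
  rewrite big_split /= sumr_const card_ord -mulr_suml mulrDr e1 lerD2l.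
  by rewrite [leLHS]mulrA ler_pM2r ?invr_gt0.
have t1 : B * (c / d%:R) <= delta0 / 4.
  rewrite mulrA ler_pdivrMr // -(ler_pM2r (_ : 0 < 4 / delta0)) ?divr_gt0 //.
  apply: le_trans (_ : 4 * B * (lam + 1) / delta0 <= _); last first.
    by apply: (le_trans Kd); rewrite le_eqVlt; apply/orP; left; apply/eqP; field; rewrite gt_eqF.
  have -> : B * c * (4 / delta0) = 4 * B * c / delta0 by ring.
  by rewrite ler_pM2r ?invr_gt0 // ler_pM2l // mulr_gt0.
have t2 : B * (c * tau) <= delta0 / 4.
  have -> : delta0 / 4 = B * ((lam + 1) * tau).
    by rewrite /tau; field; rewrite !gt_eqF.
  by rewrite ler_pM2l // ler_pM2r.
have t3 : B * (eta / tau) = delta0 / 4.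
  by rewrite /eta; field; rewrite !gt_eqF.
have := ler_wpM2l (ltW B0) hn; rewrite mulrDr mulrDr; lra.
Qed.

(** * Probability of large leave-one-out fluctuations *)

Section RandomGram.
Variables (R : realType) (disp : measure_display) (T : measurableType disp).
Variables (P : probability T R) (d : nat) (u : nat -> {RV P >-> Cvec R d}).
Local Notation C := R[i].

Let mu k : mx_cmeasurable (fun w => (u k w : 'cV[C]_d)).
Proof.
exact: (@mx_cmeasurable_comp R _ _ T (Cvec R d) d 1 _ (u k) (measurable_funP (u k))
  (@mx_cmeasurable_Cvec R d)).
Qed.

Let x w k : 'cV[C]_d := u k w.

Lemma cmeasurable_stieltjes_gram N z : (0 < d)%N -> 1 <= Im z ->
  cmeasurable (fun w => stieltjes (spectral_distribution (sum_rank_one N (x w))) z).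
Proof.
move=> d0 z1; have z0 : 0 < Im z by exact: lt_le_trans z1.
under eq_fun do rewrite stieltjes_gram //.
apply: cmeasurableM; last exact: cmeasurable_cst.
apply: cmeasurable_tr.
exact: (@mx_cmeasurable_resolvent _ _ T d N xpredT (fun k w => u k w) z z0 (fun k _ => mu k)).
Qed.

Let loo_term N z (k : nat) w := nc (quad (resolvent (gram N (predC1 k) (x w)) z) (x w k)
                             - \tr (resolvent (gram N (predC1 k) (x w)) z) / d%:R) ^+ 2.

Let measurable_loo_term N z k : 1 <= Im z -> measurable_fun setT (loo_term N z k).
Proof.
move=> z1; have z0 : 0 < Im z by exact: lt_le_trans z1.
have mH := @mx_cmeasurable_resolvent _ _ T d N (predC1 k) (fun k w => u k w) z z0 (fun k _ => mu k).
apply: measurable_funX; apply: measurable_nc; apply: cmeasurableD.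
  exact: (cmeasurable_quad mH (mu k)).
apply: cmeasurableN; apply: cmeasurableM; last exact: cmeasurable_cst.
exact: (cmeasurable_tr mH).
Qed.

Lemma measurable_loo_fluctuation N z : 1 <= Im z ->
  measurable_fun setT (fun w => loo_fluctuation N z (x w)).
Proof.
move=> z1; apply: measurable_funM => //; apply: measurable_sum => k.
exact: measurable_loo_term.
Qed.

(** Markov's inequality: [N] variances of order [1 / d], weighted by [1 / d], add up to [N / d]
    times [O(1 / d)]. *)
Lemma loo_fluctuation_tail N z (eta : R) :
  mutually_independent P u -> (forall k, uniform_on_Csphere (distribution P (u k))) ->
  (1 < d)%N -> 1 <= Im z -> 0 < eta ->
  (P [set w | (eta < loo_fluctuation N z (x w))%R] <=
    (N%:R / d%:R * (3 / (d%:R - 1)) / eta)%:E)%E.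
Proof.
move=> indep unif d1 z1 eta0; have mY := measurable_loo_fluctuation N z1.
set Y := fun w => loo_fluctuation N z (x w) in mY *.
have d0' : 0 < (d%:R : R) by rewrite ltr0n ltnW.
have Y0 w : 0 <= Y w.
  by rewrite mulr_ge0 ?invr_ge0 ?ler0n // sumr_ge0 // => k _; exact: sqr_ge0.
set A := [set w | _].
have mA : measurable A.
  rewrite (_ : A = Y @^-1` `]eta, +oo[%classic); last first.
    by apply/seteqP; split => w /=; rewrite in_itv /= andbT.
  by rewrite -[X in measurable X]setTI; exact: mY.
have mYE : measurable_fun setT (EFin \o Y) by exact/measurable_EFinP.
have markov : (eta%:E * P A <= \int[P]_w (Y w)%:E)%E.
  rewrite -integral_cst //.
  apply: (@le_trans _ _ (\int[P]_(w in A) (Y w)%:E)%E).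
    apply: ge0_le_integral => //.
    - by move=> w _; rewrite lee_fin ltW.
    - exact: measurable_funTS.
    - by move=> w; rewrite /A /= lee_fin => /ltW.
  apply: ge0_subset_integral => //.
  by move=> w _; rewrite lee_fin.
have EY : (\int[P]_w (Y w)%:E <= (N%:R / d%:R * (3 / (d%:R - 1)))%:E)%E.
  have mt k := @measurable_loo_term N z k z1.
  have mtE k : measurable_fun setT (fun w => (loo_term N z k w)%:E) by exact/measurable_EFinP.
  have t0 k w : (0 <= (loo_term N z k w)%:E)%E by rewrite lee_fin sqr_ge0.
  have -> : (\int[P]_w (Y w)%:E = (d%:R^-1)%:E * \sum_(k < N) \int[P]_w (loo_term N z k w)%:E)%E.
    rewrite -ge0_integral_sum // -ge0_integralZl //.
    - by apply: eq_integral => w _; rewrite /Y /loo_fluctuation EFinM -sumEFin.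
    - by apply: emeasurable_sum => k; exact: mtE.
    - by move=> w _; apply: sume_ge0 => k _; exact: t0.
  apply: (@le_trans _ _ ((d%:R^-1)%:E * \sum_(k < N) (3 / (d%:R - 1))%:E)%E).
    apply: lee_wpmul2l; first by rewrite lee_fin invr_ge0 ler0n.
    by apply: lee_sum => k _; exact: leave_one_out_variance.
  by rewrite sumEFin sumr_const card_ord -EFinM lee_fin -[_ *+ N]mulr_natl mulrCA mulrA.
have PA : P A = (fine (P A))%:E by rewrite fineK // fin_num_measure.
move: (le_trans markov EY); rewrite PA -EFinM !lee_fin => h.
by rewrite ler_pdivlMr // mulrC.
Qed.

End RandomGram.

Lemma union_bound (R : realType) (disp : measure_display) (T : measurableType disp)
    (P : probability T R) (I : eqType) (s : seq I) (B : I -> set T) (A : set T) (e : R) :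
  measurable A -> (forall i, i \in s -> measurable (B i)) ->
  (forall i, i \in s -> (P (B i) <= e%:E)%E) ->
  (forall w, A w -> exists2 i, i \in s & B i w) ->
  (P A <= ((size s)%:R * e)%:E)%E.
Proof.
elim: s A => [|i s IH] A mA mB PB AB.
  rewrite (_ : A = set0) ?measure0 ?mul0r //.
  by apply/seteqP; split => // w /AB[].
have mBi : measurable (B i) by apply: mB; rewrite inE eqxx.
rewrite (measureDI P mA mBi) /= -[(size s).+1]addn1 natrD mulrDl mul1r EFinD.
apply: leeD.
  apply: IH; first exact: measurableD.
  - by move=> j js; apply: mB; rewrite inE js orbT.
  - by move=> j js; apply: PB; rewrite inE js orbT.
  by move=> w [/AB[j]]; rewrite inE => /orP[/eqP -> //|js Bj _]; exists j.
apply: (@le_trans _ _ (P (B i))); last by apply: PB; rewrite inE eqxx.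
by apply: le_measure; rewrite ?inE //; exact: measurableI.
Qed.

(** * Finite and countable nets in the half plane [1 <= Im z] *)

Section Net.
Variable R : realType.

Definition grid (K h : R) (p : nat * nat) : R[i] :=
  (p.1%:R * h - K) +i* (1 + p.2%:R * h).

Lemma Im_grid K h p : 0 <= h -> 1 <= Im (grid K h p).
Proof. by move=> h0 /=; rewrite lerDl mulr_ge0. Qed.

Lemma near_multiple (h K r : R) : 0 < h -> 0 <= r <= K ->
  exists2 i : nat, (i < (Num.truncn (K / h)).+1)%N & `|r - i%:R * h| <= h.
Proof.
move=> h0 /andP[r0 rK]; have q0 : 0 <= r / h by rewrite divr_ge0 // ltW.
exists (Num.truncn (r / h)).
  by rewrite ltnS le_truncn // ler_pM2r ?invr_gt0.
have /andP[h1 h2] := truncn_itv q0; rewrite -natr1 in h2.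
rewrite -[r in r - _](divfK (x := h)) ?gt_eqF // -mulrBl normrM (gtr0_norm h0).
by rewrite ler_piMl ?(ltW h0) // ler_norml; apply/andP; split; lra.
Qed.

Lemma grid_net (K h : R) (z : R[i]) : 0 < h -> 1 <= Im z -> nc z <= K ->
  let L := (Num.truncn (2 * K / h)).+1 in
  exists2 p, (p.1 < L)%N && (p.2 < L)%N & nc (z - grid K h p) <= 2 * h.
Proof.
move=> h0 z1 zK L.
have := le_trans (ler_Re_nc z) zK; rewrite ler_norml => /andP[r1 r2].
have := le_trans (ler_Im_nc z) zK; rewrite ler_norml => /andP[i1 i2].
have [i iL hi] : exists2 i : nat, (i < L)%N & `|(Re z + K) - i%:R * h| <= h.
  by apply: near_multiple => //; apply/andP; split; lra.
have [j jL hj] : exists2 j : nat, (j < L)%N & `|(Im z - 1) - j%:R * h| <= h.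
  by apply: near_multiple => //; apply/andP; split; lra.
exists (i, j); first by rewrite iL jL.
apply: nc_le_ReIm_eps; rewrite ?Re_add ?Re_opp ?Im_add ?Im_opp /=.
  by move: hi; rewrite opprB addrA.
by move: hj; rewrite opprD addrA.
Qed.

(** The absolute value puts every pair of rationals into the half plane [1 <= Im z], so that
    countable unions over these points need no side condition. *)
Definition rational_point (q : rat * rat) : R[i] := ratr q.1 +i* (1 + `|ratr q.2|).

Lemma rational_point_dense (z : R[i]) (h : R) : 0 < h -> 1 <= Im z ->
  exists q, nc (z - rational_point q) <= 2 * h.
Proof.
move=> h0 z1.
have [q1] : exists q, ratr q \in `]Re z - h, Re z + h[.
  by apply: rat_in_itvoo; lra.
rewrite in_itv /= => /andP[a1 a2].
have [q2] : exists q, ratr q \in `]Im z - 1, Im z - 1 + h[.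
  by apply: rat_in_itvoo; lra.
rewrite in_itv /= => /andP[b1 b2].
exists (q1, q2); apply: nc_le_ReIm_eps; rewrite ?Re_add ?Re_opp ?Im_add ?Im_opp /=.
  by rewrite ler_norml; apply/andP; split; lra.
by rewrite (gtr0_norm (_ : 0 < ratr q2)) ?ler_norml; [apply/andP; split|]; lra.
Qed.

End Net.

(** * Reduction of the distance to countably or finitely many points *)

Section DistanceEvent.
Variables (R : realType) (lam : R) (MP : probability R R).
Hypotheses (lam_ge0 : 0 <= lam) (MP_law : is_marchenko_pastur lam MP).
Variables (d N : nat).
Hypothesis d_gt0 : (0 < d)%N.
Local Notation C := R[i].

Definition stieltjes_gap (x : nat -> 'cV[C]_d) (z : C) : R :=
  nc (stieltjes (spectral_distribution (sum_rank_one N x)) z - stieltjes MP z).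

Lemma stieltjes_gap_lip x z z' : 1 <= Im z -> 1 <= Im z' ->
  stieltjes_gap x z <= stieltjes_gap x z' + 3 * nc (z - z').
Proof.
move=> z1 z1'; rewrite /stieltjes_gap; set s := stieltjes (spectral_distribution _).
have -> : s z - stieltjes MP z = (s z' - stieltjes MP z') +
   ((s z - s z') - (stieltjes MP z - stieltjes MP z')) by ring.
apply: (le_trans (ncD _ _)); rewrite lerD2l; apply: (le_trans (ncD _ _)).
have := stieltjes_spectral_lip N x d_gt0 z1 z1'.
by have := mp_stieltjes_lip MP z1 z1'; rewrite ncN -/s; lra.
Qed.

(** Makes the event measurable: the supremum runs over uncountably many [z], but by the Lipschitz
    bound countably many points detect that it exceeds [eps]. *)
Lemma dist_gtP x (eps : R) :
  (eps%:E < dist (spectral_distribution (sum_rank_one N x)) MP)%E <->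
  exists q, eps < stieltjes_gap x (rational_point R q).
Proof.
split => [/ereal_sup_gt[_ [z z1 <-]]|[q q_gt]].
  rewrite lte_fin -/(stieltjes_gap x z) => gt; have {}z1 : 1 <= Im z by [].
  (* The Lipschitz constant [3] times the distance [2 * h] loses half of the excess over [eps]. *)
  pose h := (stieltjes_gap x z - eps) / 12.
  have h0 : 0 < h by rewrite divr_gt0 // subr_gt0.
  have [q qz] := rational_point_dense h0 z1; exists q.
  have q1 : 1 <= Im (rational_point R q) by rewrite /= lerDl.
  have := stieltjes_gap_lip x z1 q1; move: qz; rewrite /h; lra.
apply: (@lt_le_trans _ _ (stieltjes_gap x (rational_point R q))%:E).
  by rewrite lte_fin.
apply: ereal_sup_ubound; exists (rational_point R q) => //=.
by rewrite lerDl.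
Qed.

(** Bounds [|z|] times the gap: [lam + 1] comes from the Gram matrix, whose ratio is assumed to be
    at most that, and the rest from the limit law. *)
Let tail_cst := lam + 1 + 2 * (1 + nc_moment lam 2).

(** Where the gap exceeds [eps], the tail bounds force [|z| <= K], which confines [z] to a bounded
    region. With mesh [eps / 12], moving to the grid costs at most [3 * (2 * h) = eps / 2]. *)
Lemma dist_net x (eps : R) (h := eps / 12) (K := tail_cst / eps)
    (L := (Num.truncn (2 * K / h)).+1) : 0 < eps ->
  N%:R / d%:R <= lam + 1 -> (forall k, (k < N)%N -> @unit_Csphere R d (x k)) ->
  (eps%:E < dist (spectral_distribution (sum_rank_one N x)) MP)%E ->
  exists2 p, (p.1 < L)%N && (p.2 < L)%N & eps / 2 < stieltjes_gap x (grid K h p).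
Proof.
move=> eps0 cl xS /ereal_sup_gt[_ [z z1 <-]].
rewrite lte_fin -/(stieltjes_gap x z) => gt; have {}z1 : 1 <= Im z by [].
have h0 : 0 < h by rewrite divr_gt0.
have zK : nc z <= K.
  rewrite /K ler_pdivlMr //; apply: le_trans (_ : nc z * stieltjes_gap x z <= _).
    by rewrite ler_wpM2l ?nc_ge0 // ltW.
  rewrite /stieltjes_gap -ncM; set s := stieltjes (spectral_distribution _) z.
  have -> : z * (s - stieltjes MP z) = (1 + z * s) - (1 + z * stieltjes MP z) by ring.
  apply: (le_trans (ncD _ _)); rewrite ncN; apply: lerD.
    exact: le_trans (stieltjes_spectral_tail d_gt0 z1 xS) cl.
  exact: mp_stieltjes_tail.
have [p pL pz] := grid_net h0 z1 zK; exists p => //.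
have g1 := Im_grid K p (ltW h0).
have := stieltjes_gap_lip x z1 g1; move: pz; rewrite /h; lra.
Qed.

End DistanceEvent.

Lemma measurable_gt (R : realType) (disp : measure_display) (T : measurableType disp)
  (f : T -> R) (e : R) : measurable_fun setT f -> measurable [set w | e < f w].
Proof.
move=> mf; rewrite (_ : [set w | _] = f @^-1` `]e, +oo[%classic); last first.
  by apply/seteqP; split => w /=; rewrite in_itv /= andbT.
by rewrite -[X in measurable X]setTI; exact: mf.
Qed.

Section RandomDistance.
Variables (R : realType) (lam : R) (MP : probability R R).
Hypotheses (lam_ge0 : 0 <= lam) (MP_law : is_marchenko_pastur lam MP).
Variables (disp : measure_display) (T : measurableType disp).
Variables (P : probability T R) (d N : nat) (u : nat -> {RV P >-> Cvec R d}).
Hypothesis d_gt0 : (0 < d)%N.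

Lemma measurable_gap_gt z (e : R) : 1 <= Im z ->
  measurable [set w | e < stieltjes_gap MP N (fun k => u k w) z].
Proof.
move=> z1; apply: measurable_gt; apply: measurable_nc; apply: cmeasurableD.
  exact: (cmeasurable_stieltjes_gram u N d_gt0 z1).
exact: cmeasurable_cst.
Qed.

Lemma measurable_dist_gt (e : R) :
  measurable [set w | (e%:E < dist (spectral_distribution
    (sum_rank_one N (fun k => u k w))) MP)%E].
Proof.
rewrite (_ : [set w | _] = \bigcup_(k : nat)
   (if unpickle k is Some q then
      [set w | e < stieltjes_gap MP N (fun k => u k w) (rational_point R q)] else set0)).
  apply: bigcupT_measurable => k; case: unpickle => [q|]; last exact: measurable0.
  by apply: measurable_gap_gt; rewrite /= lerDl.
apply/seteqP; split => [w /(dist_gtP MP N d_gt0)[q eq]|w [k _]].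
  by exists (pickle q); [exact: I | rewrite pickleK; exact: eq].
by case: (unpickle k) => [q eq|[]]; apply/(dist_gtP MP N d_gt0); exists q.
Qed.

End RandomDistance.

(** * Convergence in probability *)

Section Convergence.
Variable R : realType.
Variables (disp : nat -> measure_display) (T : forall d : nat, measurableType (disp d)).
Variables (P : forall d : nat, probability (T d) R).
Variables (u : forall d : nat, nat -> {RV (P d) >-> Cvec R d}).
Hypothesis u_indep : forall d : nat, (1 <= d)%N -> mutually_independent (P d) (u d).
Hypothesis u_unif : forall d k : nat, (1 <= d)%N ->
  uniform_on_Csphere (distribution (P d) (u d k)).
Variables (lam : R) (MP : probability R R).
Hypotheses (lam_ge0 : 0 <= lam) (MP_law : is_marchenko_pastur lam MP).
Variables (d d' : nat -> nat).
Hypothesis d_cvg : d n @[n --> \oo] --> \oo.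
Hypothesis ratio_cvg : ((d' n)%:R / (d n)%:R : R) @[n --> \oo] --> lam.

Let near_d (A : R) : \forall n \near \oo, A <= (d n)%:R.
Proof. exact: (d_cvg (nbhs_infty_ger A)). Qed.

Let near_ratio (e : R) : 0 < e -> \forall n \near \oo, `|(d' n)%:R / (d n)%:R - lam| <= e.
Proof.
move=> e0; have /cvgrPdist_le /(_ _ e0) := ratio_cvg.
by apply: filterS => n; rewrite distrC.
Qed.

Lemma stieltjes_gap_cvg z (eps e : R) : 1 <= Im z -> 0 < eps -> 0 < e ->
  \forall n \near \oo,
    (P (d n) [set w | (eps < stieltjes_gap MP (d' n) (fun k => u (d n) k w) z)%R] <= e%:E)%E.
Proof.
move=> z1 eps0 e0.
have [eta [delta [K [eta0 dl0 close]]]] := stieltjes_gram_close lam_ge0 MP_law z1 eps0.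
near=> n.
have d2 : (1 < d n)%N.
  by rewrite -(ltr_nat R); apply: (@lt_le_trans _ _ 2); [lra|near: n; exact: near_d].
have d1 : (0 < d n)%N by exact: ltnW.
have cl : `|(d' n)%:R / (d n)%:R - lam| <= delta by near: n; exact: near_ratio.
have cl1 : `|(d' n)%:R / (d n)%:R - lam| <= 1 by near: n; exact: near_ratio.
have Kd : K <= (d n)%:R by near: n; exact: near_d.
(* Makes the tail bound [3 c / ((d - 1) eta)], with [c <= lam + 1], at most [e]. *)
have bigd : 1 + (lam + 1) * 3 / (e * eta) <= (d n)%:R by near: n; exact: near_d.
apply: (@le_trans _ _ (P (d n) [set w | (eta < loo_fluctuation (d' n) z (fun k => u (d n) k w))%R])).
  apply: le_measure; rewrite ?inE.
  - exact: measurable_gap_gt.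
  - by apply: measurable_gt; exact: measurable_loo_fluctuation.
  move=> w /=; rewrite !ltNge; apply: contra => le.
  exact: (close (d n) (d' n)).
apply: le_trans (loo_fluctuation_tail (d' n) (u_indep d1) (fun k => u_unif k d1) d2 z1 eta0) _.
rewrite lee_fin; set c := (d' n)%:R / (d n)%:R in cl cl1 *.
have dgt : (1 : R) < (d n)%:R by rewrite ltr1n.
have cle : c <= lam + 1 by have := ler_norm (c - lam); lra.
have ee : 0 < e * eta by exact: mulr_gt0.
have h : (lam + 1) * 3 <= e * eta * ((d n)%:R - 1).
  by rewrite -ler_pdivrMl // mulrC; lra.
rewrite mulrA !ler_pdivrMr ?subr_gt0 //.
by apply: le_trans (_ : (lam + 1) * 3 <= _); [rewrite ler_pM2r|lra].
Unshelve. all: by end_near. Qed.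

(** The vectors have length [1] only almost surely, whereas the tail bound for the spectral
    distribution needs it exactly; the exceptional event is set aside here. *)
Lemma off_sphere_null n : (0 < d n)%N ->
  let A := [set w | exists2 k, (k < d' n)%N & ~ @unit_Csphere R (d n) (u (d n) k w)] in
  measurable A /\ P (d n) A = 0%E.
Proof.
move=> d1 A; pose B k := u (d n) k @^-1` ~` @unit_Csphere R (d n).
have mS := @measurable_sphere R (d n).
have mB k : measurable (B k).
  rewrite -[X in measurable X]setTI.
  exact: (measurable_funP (u (d n) k) measurableT _ (measurableC mS)).
have mA : measurable A.
  rewrite (_ : A = \bigcup_(k in `I_(d' n)) B k); first by apply: bigcup_measurable => k _.
  by apply/seteqP; split => w [k kn] Bk; exists k.
split => //; apply/eqP; rewrite eq_le measure_ge0 andbT.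
have -> : (0 = ((size (iota 0 (d' n)))%:R * 0)%:E :> \bar R)%E by rewrite mulr0.
apply: (union_bound (B := B)) => // [k _|w [k kn Bk]]; last by exists k; rewrite ?mem_iota.
have [mu1 _] := u_unif k d1.
have : (distribution (P (d n)) (u (d n) k)) (~` @unit_Csphere R (d n)) = 0%E.
  by rewrite probability_setC // mu1 subee.
by rewrite /distribution /pushforward => ->.
Qed.

Lemma stieltjes_gap_cvg_seq (s : seq R[i]) (eps e : R) : 0 < eps -> 0 < e ->
  \forall n \near \oo, forall z, z \in s -> 1 <= Im z ->
    (P (d n) [set w | (eps < stieltjes_gap MP (d' n) (fun k => u (d n) k w) z)%R] <= e%:E)%E.
Proof.
move=> eps0 e0; elim: s => [|z0 s IH]; first exact: nearW.
have [z1|z1] := boolP (1 <= Im z0); last first.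
  apply: filterS IH => n IH z; rewrite inE => /orP[/eqP ->|]; last exact: IH.
  by rewrite (negPf z1).
apply: filterS2 (stieltjes_gap_cvg z1 eps0 e0) IH => n h0 IH z.
by rewrite inE => /orP[/eqP -> //|]; exact: IH.
Qed.

Lemma dist_cvg (eps e : R) : 0 < eps -> 0 < e -> \forall n \near \oo,
  (P (d n) [set w | (eps%:E <
      dist (spectral_distribution (sum_rank_one (d' n) (fun k => u (d n) k w))) MP)%E] <= e%:E)%E.
Proof.
move=> eps0 e0.
pose h := eps / 12; have h0 : 0 < h by rewrite divr_gt0.
pose K := (lam + 1 + 2 * (1 + nc_moment lam 2)) / eps.
pose L := (Num.truncn (2 * K / h)).+1.
pose net := [seq (i, j) | i <- iota 0 L, j <- iota 0 L].
(* One share for each point of the net and one for the exceptional null event, which [None] stands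
   for below. *)
pose e1 := e / (size net).+1%:R.
have e10 : 0 < e1 by rewrite divr_gt0.
have eps2 : 0 < eps / 2 by rewrite divr_gt0.
near=> n.
have d1 : (0 < d n)%N by rewrite -(ler_nat R); near: n; exact: near_d.
have cl1 : `|(d' n)%:R / (d n)%:R - lam| <= 1 by near: n; exact: near_ratio.
have small : forall z, z \in [seq grid K h p | p <- net] -> 1 <= Im z ->
    (P (d n) [set w | (eps / 2 < stieltjes_gap MP (d' n) (fun k => u (d n) k w) z)%R]
     <= e1%:E)%E.
  by near: n; exact: stieltjes_gap_cvg_seq.
have cle : (d' n)%:R / (d n)%:R <= lam + 1.
  by have := ler_norm ((d' n)%:R / (d n)%:R - lam); lra.
have [mO PO] := off_sphere_null d1.
set O := [set w | exists2 k, _ & _] in mO PO.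
pose B (o : option (nat * nat)) := if o is Some p then
  [set w | eps / 2 < stieltjes_gap MP (d' n) (fun k => u (d n) k w) (grid K h p)] else O.
have mem_net p : (Some p \in None :: map Some net) = (p \in net).
  by rewrite inE mem_map //; move=> ? ? [].
have -> : e = (size (None :: map Some net))%:R * e1.
  by rewrite /= size_map mulrC divfK // pnatr_eq0.
apply: (union_bound (B := B)).
- exact: measurable_dist_gt.
- case=> [p|] _ //; apply: measurable_gap_gt => //.
  exact: Im_grid (ltW h0).
- case=> [p|_]; last by rewrite /= PO lee_fin ltW.
  rewrite mem_net => pnet; apply: small; last exact: Im_grid (ltW h0).
  exact: map_f.
move=> w dw; have [Ow|nOw] := pselect (O w); first by exists None.
have xS k : (k < d' n)%N -> @unit_Csphere R (d n) (u (d n) k w).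
  by move=> kn; apply: contrapT => nS; apply: nOw; exists k.
have [p /andP[p1 p2] gap] := dist_net MP_law d1 eps0 cle xS dw.
exists (Some p); rewrite ?mem_net //.
by case: p p1 p2 {gap} => i j /= iL jL; apply: allpairs_f; rewrite mem_iota.
Unshelve. all: by end_near. Qed.

End Convergence.

Theorem proposition5p3 (R : realType)
  (disp : nat -> measure_display) (T : forall d : nat, measurableType (disp d))
  (P : forall d : nat, probability (T d) R)
  (u : forall d : nat, nat -> {RV (P d) >-> Cvec R d})
  (u_indep : forall d : nat, (1 <= d)%N -> mutually_independent (P d) (u d))
  (u_unif : forall d k : nat, (1 <= d)%N ->
     uniform_on_Csphere (distribution (P d) (u d k)))
  (lambda : R) (lambda_ge0 : 0 <= lambda)
  (MP : probability R R) (MP_law : is_marchenko_pastur lambda MP)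
  (d d' : nat -> nat)
  (d_cvg : d n @[n --> \oo] --> \oo) (d'_cvg : d' n @[n --> \oo] --> \oo)
  (ratio_cvg : ((d' n)%:R / (d n)%:R : R) @[n --> \oo] --> lambda) :
  forall eps : R, 0 < eps ->
    P (d n) [set w | (eps%:E <
      dist (spectral_distribution (sum_rank_one (d' n) (fun k => u (d n) k w)))
           MP)%E]
    @[n --> \oo] --> 0%E.
Proof.
move=> eps eps0.
have small e : 0 < e -> \forall n \near \oo, (P (d n) [set w | (eps%:E <
    dist (spectral_distribution (sum_rank_one (d' n) (fun k => u (d n) k w))) MP)%E] <= e%:E)%E.
  exact: (dist_cvg u_indep u_unif lambda_ge0 MP_law d_cvg ratio_cvg eps0).
apply/fine_cvgP; split.
  apply: filterS (small 1 ltr01) => n le1.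
  by rewrite ge0_fin_numE ?measure_ge0 // (le_lt_trans le1) // ltry.
apply/cvgrPdist_le => e e0; apply: filterS (small e e0) => n le_e.
rewrite /= sub0r normrN ger0_norm ?fine_ge0 ?measure_ge0 //.
by rewrite -lee_fin fineK // ge0_fin_numE ?measure_ge0 // (le_lt_trans le_e) // ltry.
Qed.
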